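(* There are only two real forms of the complex Lie algebra $\mathrm{Der}(\mathcal{C})$ up to isomorphism, where $\mathcal{C}$ is the complex octonion algebra; namely, $\mathrm{Der}(\mathbb{R}^7,\Omega_0)\cong\mathfrak{g}_{2,2}$ and $\mathrm{Der}(\mathbb{R}^7,\Omega_1)\cong\mathfrak{g}_{2,-14}$.
   Context: For a 3-form $\Omega$ on a vector space $V$, $\mathrm{Der}(V,\Omega)=\{f\in\mathfrak{gl}(V):\Omega(f(X),Y,Z)+\Omega(X,f(Y),Z)+\Omega(X,Y,f(Z))=0\ \forall X,Y,Z\in V\}$. With $\{E_0,E_1,E_2,E_3,F_1,F_2,F_3\}$ the canonical basis of $\mathbb{F}^7$ ($\mathbb{F}=\mathbb{R}$ or $\mathbb{C}$), $\Omega_0=-2\sum_{i=1}^3E_0^*\wedge E_i^*\wedge F_i^*-4E_1^*\wedge E_2^*\wedge E_3^*+4F_1^*\wedge F_2^*\wedge F_3^*$. With $\{e_i^*\}_{i=1}^7$ a basis of $(\mathbb{R}^7)^*$ and $e^{ijk}=e_i^*\wedge e_j^*\wedge e_k^*$, $\Omega_1=e^{147}+e^{257}+e^{367}+e^{123}-e^{156}+e^{246}-e^{345}$. The complex octonion algebra is $\mathcal{C}=\mathbb{C}1\oplus\mathbb{C}^7$ with unit $1$ and $XY=-n(X,Y)1+X\times Y$ for $X,Y\in\mathbb{C}^7$, where, writing vectors as $(s,u,v)$ with $s\in\mathbb{C}$, $u,v\in\mathbb{C}^3$, $n$ is the symmetric bilinear form with quadratic form $n(s,u,v)=-s^2-4u^tv$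 and $n(X\times Y,Z)=\Omega_0(X,Y,Z)$; $\mathrm{Der}(\mathcal{C})=\{d\in\mathfrak{gl}(\mathcal{C}):d(XY)=d(X)Y+Xd(Y)\}$ is the simple complex Lie algebra of type $G_2$. A real form of a complex Lie algebra $\mathfrak{g}$ is a real Lie algebra $L$ with $L\otimes_{\mathbb{R}}\mathbb{C}\cong\mathfrak{g}$. $\mathfrak{g}_{2,2}$ denotes the split real Lie algebra of type $G_2$ (Killing form of signature $2$), and $\mathfrak{g}_{2,-14}$ the compact real Lie algebra of type $G_2$ (Killing form negative definite, signature $-14$). *)

(* Defs.v *)
From HB Require Import structures.
From mathcomp Require Import all_boot all_order all_algebra.
From mathcomp Require Import boolp reals.
From mathcomp Require Import complex.
From mathcomp Require Import ssrAC ring.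

Set Implicit Arguments.
Unset Strict Implicit.
Unset Printing Implicit Defensive.

Import Order.TTheory GRing.Theory Num.Theory.
Local Open Scope ring_scope.

HB.mixin Record Lmodule_isLie (F : fieldType) L of GRing.Lmodule F L := {
  lbr : L -> L -> L;
  lbr_linearl : forall y : L, linear (lbr^~ y);
  lbr_linearr : forall x : L, linear (lbr x);
  lbrxx : forall x : L, lbr x x = 0;
  lbr_jacobi : forall x y z : L,
    lbr x (lbr y z) + lbr y (lbr z x) + lbr z (lbr x y) = 0
}.

#[short(type="lieAlgType")]
HB.structure Definition LieAlgebra (F : fieldType) :=
  {L of Lmodule_isLie F L & GRing.Lmodule F L}.

#[short(type="lieVectType")]
HB.structure Definition LieVector (F : fieldType) :=
  {L of Lmodule_isLie F L & Vector F L}.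

Definition lie_iso (F : fieldType) (A B : lieAlgType F) : Prop :=
  exists phi : {linear A -> B},
    bijective phi /\ forall x y : A, phi (lbr x y) = lbr (phi x) (phi y).

Section LieTheory.
Variables (F : fieldType) (L : lieAlgType F).
Implicit Types x y z : L.

HB.instance Definition _ x := GRing.isSemilinear.Build F L L _ (lbr x)
  (GRing.semilinear_linear (lbr_linearr x)).

Lemma lbrDl x y z : lbr (x + y) z = lbr x z + lbr y z.
Proof. by have := lbr_linearl z 1 x y; rewrite !scale1r. Qed.

Lemma lbrDr x y z : lbr x (y + z) = lbr x y + lbr x z.
Proof. exact: linearD. Qed.

Lemma lbr0l x : lbr 0 x = 0.
Proof.
by have := lbr_linearl x (-1) 0 0; rewrite scaler0 addr0 scaleN1r addNr.
Qed.

Lemma lbrZl a x y : lbr (a *: x) y = a *: lbr x y.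
Proof. by have := lbr_linearl y a x 0; rewrite !addr0 lbr0l addr0. Qed.

Lemma lbrZr a x y : lbr x (a *: y) = a *: lbr x y.
Proof. exact: linearZ. Qed.

Lemma lbrNl x y : lbr (- x) y = - lbr x y.
Proof. by rewrite -scaleN1r lbrZl scaleN1r. Qed.

Lemma lbrNr x y : lbr x (- y) = - lbr x y.
Proof. exact: linearN. Qed.

Lemma lbrC x y : lbr x y = - lbr y x.
Proof.
have := lbrxx (x + y); rewrite lbrDl !lbrDr !lbrxx add0r addr0 => /eqP.
by rewrite addr_eq0 => /eqP.
Qed.

End LieTheory.

Record lieSubalg (F : fieldType) (L : lieAlgType F) := LieSubalg {
  lsub_mem :> L -> Prop;
  lsub0 : lsub_mem 0;
  lsubP : forall (a : F) x y, lsub_mem x -> lsub_mem y -> lsub_mem (a *: x + y);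
  lsub_lbr : forall x y, lsub_mem x -> lsub_mem y -> lsub_mem (lbr x y)
}.

Section SubLie.
Variables (F : fieldType) (L : lieAlgType F) (S : lieSubalg L).

Definition lsub_pred (x : L) : bool := `[< S x >].

Lemma lsub_predE x : (x \in lsub_pred) = `[< S x >].
Proof. by []. Qed.

Fact lsub_submod : subsemimod_closed lsub_pred.
Proof.
split; first split.
- by apply/asboolP; exact: lsub0.
- move=> x y /asboolP Sx /asboolP Sy; apply/asboolP.
  by rewrite -(scale1r x); exact: lsubP.
- move=> a x /asboolP Sx; apply/asboolP.
  by rewrite -(addr0 (a *: x)); apply: lsubP => //; exact: lsub0.
Qed.
HB.instance Definition _ := GRing.isSubmodClosed.Build F L lsub_pred lsub_submod.

Record sub_lie : predArgType :=
  SubLie { sub_lie_val : L; sub_lieP : sub_lie_val \in lsub_pred }.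

HB.instance Definition _ := [isSub for sub_lie_val].
HB.instance Definition _ := [Choice of sub_lie by <:].
HB.instance Definition _ := [SubChoice_isSubZmodule of sub_lie by <:].
HB.instance Definition _ := [SubZmodule_isSubLmodule of sub_lie by <:].

Fact sub_lbr_subproof (x y : sub_lie) :
  lbr (sub_lie_val x) (sub_lie_val y) \in lsub_pred.
Proof.
case: x y => [x Sx] [y Sy]; apply/asboolP => /=.
by apply: lsub_lbr; apply/asboolP.
Qed.
Definition sub_lbr (x y : sub_lie) : sub_lie := SubLie (sub_lbr_subproof x y).

Fact sub_lbr_linearl y : linear (sub_lbr^~ y).
Proof. by move=> a x x'; apply: val_inj; rewrite /= lbrDl lbrZl. Qed.
Fact sub_lbr_linearr x : linear (sub_lbr x).
Proof. by move=> a y y'; apply: val_inj; rewrite /= lbrDr lbrZr. Qed.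
Fact sub_lbrxx x : sub_lbr x x = 0.
Proof. by apply: val_inj; rewrite /= lbrxx. Qed.
Fact sub_lbr_jacobi x y z :
  sub_lbr x (sub_lbr y z) + sub_lbr y (sub_lbr z x) + sub_lbr z (sub_lbr x y)
  = 0.
Proof. by apply: val_inj; rewrite /= lbr_jacobi. Qed.

HB.instance Definition _ := Lmodule_isLie.Build F sub_lie
  sub_lbr_linearl sub_lbr_linearr sub_lbrxx sub_lbr_jacobi.

End SubLie.

Coercion sub_lie : lieSubalg >-> predArgType.

Section SubLieVector.
Variables (F : fieldType) (L : lieVectType F) (S : lieSubalg L).

Lemma lsub_vspace : exists U : {vspace L}, forall x, (x \in U) = `[< S x >].
Proof.
pose sub (U : {vspace L}) := forall x, x \in U -> S x.
pose P n := `[< exists2 U, sub U & \dim U = n >].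
have exP : exists n, P n.
  exists 0%N; apply/asboolP; exists 0%VS; last exact: dimv0.
  by move=> x; rewrite memv0 => /eqP->; exact: lsub0.
have ubP n : P n -> (n <= \dim {:L})%N.
  by move=> /asboolP[U _ <-]; apply/dimvS/subvf.
case: (ex_maxnP exP ubP) => n /asboolP[U sU dU] maxn.
exists U => x; apply/idP/asboolP; first exact: sU.
move=> Sx; apply/negP => /negP xU.
have sUx : sub (U + <[x]>)%VS.
  move=> y /memv_addP[u uU [v /vlineP[a ->] ->]].
  by rewrite addrC; apply: lsubP => //; exact: sU.
have := maxn (\dim (U + <[x]>)) _; rewrite -dU leqNgt => /(_ _)/negP; apply.
  by apply/asboolP; exists (U + <[x]>)%VS.
rewrite ltnNge; apply: contra xU => le.
have /eqP -> : U == (U + <[x]>)%VS by rewrite eqEdim addvSl.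
by rewrite (subvP (addvSr _ _))// memv_line.
Qed.

Fact sub_lie_vect_iso : {n & Vector.axiom n (sub_lie S)}.
Proof.
have [U memU] := cid lsub_vspace; exists (\dim U).
have inU (w : sub_lie S) : val w \in U by rewrite memU; case: w.
exists (fun w : sub_lie S => \row_i coord (vbasis U) i (val w)).
  by move=> k w1 w2; apply/rowP=> i; rewrite !mxE linearP.
have vU (rw : 'rV_(\dim U)) : \sum_i rw 0 i *: (vbasis U)`_i \in U.
  by apply: rpred_sum => j _; rewrite rpredZ ?vbasis_mem ?memt_nth.
have vS (rw : 'rV_(\dim U)) : \sum_i rw 0 i *: (vbasis U)`_i \in lsub_pred S.
  by rewrite lsub_predE -memU.
exists (fun rw => SubLie (vS rw)).
  move=> w /=; apply: val_inj; rewrite /= [RHS](coord_vbasis (inU w)).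
  by apply: eq_bigr => i _; rewrite mxE.
move=> rw; apply/rowP=> i.
by rewrite mxE /= coord_sum_free ?(basis_free (vbasisP U)).
Qed.

HB.instance Definition _ :=
  Lmodule_hasFinDim.Build F (sub_lie S) (projT2 sub_lie_vect_iso).

End SubLieVector.

Definition gl (F : fieldType) (V : vectType F) : Type := 'End(V).

Section GL.
Variables (F : fieldType) (V : vectType F).
HB.instance Definition _ := Vector.copy (gl V) 'End(V).

Definition gl_lbr (f g : gl V) : gl V :=
  ((f \o g)%VF - (g \o f)%VF : 'End(V)).

Lemma gl_addE (f g : gl V) v : (f + g) v = f v + g v.
Proof. exact: add_lfunE. Qed.

Lemma gl_scaleE a (f : gl V) v : (a *: f) v = a *: f v.
Proof. exact: scale_lfunE. Qed.

Lemma gl_lbrE (f g : gl V) v : gl_lbr f g v = f (g v) - g (f v).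
Proof. by rewrite /gl_lbr add_lfunE opp_lfunE !comp_lfunE. Qed.

Fact gl_lbr_linearl g : linear (gl_lbr^~ g).
Proof.
move=> a f f'; apply/lfunP => v.
rewrite [RHS]gl_addE [in RHS]gl_scaleE !gl_lbrE !gl_addE !gl_scaleE linearP.
by rewrite scalerBr opprD addrACA.
Qed.
Fact gl_lbr_linearr f : linear (gl_lbr f).
Proof.
move=> a g g'; apply/lfunP => v.
rewrite [RHS]gl_addE [in RHS]gl_scaleE !gl_lbrE !gl_addE !gl_scaleE linearP.
by rewrite scalerBr opprD addrACA.
Qed.
Fact gl_lbrxx f : gl_lbr f f = 0.
Proof. exact: subrr. Qed.
Fact gl_lbr_jacobi f g h :
  gl_lbr f (gl_lbr g h) + gl_lbr g (gl_lbr h f) + gl_lbr h (gl_lbr f g) = 0.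
Proof.
apply/lfunP => v; rewrite [LHS]gl_addE [X in X + _ = _]gl_addE !gl_lbrE !linearB [RHS]zero_lfunE.
rewrite !opprK !addrA /=.
rewrite [LHS](ACl (1*11*2*8*3*5*4*10*6*12*7*9))/=.
by rewrite !subrK addrK subrr.
Qed.
HB.instance Definition _ := Lmodule_isLie.Build F (gl V)
  gl_lbr_linearl gl_lbr_linearr gl_lbrxx gl_lbr_jacobi.
End GL.

(* L (x)_R C, realised as L + iL: the pair (x, y) stands for x (x) 1 + y (x) i. *)
Definition complexification (R : realType) (L : lieAlgType R) : Type :=
  (L * L)%type.

Section Complexification.
Variables (R : realType) (L : lieAlgType R).
Local Notation LC := (complexification L).

HB.instance Definition _ := GRing.Zmodule.copy LC (L * L)%type.

Definition cplx_scale (c : R[i]) (x : LC) : LC :=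
  let: Complex a b := c in (a *: x.1 - b *: x.2, a *: x.2 + b *: x.1).

Definition cplx_lbr (x y : LC) : LC :=
  (lbr x.1 y.1 - lbr x.2 y.2, lbr x.1 y.2 + lbr x.2 y.1).

Fact cplx_scalerA a b x : cplx_scale a (cplx_scale b x) = cplx_scale (a * b) x.
Proof.
case: a b x => [a a'] [b b'] [x y]; congr (_, _) => /=.
  rewrite !scalerDl !scalerDr !scalerN !scaleNr !scalerA !opprD.
  by rewrite [X in _ + X = _]addrC addrACA.
rewrite !scalerDl !scalerDr !scalerN !scaleNr !scalerA.
by rewrite [X in _ + X = _]addrC addrACA.
Qed.
Fact cplx_scale1r x : cplx_scale 1 x = x.
Proof.
by case: x => x y; congr (_, _); rewrite /= !scale1r scale0r ?subr0 ?addr0.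
Qed.
Fact cplx_scalerDr : right_distributive cplx_scale +%R.
Proof.
move=> [a b] [x y] [x' y']; congr (_, _) => /=.
  by rewrite !scalerDr opprD addrACA.
by rewrite !scalerDr addrACA.
Qed.
Fact cplx_scalerDl x : {morph cplx_scale^~ x : a b / a + b}.
Proof.
move: x => [x y] [a a'] [b b']; congr (_, _) => /=.
  by rewrite !scalerDl opprD addrACA.
by rewrite !scalerDl addrACA.
Qed.
HB.instance Definition _ := GRing.Zmodule_isLmodule.Build R[i] LC
  cplx_scalerA cplx_scale1r cplx_scalerDr cplx_scalerDl.


Fact cplx_lbr_linearl y : linear (cplx_lbr^~ y).
Proof.
move: y => [y y'] [a b] [x x'] [z z']; congr (_, _) => /=;
  rewrite !(lbrDl, lbrNl, lbrZl) !(scalerDr, scalerN, opprD) !addrA.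
  by rewrite [LHS](ACl (1*4*5*2*3*6))/=.
by rewrite [LHS](ACl (1*4*5*2*3*6))/=.
Qed.

Fact cplx_lbrC x y : cplx_lbr x y = - cplx_lbr y x.
Proof.
congr (_, _) => /=.
  by rewrite (lbrC y.1) (lbrC y.2) opprD !opprK.
by rewrite (lbrC y.1) (lbrC y.2) opprD !opprK addrC.
Qed.

Fact cplx_lbr_linearr x : linear (cplx_lbr x).
Proof.
move=> c y z; rewrite cplx_lbrC cplx_lbr_linearl opprD -scalerN.
by rewrite -!cplx_lbrC.
Qed.

Fact cplx_lbrxx x : cplx_lbr x x = 0.
Proof.
congr (_, _); first by rewrite !lbrxx subr0.
by rewrite [X in _ + X]lbrC subrr.
Qed.

Fact cplx_lbr_jacobi x y z :
  cplx_lbr x (cplx_lbr y z) + cplx_lbr y (cplx_lbr z x)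
    + cplx_lbr z (cplx_lbr x y) = 0.
Proof.
move: x y z => [x x'] [y y'] [z z']; congr (_, _) => /=;
  rewrite !(lbrDr, lbrNr, opprD) !addrA.
  rewrite [LHS](ACl ((1*5*9)*(2*8*11)*(3*6*12)*(4*7*10)))/=.
  by rewrite -!opprD !lbr_jacobi !subr0.
rewrite [LHS](ACl ((1*6*11)*(2*7*9)*(3*5*10)*(4*8*12)))/=.
by rewrite -!opprD !lbr_jacobi !addr0 subr0.
Qed.

HB.instance Definition _ := Lmodule_isLie.Build R[i] LC
  cplx_lbr_linearl cplx_lbr_linearr cplx_lbrxx cplx_lbr_jacobi.

End Complexification.

Definition real_form (R : realType) (L : lieAlgType R) (g : lieAlgType R[i]) :
  Prop := lie_iso (complexification L) g.

Section Killing.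
Variables (F : fieldType).

Definition lfun_trace (V : vectType F) (f : 'End(V)) : F :=
  \tr (passmx.mxof (vbasis {:V}) (vbasis {:V}) f).

Definition ad (L : lieVectType F) (x : L) : 'End(L) := linfun (lbr x).

Definition killing (L : lieVectType F) (x y : L) : F :=
  lfun_trace (ad x \o ad y)%VF.

End Killing.

(* The bilinear form B has signature p - q, where p (resp. q) is the number of
   positive (resp. negative) diagonal values in some B-orthogonal basis. *)
Definition has_signature (R : realType) (V : vectType R) (B : V -> V -> R)
    (s : int) : Prop :=
  exists e : (\dim {:V}).-tuple V,
    [/\ basis_of {:V} e,
        forall i j : 'I_(\dim {:V}), i != j -> B e`_i e`_j = 0
      & s = #|[set i : 'I_(\dim {:V}) | 0 < B e`_i e`_i]|%:Z
            - #|[set i : 'I_(\dim {:V}) | B e`_i e`_i < 0]|%:Z].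

Section Cartan.
Variables (F : fieldType) (L : lieVectType F).

Definition lie_nilpotent (H : lieSubalg L) : Prop :=
  exists n : nat, forall (s : n.-tuple L) (y : L),
    (forall i, H (tnth s i)) -> H y -> foldr (fun x z => lbr x z) y s = 0.

Definition self_normalizing (H : lieSubalg L) : Prop :=
  forall x : L, (forall h, H h -> H (lbr x h)) -> H x.

Definition cartan_subalgebra (H : lieSubalg L) : Prop :=
  lie_nilpotent H /\ self_normalizing H.

Definition ad_diagonalizable (x : L) : Prop :=
  exists2 e : (\dim {:L}).-tuple L, basis_of {:L} e
    & forall i : 'I_(\dim {:L}), exists c : F, lbr x e`_i = c *: e`_i.

Definition lie_split : Prop :=
  exists2 H : lieSubalg L, cartan_subalgebra H
    & forall h, H h -> ad_diagonalizable h.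

End Cartan.

Section Form3.
Variables (F : fieldType) (V : vectType F).

Record is_form3 (w : V -> V -> V -> F) : Prop := IsForm3 {
  form3_lin1 : forall Y Z, scalar (fun X => w X Y Z);
  form3_lin2 : forall X Z, scalar (fun Y => w X Y Z);
  form3_lin3 : forall X Y, scalar (fun Z => w X Y Z);
  form3_alt12 : forall X Z, w X X Z = 0;
  form3_alt13 : forall X Y, w X Y X = 0;
  form3_alt23 : forall X Y, w X Y Y = 0
}.

Record form3 := Form3 {
  form3_fun :> V -> V -> V -> F;
  form3P : is_form3 form3_fun
}.

(* (a /\ b /\ c)(X, Y, Z) is the 3 x 3 determinant of the values of a, b, c at
   X, Y, Z, without a factor 1/3!.  With this normalisation the product on
   [octonion] below is the octonion product. *)
Definition wedge3 (a b c : V -> F) (X Y Z : V) : F :=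
  a X * b Y * c Z + b X * c Y * a Z + c X * a Y * b Z
  - a X * c Y * b Z - b X * a Y * c Z - c X * b Y * a Z.

Fact wedge3P (a b c : V -> F) :
  scalar a -> scalar b -> scalar c -> is_form3 (wedge3 a b c).
Proof.
move=> la lb lc; split=> [Y Z k X X'|X Z k Y Y'|X Y k Z Z'|X Z|X Y|X Y];
  by rewrite /wedge3 ?la ?lb ?lc; ring.
Qed.

Fact form3D (w w' : V -> V -> V -> F) :
  is_form3 w -> is_form3 w' -> is_form3 (fun X Y Z => w X Y Z + w' X Y Z).
Proof.
case=> p1 p2 p3 p4 p5 p6 [q1 q2 q3 q4 q5 q6].
by split=> [Y Z c X X'|X Z c Y Y'|X Y c Z Z'|X Z|X Y|X Y];
  rewrite ?p1 ?q1 ?p2 ?q2 ?p3 ?q3 ?p4 ?q4 ?p5 ?q5 ?p6 ?q6 ?addr0 //; ring.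
Qed.

Fact form3Z (k : F) (w : V -> V -> V -> F) :
  is_form3 w -> is_form3 (fun X Y Z => k * w X Y Z).
Proof.
case=> p1 p2 p3 p4 p5 p6.
by split=> [Y Z c X X'|X Z c Y Y'|X Y c Z Z'|X Z|X Y|X Y];
  rewrite ?p1 ?p2 ?p3 ?p4 ?p5 ?p6 ?mulr0 //; ring.
Qed.

Variable w : form3.

Definition is_der3 (f : gl V) : Prop :=
  forall X Y Z : V, w (f X) Y Z + w X (f Y) Z + w X Y (f Z) = 0.

Lemma form3_0 :
  [/\ forall Y Z, w 0 Y Z = 0, forall X Z, w X 0 Z = 0
    & forall X Y, w X Y 0 = 0].
Proof.
case: (form3P w) => p1 p2 p3 _ _ _; split=> [Y Z|X Z|X Y].
- by have := p1 Y Z (-1) 0 0; rewrite scaler0 addr0 mulN1r addNr.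
- by have := p2 X Z (-1) 0 0; rewrite scaler0 addr0 mulN1r addNr.
- by have := p3 X Y (-1) 0 0; rewrite scaler0 addr0 mulN1r addNr.
Qed.

Fact der3_0 : is_der3 0.
Proof.
by move=> X Y Z; case: form3_0 => z1 z2 z3; rewrite !lfunE/= z1 z2 z3 !addr0.
Qed.

Fact der3P a f g : is_der3 f -> is_der3 g -> is_der3 (a *: f + g).
Proof.
move=> df dg X Y Z; case: (form3P w) => p1 p2 p3 _ _ _.
rewrite !gl_addE !gl_scaleE p1 p2 p3.
transitivity (a * (w (f X) Y Z + w X (f Y) Z + w X Y (f Z))
              + (w (g X) Y Z + w X (g Y) Z + w X Y (g Z))); first by ring.
by rewrite df dg mulr0 addr0.
Qed.

Fact der3_lbr f g : is_der3 f -> is_der3 g -> is_der3 (lbr f g).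
Proof.
move=> df dg X Y Z; case: (form3P w) => p1 p2 p3 _ _ _.
have B1 x x' y z : w (x - x') y z = w x y z - w x' y z.
  by rewrite addrC -scaleN1r p1 mulN1r addrC.
have B2 x y y' z : w x (y - y') z = w x y z - w x y' z.
  by rewrite addrC -scaleN1r p2 mulN1r addrC.
have B3 x y z z' : w x y (z - z') = w x y z - w x y z'.
  by rewrite addrC -scaleN1r p3 mulN1r addrC.
rewrite ![lbr f g _]gl_lbrE B1 B2 B3.
have e1 := df (g X) Y Z; have e2 := df X (g Y) Z; have e3 := df X Y (g Z).
have e4 := dg (f X) Y Z; have e5 := dg X (f Y) Z; have e6 := dg X Y (f Z).
transitivity (
  (w (f (g X)) Y Z + w (g X) (f Y) Z + w (g X) Y (f Z))
  + (w (f X) (g Y) Z + w X (f (g Y)) Z + w X (g Y) (f Z))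
  + (w (f X) Y (g Z) + w X (f Y) (g Z) + w X Y (f (g Z)))
  - (w (g (f X)) Y Z + w (f X) (g Y) Z + w (f X) Y (g Z))
  - (w (g X) (f Y) Z + w X (g (f Y)) Z + w X (f Y) (g Z))
  - (w (g X) Y (f Z) + w X (g Y) (f Z) + w X Y (g (f Z)))); first by ring.
by rewrite e1 e2 e3 e4 e5 e6 !addr0 !subr0.
Qed.

Definition Der3 : lieSubalg (gl V) := LieSubalg der3_0 der3P der3_lbr.

End Form3.

Section ConcreteForms.
Variable F : fieldType.
Local Notation V := 'rV[F]_7.

Definition crd (k : nat) (X : V) : F := X 0 (inord k).

Fact crd_scalar k : scalar (crd k).
Proof. by move=> a X Y; rewrite /crd !mxE. Qed.

(* The canonical basis is ordered E_0, E_1, E_2, E_3, F_1, F_2, F_3. *)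
Definition Est (i : nat) : V -> F := crd i.
Definition Fst (i : nat) : V -> F := crd (3 + i).

Definition Omega0_fun (X Y Z : V) : F :=
  - 2 * \sum_(1 <= i < 4) wedge3 (Est 0) (Est i) (Fst i) X Y Z
  - 4 * wedge3 (Est 1) (Est 2) (Est 3) X Y Z
  + 4 * wedge3 (Fst 1) (Fst 2) (Fst 3) X Y Z.

(* e^{ijk}, with indices from 1 to 7; coordinates are numbered from 0. *)
Definition e3 (i j k : nat) : V -> V -> V -> F :=
  wedge3 (crd i.-1) (crd j.-1) (crd k.-1).

Definition Omega1_fun (X Y Z : V) : F :=
  e3 1 4 7 X Y Z + e3 2 5 7 X Y Z + e3 3 6 7 X Y Z + e3 1 2 3 X Y Z
  - e3 1 5 6 X Y Z + e3 2 4 6 X Y Z - e3 3 4 5 X Y Z.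

Lemma sum13 (f : nat -> F) : \sum_(1 <= i < 4) f i = f 1%N + f 2%N + f 3%N.
Proof. by rewrite unlock /= addr0 addrA. Qed.

Fact Omega0P : is_form3 Omega0_fun.
Proof.
have H i j k : is_form3 (wedge3 (crd i) (crd j) (crd k)).
  by apply: wedge3P; exact: crd_scalar.
have -> : Omega0_fun = (fun X Y Z =>
    - 2 * (wedge3 (crd 0) (crd 1) (crd 4) X Y Z
           + wedge3 (crd 0) (crd 2) (crd 5) X Y Z
           + wedge3 (crd 0) (crd 3) (crd 6) X Y Z)
    + - 4 * wedge3 (crd 1) (crd 2) (crd 3) X Y Z
    + 4 * wedge3 (crd 4) (crd 5) (crd 6) X Y Z).
  apply/funext => X; apply/funext => Y; apply/funext => Z.
  by rewrite /Omega0_fun sum13 !mulNr !addrA.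
apply: form3D; last exact: form3Z.
apply: form3D; last exact: form3Z.
by apply: form3Z; do 2!(apply: form3D; last exact: H).
Qed.

Fact Omega1P : is_form3 Omega1_fun.
Proof.
have H i j k : is_form3 (e3 i j k) by apply: wedge3P; exact: crd_scalar.
have N i j k : is_form3 (fun X Y Z => - e3 i j k X Y Z).
  have -> : (fun X Y Z => - e3 i j k X Y Z) = (fun X Y Z => -1 * e3 i j k X Y Z).
    by apply/funext => X; apply/funext => Y; apply/funext => Z; rewrite mulN1r.
  exact: form3Z.
by do 6!(apply: form3D; last by [exact: H | exact: N]).
Qed.

Definition Omega0 : form3 V := Form3 Omega0P.
Definition Omega1 : form3 V := Form3 Omega1P.

End ConcreteForms.

Section Octonions.
Variable F : numFieldType.
Local Notation V := 'rV[F]_7.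

(* The polarisation of n(s, u, v) = - s^2 - 4 u^t v, where s = E_0^*(X),
   u_i = E_i^*(X), v_i = F_i^*(X). *)
Definition oct_n (X Y : V) : F :=
  - (Est 0 X * Est 0 Y)
  - 2 * \sum_(1 <= i < 4) (Est i X * Fst i Y + Fst i X * Est i Y).

Lemma oct_nC X Y : oct_n X Y = oct_n Y X.
Proof. by rewrite /oct_n !sum13; ring. Qed.

Lemma oct_n_quad X :
  oct_n X X = - Est 0 X ^+ 2 - 4 * \sum_(1 <= i < 4) Est i X * Fst i X.
Proof. by rewrite /oct_n !sum13; ring. Qed.

(* X x Y, solved for from n(X x Y, Z) = Omega0(X, Y, Z): see [oct_crossP]. *)
Definition oct_cross (X Y : V) : V :=
  \row_k (let w j := Omega0 F X Y (delta_mx 0 (inord j)) in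
          if k == 0 :> nat then - w 0
          else if (k <= 3)%N then - w (3 + k)%N / 2
          else - w (k - 3)%N / 2).

Lemma oct_crossP X Y Z : oct_n (oct_cross X Y) Z = Omega0 F X Y Z.
Proof.
case: (form3P (Omega0 F)) => _ _ p3 _ _ _.
have [_ _ w0] := form3_0 (Omega0 F).
have -> : Omega0 F X Y Z =
    \sum_(j < 7) crd j Z * Omega0 F X Y (delta_mx 0 (inord j)).
  rewrite {1}[Z]row_sum_delta.
  transitivity (\sum_(j < 7) Omega0 F X Y (Z 0 j *: delta_mx 0 j)).
    apply: (big_morph (Omega0 F X Y)) => // A B.
    by have := p3 X Y 1 A B; rewrite scale1r mul1r.
  apply: eq_bigr => j _; rewrite /crd inord_val.
  by have := p3 X Y (Z 0 j) (delta_mx 0 j) 0; rewrite w0 !addr0.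
rewrite /oct_n !sum13 !big_ord_recl big_ord0.
rewrite /Est /Fst /oct_cross /crd !mxE !inordK //=.
by field.
Qed.

Lemma oct_n_inj X Y : (forall Z, oct_n X Z = oct_n Y Z) -> X = Y.
Proof.
move=> h; apply/rowP => k.
have E (j : nat) : (j < 7)%N -> forall i : nat, (i < 7)%N ->
    crd i (delta_mx 0 (inord j) : V) = (i == j)%:R.
  by move=> j7 i i7; rewrite /crd mxE /= -val_eqE /= !inordK.
have := h (delta_mx 0 (inord 0)); have := h (delta_mx 0 (inord 1)).
have := h (delta_mx 0 (inord 2)); have := h (delta_mx 0 (inord 3)).
have := h (delta_mx 0 (inord 4)); have := h (delta_mx 0 (inord 5)).
have := h (delta_mx 0 (inord 6)).
rewrite /oct_n !sum13 /Est /Fst !E //=.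
rewrite !(mulr0, mulr1, addr0, add0r, oppr0, subr0).
have two : (2 : F) != 0 by rewrite pnatr_eq0.
do 6!move=> /oppr_inj/(mulfI two) ?; move=> /oppr_inj ?.
by case: k => [[|[|[|[|[|[|[|]]]]]]]] // lt;
  rewrite -[Ordinal lt]inord_val.
Qed.

(* The octonion algebra F 1 (+) F^7. *)
Definition octonion : vectType F := (F^o * V)%type.

Definition oct_mul (x y : octonion) : octonion :=
  (x.1 * y.1 - oct_n x.2 y.2, x.1 *: y.2 + y.1 *: x.2 + oct_cross x.2 y.2).

Definition is_der_oct (d : gl octonion) : Prop :=
  forall x y : octonion, d (oct_mul x y) = oct_mul (d x) y + oct_mul x (d y).

Lemma oct_n_lin2 X : scalar (oct_n X).
Proof.
by move=> a Y Y'; rewrite /oct_n !sum13 /Est /Fst !crd_scalar; ring.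
Qed.

Lemma oct_n_lin1 Y : scalar (oct_n^~ Y).
Proof. by move=> a X X'; rewrite !(oct_nC _ Y) oct_n_lin2. Qed.

Lemma oct_cross_lin1 Y : linear (oct_cross^~ Y).
Proof.
case: (form3P (Omega0 F)) => p1 _ _ _ _ _.
move=> a X X'; apply: oct_n_inj => Z.
by rewrite oct_n_lin1 !oct_crossP p1.
Qed.

Lemma oct_cross_lin2 X : linear (oct_cross X).
Proof.
case: (form3P (Omega0 F)) => _ p2 _ _ _ _.
move=> a Y Y'; apply: oct_n_inj => Z.
by rewrite oct_n_lin1 !oct_crossP p2.
Qed.

Lemma oct_mul_lin1 y : linear (oct_mul^~ y).
Proof.
move=> a x x'; congr (_, _) => /=.
  by rewrite oct_n_lin1 /GRing.scale /=; ring.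
rewrite oct_cross_lin1 /= !(scalerDl, scalerDr) !scalerA.
rewrite [y.1 * a]mulrC !addrA.
by rewrite [LHS](ACl (1*3*5*2*4*6))/=.
Qed.

Lemma oct_mul_lin2 x : linear (oct_mul x).
Proof.
move=> a y y'; congr (_, _) => /=.
  by rewrite oct_n_lin2 /GRing.scale /=; ring.
rewrite oct_cross_lin2 /= !(scalerDl, scalerDr) !scalerA.
rewrite [x.1 * a]mulrC !addrA.
by rewrite [LHS](ACl (1*3*5*2*4*6))/=.
Qed.

Fact der_oct0 : is_der_oct 0.
Proof.
move=> x y; rewrite ![(0 : gl octonion) _]zero_lfunE.
have := oct_mul_lin1 y (-1) 0 0; have := oct_mul_lin2 x (-1) 0 0.
by rewrite !scaler0 !addr0 !scaleN1r !addNr => -> ->; rewrite addr0.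
Qed.

Fact der_octP a f g : is_der_oct f -> is_der_oct g -> is_der_oct (a *: f + g).
Proof.
move=> df dg x y; rewrite !gl_addE !gl_scaleE df dg.
by rewrite oct_mul_lin1 oct_mul_lin2 scalerDr addrACA.
Qed.

Fact der_oct_lbr f g : is_der_oct f -> is_der_oct g -> is_der_oct (lbr f g).
Proof.
move=> df dg x y; rewrite ![lbr f g _]gl_lbrE dg df !linearD /= !df !dg.
have B1 z z' t : oct_mul (z - z') t = oct_mul z t - oct_mul z' t.
  by rewrite addrC -scaleN1r oct_mul_lin1 scaleN1r addrC.
have B2 t z z' : oct_mul t (z - z') = oct_mul t z - oct_mul t z'.
  by rewrite addrC -scaleN1r oct_mul_lin2 scaleN1r addrC.
rewrite B1 B2 !opprD !addrA.
rewrite [LHS](ACl (1*5*4*8*2*7*3*6))/=.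
by rewrite !addrK.
Qed.

Definition DerOct : lieSubalg (gl octonion) :=
  LieSubalg der_oct0 der_octP der_oct_lbr.

End Octonions.

Section G2.
Variable R : realType.

(* Der(C) is the simple complex Lie algebra of type G_2, so a real Lie algebra
   is of type G_2 when its complexification is isomorphic to Der(C). *)
Definition type_G2 (L : lieAlgType R) : Prop := real_form L (DerOct R[i]).

Definition is_g2_split (L : lieVectType R) : Prop :=
  [/\ type_G2 L, lie_split L & has_signature (@killing R L) 2].

Definition is_g2_compact (L : lieVectType R) : Prop :=
  [/\ type_G2 L, forall x : L, x != 0 -> killing x x < 0
    & has_signature (@killing R L) (- 14)].

End G2.

(* Main.v *)
(** A real form of g = Der(C) is the fixed-point set of an antilinear involution
    of g.  The crux is that such an involution comes from one of C^7, i.e. that g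
    has only one faithful 7-dimensional representation: under a principal sl2,
    g = V_2 + V_10, a faithful representation of dimension 7 must have weights
    differing by 10, which leaves V_6 and V_5 + V_0, and the bracket of the
    extreme vectors of V_10 excludes V_5 + V_0 and fixes the action on V_6.
    Since V_6 occurs once in V_6 (x) V_6, the resulting antilinear map preserves
    the cross product up to a scalar, which can be normalised away; it is then an
    involution whose fixed points form a real 7-dimensional cross product
    algebra.  Orthogonal vectors of norms 1, 1, +-1 generate a standard basis of
    the latter, so only Omega0 and Omega1 occur.  The two cases are told apart by
    the signature of the Killing form. *)

Require Import Defs.
From HB Require Import structures.
From mathcomp Require Import all_boot all_order all_algebra.
From mathcomp Require Import boolp reals.
From mathcomp Require Import complex.
From mathcomp Require Import ssrAC ring zify.

Set Implicit Arguments.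
Unset Strict Implicit.
Unset Printing Implicit Defensive.

Import Order.TTheory GRing.Theory Num.Theory.
Local Open Scope ring_scope.

(** * Matrix models of Lie algebras *)

(** No structure theory of semisimple Lie algebras is invoked. Every Lie algebra in play is
    presented as a set of 7 x 7 matrices, the derivations of a 3-form, so that two presentations by
    the same set give an isomorphism. Facts about the 14-dimensional algebra are reduced to integer
    identities, decided by computation and valid over R and C alike. Representations are studied
    through eigenvectors only: a 7 x 7 matrix has at most 7 eigenvalues, which cuts every string v,
    v f, v f^2, ... and keeps the weights between -6 and 6, so neither complete reducibility nor
    diagonalizability of h is assumed. The relation that fixes the action on V_6, namely 14
    [x_0, x_10] = - 15 h - x_5, is inhomogeneous in x; hence it also fixes the scale of x_0 and
    leaves no free parameter. Finally, uniqueness concerns complex linear representations, whereas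
    the involution is antilinear: conjugating both the element and its matrix restores linearity. *)

Lemma linear_fun0 (R : pzRingType) (U W : lmodType R) (f : U -> W) :
  linear f -> f 0 = 0.
Proof. by move=> lf; have := lf (-1) 0 0; rewrite scaler0 addr0 scaleN1r addNr. Qed.

Lemma linear_funZ (R : pzRingType) (U W : lmodType R) (f : U -> W) a x :
  linear f -> f (a *: x) = a *: f x.
Proof. by move=> lf; have := lf a x 0; rewrite !addr0 (linear_fun0 lf) addr0. Qed.

Section MatrixModels.
Variable F : fieldType.

Definition der_mx (w : form3 'rV[F]_7) (M : 'M[F]_7) : Prop :=
  forall X Y Z : 'rV[F]_7,
    w (X *m M) Y Z + w X (Y *m M) Z + w X Y (Z *m M) = 0.

(* An endomorphism acts on row vectors as [X |-> X *m M], so that composition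
   is reversed and the bracket of [M] and [M'] is [M' *m M - M *m M']. *)
Definition mx_model (L : lieAlgType F) (D : 'M[F]_7 -> Prop)
    (mu : L -> 'M[F]_7) : Prop :=
  [/\ linear mu, injective mu, forall x, D (mu x),
      forall M, D M -> exists x, mu x = M
    & forall x y, mu (lbr x y) = mu y *m mu x - mu x *m mu y].

(** The isomorphism is [mu] followed by the inverse of [mu'], both being bijections onto the same
    set of matrices. *)
Lemma mx_model_iso (L L' : lieAlgType F) D D' mu mu' :
  mx_model (L := L) D mu -> mx_model (L := L') D' mu' ->
  (forall M, D M <-> D' M) -> lie_iso L L'.
Proof.
move=> [lm im dm sm bm] [lm' im' dm' sm' bm'] DD'.
have h x : {y | mu' y = mu x} by apply: cid; apply/sm'/DD'.
have h' y : {x | mu x = mu' y} by apply: cid; apply/sm/DD'.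
pose phi x := sval (h x); pose psi y := sval (h' y).
have phiE x : mu' (phi x) = mu x by rewrite /phi; case: (h x).
have psiE y : mu (psi y) = mu' y by rewrite /psi; case: (h' y).
have lphi : linear phi by move=> a x y; apply: im'; rewrite lm' !phiE lm.
pose phiL : {linear L -> L'} := HB.pack_for {linear L -> L'} phi
  (GRing.isLinear.Build F L L' _ phi lphi).
exists phiL; split.
  exists psi => x; first by apply: im; rewrite psiE phiE.
  by apply: im'; rewrite phiE psiE.
by move=> x y; apply: im'; rewrite bm' /= !phiE bm.
Qed.

Lemma iso_mx_model (L L' : lieAlgType F) D mu :
  lie_iso L L' -> mx_model (L := L') D mu ->
  exists mu', mx_model (L := L) D mu'.
Proof.
move=> [phi [[psi phiK psiK] bphi]] [lm im dm sm bm].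
exists (mu \o phi); split=> //=.
- by move=> a x y; rewrite /= linearP lm.
- by apply: inj_comp => //; exact: can_inj phiK.
- by move=> M /sm[y <-]; exists (psi y); rewrite psiK.
- by move=> x y; rewrite /= bphi bm.
Qed.

Lemma lie_iso_sym (L L' : lieAlgType F) : lie_iso L L' -> lie_iso L' L.
Proof.
move=> [phi [[psi phiK psiK] bphi]].
have lpsi : linear psi.
  by move=> a x y; apply: (can_inj phiK); rewrite linearP !psiK.
pose psiL : {linear L' -> L} := HB.pack_for {linear L' -> L} psi
  (GRing.isLinear.Build F L' L _ psi lpsi).
exists psiL; split; first by exists phi.
by move=> x y; apply: (can_inj phiK); rewrite bphi /= !psiK.
Qed.

Lemma eq_mx_model (L : lieAlgType F) D D' mu :
  (forall M, D M <-> D' M) -> mx_model (L := L) D mu -> mx_model (L := L) D' mu.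
Proof.
move=> DD' [lm im dm sm bm]; split=> //; first by move=> x; apply/DD'.
by move=> M /DD'/sm.
Qed.

Lemma conj_mx_model (L : lieAlgType F) D mu (S : 'M[F]_7) : S \in unitmx ->
  mx_model (L := L) D mu ->
  mx_model (L := L) (fun M => D (invmx S *m M *m S))
    (fun x => S *m mu x *m invmx S).
Proof.
move=> Su [lm im dm sm bm]; split.
- by move=> a x y; rewrite lm mulmxDr mulmxDl -scalemxAr -scalemxAl.
- move=> x y /(congr1 (fun M => invmx S *m M *m S)).
  by rewrite -!mulmxA mulVmx // !mulmx1 !mulKmx //; exact: im.
- by move=> x; rewrite -!mulmxA mulVmx // mulmx1 mulKmx.
- move=> M /sm[x xE]; exists x.
  by rewrite xE -!mulmxA mulmxV // mulmx1 mulKVmx.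
- by move=> x y; rewrite bm mulmxBr mulmxBl !mulmxA !mulmxKV.
Qed.

Lemma gl_mulmx (f : gl 'rV[F]_7) (X : 'rV[F]_7) : X *m lin1_mx f = f X.
Proof. by rewrite mul_rV_lin1. Qed.

Lemma Der3_model (w : form3 'rV[F]_7) :
  mx_model (L := Der3 w) (der_mx w) (fun f => lin1_mx (val f)).
Proof.
split.
- move=> a f g; apply/row_matrixP=> i.
  rewrite !rowE mulmxDr -scalemxAr !gl_mulmx.
  by rewrite [LHS]gl_addE gl_scaleE.
- move=> f g fg; apply/val_inj/lfunP=> X.
  by rewrite -!gl_mulmx fg.
- by case=> f /= /asboolP df X Y Z; rewrite !gl_mulmx.
- move=> M dM; pose f : gl 'rV[F]_7 := linfun (mulmxr M).
  have fE X : f X = X *m M by rewrite lfunE.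
  have df : f \in lsub_pred (Der3 w).
    by apply/asboolP=> X Y Z; rewrite !fE.
  exists (SubLie df); apply/row_matrixP=> i.
  by rewrite !rowE gl_mulmx /= fE.
- move=> f g; apply/row_matrixP=> i; rewrite !rowE mulmxBr !mulmxA !gl_mulmx.
  exact: gl_lbrE.
Qed.

End MatrixModels.

(** * Reduction of identities to integer tables *)

Section IntegerTables.

Definition itable := nat -> nat -> int.
Definition iform := nat -> nat -> nat -> int.

Definition sparse (s : seq (nat * nat * int)) : itable := fun i j =>
  foldr (fun t acc => if (t.1.1 == i) && (t.1.2 == j) then t.2 + acc else acc)
    0 s.

Definition isum (n : nat) (f : nat -> int) : int :=
  foldr (fun i acc => f i + acc) 0 (iota 0 n).

Definition alln (n : nat) (p : pred nat) : bool := all p (iota 0 n).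

Arguments isum : simpl never.
Arguments alln : simpl never.

Lemma isumE n f : isum n f = \sum_(i < n) f i.
Proof. by rewrite -(big_mkord xpredT f) /index_iota subn0 unlock. Qed.

Lemma allnP n p : alln n p -> forall i, (i < n)%N -> p i.
Proof. by move=> /allP h i lt_in; apply: h; rewrite mem_iota. Qed.

Lemma intr_isum (F : pzRingType) n f :
  (isum n f)%:~R = \sum_(i < n) (f i)%:~R :> F.
Proof. by rewrite isumE rmorph_sum. Qed.

Definition imx (F : pzRingType) (b : itable) : 'M[F]_7 :=
  \matrix_(i, j) (b i j)%:~R.

Definition idelta (i j : nat) : int := (i == j)%:R.

Definition iwedge (a b c : nat) : iform := fun i j k =>
    idelta i a * idelta j b * idelta k c + idelta i b * idelta j c * idelta k a
  + idelta i c * idelta j a * idelta k b - idelta i a * idelta j c * idelta k b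
  - idelta i b * idelta j a * idelta k c - idelta i c * idelta j b * idelta k a.

Definition iOmega0 : iform := fun i j k =>
  - 2 * (iwedge 0 1 4 i j k + iwedge 0 2 5 i j k + iwedge 0 3 6 i j k)
  - 4 * iwedge 1 2 3 i j k + 4 * iwedge 4 5 6 i j k.

(* For [e = 1] this is Omega1; for [e = -1] it is a multiple of Omega0 in
   another basis. *)
Definition iOmega_pm (e : int) : iform := fun i j k =>
  e * (iwedge 0 3 6 i j k + iwedge 1 4 6 i j k + iwedge 2 5 6 i j k)
  + iwedge 0 1 2 i j k
  + e * (iwedge 1 3 5 i j k - iwedge 0 4 5 i j k - iwedge 2 3 4 i j k).

Section Forms.
Variable F : fieldType.
Local Notation V := 'rV[F]_7.
Implicit Types (w : form3 V) (t : iform) (b : itable).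

Definition has_table w t : Prop := forall i j k : 'I_7,
  w (delta_mx 0 i) (delta_mx 0 j) (delta_mx 0 k) = (t i j k)%:~R.

Lemma form3_suml w (I : finType) (f : I -> F) (X : I -> V) Y Z :
  w (\sum_i f i *: X i) Y Z = \sum_i f i * w (X i) Y Z.
Proof.
case: (form3P w) => p1 _ _ _ _ _; have [z1 _ _] := form3_0 w.
elim/big_rec2: _ => [|i y x _ <-]; first exact: z1.
by rewrite p1.
Qed.

Lemma form3_summ w (I : finType) (f : I -> F) (X : I -> V) Y Z :
  w Y (\sum_i f i *: X i) Z = \sum_i f i * w Y (X i) Z.
Proof.
case: (form3P w) => _ p1 _ _ _ _; have [_ z1 _] := form3_0 w.
elim/big_rec2: _ => [|i y x _ <-]; first exact: z1.
by rewrite p1.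
Qed.

Lemma form3_sumr w (I : finType) (f : I -> F) (X : I -> V) Y Z :
  w Y Z (\sum_i f i *: X i) = \sum_i f i * w Y Z (X i).
Proof.
case: (form3P w) => _ _ p1 _ _ _; have [_ _ z1] := form3_0 w.
elim/big_rec2: _ => [|i y x _ <-]; first exact: z1.
by rewrite p1.
Qed.

Lemma form3_expand w X Y Z : w X Y Z = \sum_i \sum_j \sum_k
  X 0 i * (Y 0 j * (Z 0 k * w (delta_mx 0 i) (delta_mx 0 j) (delta_mx 0 k))).
Proof.
rewrite {1}[X]row_sum_delta form3_suml; apply: eq_bigr => i _.
rewrite {1}[Y]row_sum_delta form3_summ mulr_sumr; apply: eq_bigr => j _.
by rewrite {1}[Z]row_sum_delta form3_sumr !mulr_sumr.
Qed.

Lemma eq_form3 w w' :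
  (forall i j k : 'I_7, w (delta_mx 0 i) (delta_mx 0 j) (delta_mx 0 k) =
                        w' (delta_mx 0 i) (delta_mx 0 j) (delta_mx 0 k)) ->
  forall X Y Z, w X Y Z = w' X Y Z.
Proof.
move=> h X Y Z; rewrite !form3_expand; apply: eq_bigr => i _.
by apply: eq_bigr => j _; apply: eq_bigr => k _; rewrite h.
Qed.

Lemma delta_mul (M : 'M[F]_7) (i : 'I_7) :
  (delta_mx 0 i : V) *m M = \sum_a M i a *: delta_mx 0 a.
Proof. by rewrite -rowE [LHS]row_sum_delta; apply: eq_bigr => a _; rewrite mxE. Qed.

Definition der_eq t (M : 'M[F]_7) (i j k : 'I_7) : F :=
  \sum_(a < 7) M i a * (t a j k)%:~R + \sum_(a < 7) M j a * (t i a k)%:~R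
  + \sum_(a < 7) M k a * (t i j a)%:~R.

(** Trilinearity reduces the condition to basis vectors, where it is a linear system in the entries
    of [M] with integer coefficients: it can be solved by tables and transported along field
    morphisms. *)
Lemma der_mxP w t M : has_table w t ->
  der_mx w M <-> forall i j k, der_eq t M i j k = 0.
Proof.
move=> tab; have E i j k : der_eq t M i j k =
    w ((delta_mx 0 i : V) *m M) (delta_mx 0 j) (delta_mx 0 k)
  + w (delta_mx 0 i) ((delta_mx 0 j : V) *m M) (delta_mx 0 k)
  + w (delta_mx 0 i) (delta_mx 0 j) ((delta_mx 0 k : V) *m M).
  rewrite !delta_mul form3_suml form3_summ form3_sumr /der_eq.
  by do 2?congr (_ + _); apply: eq_bigr => a _; rewrite tab.
split=> [dM i j k|dM X Y Z]; first by rewrite E dM.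
have mulE (U : V) : U *m M = \sum_i U 0 i *: ((delta_mx 0 i : V) *m M).
  by rewrite {1}[U]row_sum_delta mulmx_suml; apply: eq_bigr => i _; rewrite scalemxAl.
transitivity (\sum_i \sum_j \sum_k X 0 i * (Y 0 j * (Z 0 k * der_eq t M i j k))).
  have e1 A B : w X A B = \sum_i X 0 i * w (delta_mx 0 i) A B.
    by rewrite {1}[X]row_sum_delta form3_suml.
  have e2 A B : w A Y B = \sum_i Y 0 i * w A (delta_mx 0 i) B.
    by rewrite {1}[Y]row_sum_delta form3_summ.
  have e3 A B : w A B Z = \sum_i Z 0 i * w A B (delta_mx 0 i).
    by rewrite {1}[Z]row_sum_delta form3_sumr.
  rewrite !e1 (mulE X) form3_suml -!big_split; apply: eq_bigr => i _ /=.
  rewrite -!mulrDr !e2 (mulE Y) form3_summ -!big_split mulr_sumr.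
  apply: eq_bigr => j _ /=; rewrite -!mulrDr -mulr_sumr -mulr_sumr.
  congr (_ * (_ * _)); rewrite !e3 (mulE Z) form3_sumr -!big_split /=.
  by apply: eq_bigr => k _; rewrite -!mulrDr E.
do 3!(apply: big1 => ? _); by rewrite dM !mulr0.
Qed.

(* The test spares the computation of [y ()] when [x] vanishes. *)
Definition mul_lazy (x : int) (y : unit -> int) : int :=
  if x == 0 then 0 else x * y tt.

Lemma mul_lazyE x y : mul_lazy x y = x * y tt.
Proof. by rewrite /mul_lazy; case: eqP => // ->; rewrite mul0r. Qed.

Definition der_table t b : bool :=
  alln 7 (fun i => alln 7 (fun j => alln 7 (fun k =>
    isum 7 (fun a => mul_lazy (b i a) (fun=> t a j k))
    + isum 7 (fun a => mul_lazy (b j a) (fun=> t i a k))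
    + isum 7 (fun a => mul_lazy (b k a) (fun=> t i j a)) == 0))).

Lemma der_imx w t b : has_table w t -> der_table t b -> der_mx w (imx F b).
Proof.
move=> tab chk; apply/(der_mxP _ tab) => i j k.
have /eqP/(congr1 (fun z : int => z%:~R : F)) :=
  allnP (allnP (allnP chk (ltn_ord i)) (ltn_ord j)) (ltn_ord k).
rewrite 2!intrD !intr_isum mulr0z => E; rewrite -[RHS]E.
by do 2?congr (_ + _); apply: eq_bigr => a _; rewrite mxE mul_lazyE intrM.
Qed.

End Forms.

Section Tables.
Variable F : numFieldType.

Lemma crd_delta (k : nat) (i : 'I_7) : (k < 7)%N ->
  crd k (delta_mx 0 i : 'rV[F]_7) = (idelta i k)%:~R.
Proof.
by move=> k7; rewrite /crd mxE /= eq_sym -val_eqE /= inordK // /idelta; case: (_ == _).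
Qed.

Lemma Omega0_table : has_table (Omega0 F) iOmega0.
Proof.
move=> i j k; rewrite /Omega0 /= /Omega0_fun sum13 /wedge3 /Est /Fst !crd_delta //.
by rewrite /iOmega0 /iwedge; ring.
Qed.

Lemma Omega1_table : has_table (Omega1 F) (iOmega_pm 1).
Proof.
move=> i j k; rewrite /Omega1 /= /Omega1_fun /e3 /wedge3 !crd_delta //.
by rewrite /iOmega_pm /iwedge; ring.
Qed.

End Tables.

End IntegerTables.

(** * Explicit bases of the derivation algebras of Omega0 and Omega1 *)

Section Spanning.

(** The coefficient of [M a b] in the equation [der_eq t M i j k], as [ev_coef] confirms. *)
Definition ider_coef (t : iform) (i j k a b : nat) : int :=
  idelta a i * t b j k + idelta a j * t i b k + idelta a k * t i j b.

Definition ider_comb (t : iform) (s : seq (int * (nat * nat * nat)))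
    (a b : nat) : int :=
  foldr (fun c acc =>
    c.1 * ider_coef t c.2.1.1 c.2.1.2 c.2.2 a b + acc) 0 s.

(* [K r s] expresses [d] times the (r, s) entry of
   [M - \sum_l M (pos l) *: B l] as a combination of the derivation equations. *)
Definition span_table (t : iform) (B : nat -> itable) (pos : nat -> nat * nat)
    (d : int) (K : nat -> nat -> seq (int * (nat * nat * nat))) : bool :=
  alln 7 (fun r => alln 7 (fun s =>
    all (fun c => [&& c.2.1.1 < 7, c.2.1.2 < 7 & c.2.2 < 7])%N (K r s) &&
    alln 7 (fun a => alln 7 (fun b =>
      d * (idelta a r * idelta b s
           - isum 14 (fun l => idelta a (pos l).1 * idelta b (pos l).2 * B l r s))
      == ider_comb t (K r s) a b)))).

Variable F : fieldType.
Implicit Types (M : 'M[F]_7).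

Lemma sum_idelta n (f : 'I_n.+1 -> F) (i : nat) : (i < n.+1)%N ->
  \sum_(a < n.+1) (idelta a i)%:~R * f a = f (inord i).
Proof.
move=> lt_in; rewrite (bigD1 (inord i)) //= big1 => [|a ne_ai].
  by rewrite addr0 /idelta inordK // eqxx mul1r.
rewrite /idelta -{1}(inordK lt_in) /= (inj_eq val_inj) (negPf ne_ai) mul0r //.
Qed.

Definition ev (c : itable) M : F := \sum_(a < 7) \sum_(b < 7) (c a b)%:~R * M a b.

Lemma ev_coef t (i j k : nat) M : (i < 7)%N -> (j < 7)%N -> (k < 7)%N ->
  ev (ider_coef t i j k) M = der_eq t M (inord i) (inord j) (inord k).
Proof.
move=> i7 j7 k7; rewrite /ev /der_eq !inordK //.
have E (p : nat) (u : nat -> int) : (p < 7)%N ->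
   \sum_(a < 7) M (inord p) a * (u a)%:~R =
   \sum_(a < 7) \sum_(b < 7) (idelta a p)%:~R * ((u b)%:~R * M a b).
  move=> p7; under [RHS]eq_bigr do rewrite -mulr_sumr.
  by rewrite sum_idelta //; apply: eq_bigr => b _; rewrite mulrC.
rewrite (E i (fun a => t a j k)) // (E j (fun a => t i a k)) //.
rewrite (E k (fun a => t i j a)) // -!big_split; apply: eq_bigr => a _.
rewrite -!big_split; apply: eq_bigr => b _.
by rewrite /ider_coef !intrD !intrM /= !mulrA -!mulrDl.
Qed.

(** Both sides of the identity in [span_table] are linear functionals of the entries of [M]. The
    right one is a combination of derivation equations, so it vanishes on [M]; then [d] cancels. *)
Lemma der_span t B pos d K : span_table t B pos d K -> (d%:~R : F) != 0 ->
  (forall l, (l < 14)%N -> ((pos l).1 < 7) && ((pos l).2 < 7))%N ->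
  forall M, (forall i j k, der_eq t M i j k = 0) ->
  M = \sum_(l < 14) M (inord (pos l).1) (inord (pos l).2) *: imx F (B l).
Proof.
move=> chk d0 pos7 M dM; apply/matrixP => r s; apply/eqP.
rewrite -subr_eq0 -(mulrI_eq0 _ (lregP d0)); apply/eqP.
have /andP[K7 {}chk] := allnP (allnP chk (ltn_ord r)) (ltn_ord s).
transitivity (ev (ider_comb t (K r s)) M); last first.
  elim: (K r s) K7 => [_|[c [[i j] k]] l IHl /= /andP[/and3P[i7 j7 k7] /IHl {}IHl]].
    by apply: big1 => a _; apply: big1 => b _; rewrite mul0r.
  transitivity (c%:~R * ev (ider_coef t i j k) M + ev (ider_comb t l) M).
    rewrite /ev mulr_sumr -big_split; apply: eq_bigr => a _.
    rewrite mulr_sumr -big_split; apply: eq_bigr => b _ /=.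
    by rewrite mulrA -mulrDl -intrM -intrD.
  by rewrite IHl ev_coef // dM mulr0 addr0.
transitivity (\sum_(a < 7) \sum_(b < 7) (d * (idelta a r * idelta b s
    - isum 14 (fun l => idelta a (pos l).1 * idelta b (pos l).2 * B l r s)))%:~R
   * M a b); last first.
  apply: eq_bigr => a _; apply: eq_bigr => b _; congr (_%:~R * _).
  by apply/eqP; have := allnP (allnP chk (ltn_ord a)) (ltn_ord b).
have pick (p q : nat) : (p < 7)%N -> (q < 7)%N -> M (inord p) (inord q) =
    \sum_(a < 7) \sum_(b < 7) (idelta a p)%:~R * (idelta b q)%:~R * M a b.
  move=> p7 q7; rewrite -(sum_idelta (fun a => M a (inord q)) p7).
  apply: eq_bigr => a _; rewrite -(sum_idelta (fun b => M a b) q7) mulr_sumr.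
  by apply: eq_bigr => b _; rewrite mulrA.
transitivity (d%:~R * (M r s - \sum_(l < 14)
    M (inord (pos l).1) (inord (pos l).2) * (B l r s)%:~R)).
  congr (_ * (_ - _)); rewrite summxE; apply: eq_bigr => l _; by rewrite !mxE.
rewrite -{1}[r]inord_val -{1}[s]inord_val pick //.
transitivity (d%:~R * (
    \sum_(a < 7) \sum_(b < 7) (idelta a r)%:~R * (idelta b s)%:~R * M a b
  - \sum_(a < 7) \sum_(b < 7) \sum_(l < 14)
      (idelta a (pos l).1)%:~R * (idelta b (pos l).2)%:~R * (B l r s)%:~R * M a b)).
  congr (_ * (_ - _)); under [RHS]eq_bigr do rewrite exchange_big /=.
  rewrite exchange_big; apply: eq_bigr => l _ /=.
  have /andP[p1 p2] := pos7 _ (ltn_ord l).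
  rewrite pick // mulr_suml; apply: eq_bigr => a _.
  rewrite mulr_suml; apply: eq_bigr => b _; by rewrite mulrAC.
rewrite -sumrB mulr_sumr; apply: eq_bigr => a _.
rewrite -sumrB mulr_sumr; apply: eq_bigr => b _.
rewrite [in RHS]intrM -[RHS]mulrA; congr (_ * _).
rewrite [in RHS]intrB intr_isum [RHS]mulrBl intrM; congr (_ - _).
by rewrite mulr_suml; apply: eq_bigr => l _; rewrite !intrM.
Qed.

End Spanning.

Module G2Tables.
Local Open Scope nat_scope.
Local Notation neg n := (- (n%:Z))%R.
Local Notation pos n := (n%:Z)%R (only parsing).

(** Root vectors for the Cartan subalgebra of diagonal matrices, six for the short roots and six for
    the long ones, followed by two diagonal matrices. The last eight kill E_0 and span a copy of
    sl_3. *)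
Definition basis0_list : seq (seq (nat * nat * int)) := [::
    [:: (0, 1, neg 1); (2, 6, neg 1); (3, 5, pos 1); (4, 0, pos 2)];
    [:: (0, 2, neg 1); (1, 6, pos 1); (3, 4, neg 1); (5, 0, pos 2)];
    [:: (0, 3, neg 1); (1, 5, neg 1); (2, 4, pos 1); (6, 0, pos 2)];
    [:: (0, 4, neg 1); (1, 0, pos 2); (5, 3, neg 1); (6, 2, pos 1)];
    [:: (0, 5, pos 1); (2, 0, neg 2); (4, 3, neg 1); (6, 1, pos 1)];
    [:: (0, 6, neg 1); (3, 0, pos 2); (4, 2, neg 1); (5, 1, pos 1)];
    [:: (2, 1, neg 1); (4, 5, pos 1)]; [:: (3, 1, neg 1); (4, 6, pos 1)];
    [:: (1, 2, neg 1); (5, 4, pos 1)]; [:: (3, 2, neg 1); (5, 6, pos 1)];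
    [:: (1, 3, neg 1); (6, 4, pos 1)]; [:: (2, 3, neg 1); (6, 5, pos 1)];
    [:: (1, 1, pos 1); (2, 2, neg 1); (4, 4, neg 1); (5, 5, pos 1)];
    [:: (1, 1, pos 1); (3, 3, neg 1); (4, 4, neg 1); (6, 6, pos 1)]].

(** Each position carries the entry 1 in the matching matrix of [basis0_list] and 0 in the others,
    so the entries of a derivation at these positions are its coordinates. *)
Definition pos0_list : seq (nat * nat) := [::
    (3, 5); (1, 6); (2, 4); (6, 2); (6, 1); (5, 1); (4, 5); (4, 6); (5, 4);
    (5, 6); (6, 4); (6, 5); (5, 5); (6, 6)].

(** Row r and column s hold the certificate for the entry (r, s): pairs of a coefficient and the
    triple (i, j, k) of a derivation equation. The factor 24 in [span_table0] clears the
    denominators, as does 6 in [span_table1]. *)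
Definition span0_list : seq (seq (seq (int * (nat * nat * nat)))) := [::
  [::

    [:: (neg 4, (0, 1, 4)); (neg 4, (0, 2, 5)); (neg 4, (0, 3, 6));
        (pos 2, (1, 2, 3)); (neg 2, (4, 5, 6))];
    [:: (neg 6, (0, 2, 3)); (pos 3, (2, 4, 5)); (neg 3, (3, 4, 6))];
    [:: (pos 6, (0, 1, 3)); (pos 3, (1, 4, 5)); (pos 3, (3, 5, 6))];
    [:: (neg 6, (0, 1, 2)); (neg 3, (1, 4, 6)); (pos 3, (2, 5, 6))];
    [:: (pos 6, (0, 5, 6)); (neg 3, (1, 2, 5)); (pos 3, (1, 3, 6))];
    [:: (neg 6, (0, 4, 6)); (pos 3, (1, 2, 4)); (pos 3, (2, 3, 6))];
    [:: (pos 6, (0, 4, 5)); (pos 3, (1, 3, 4)); (neg 3, (2, 3, 5))]];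
  [::
    [:: (neg 12, (1, 3, 6))];
    [:: (neg 8, (0, 1, 4)); (pos 4, (0, 2, 5)); (pos 4, (0, 3, 6));
        (neg 2, (1, 2, 3)); (neg 4, (4, 5, 6))];
    [:: (neg 12, (0, 1, 5))]; [:: (neg 12, (0, 1, 6))];
    [:: (pos 6, (1, 5, 6))]; [:: (neg 6, (1, 4, 6)); (pos 6, (2, 5, 6))];
    [::]];
  [::
    [:: (neg 12, (2, 3, 6))]; [:: (neg 12, (0, 2, 4))];
    [:: (pos 4, (0, 1, 4)); (neg 8, (0, 2, 5)); (pos 4, (0, 3, 6));
        (neg 2, (1, 2, 3)); (pos 2, (4, 5, 6))];
    [:: (neg 12, (0, 2, 6))]; [::]; [:: (neg 6, (2, 4, 6))];
    [:: (pos 6, (2, 4, 5)); (neg 6, (3, 4, 6))]];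
  [::
    [:: (pos 12, (2, 3, 5))]; [:: (neg 12, (0, 3, 4))];
    [:: (neg 12, (0, 3, 5))];
    [:: (pos 4, (0, 1, 4)); (pos 4, (0, 2, 5)); (neg 8, (0, 3, 6));
        (neg 2, (1, 2, 3)); (pos 2, (4, 5, 6))];
    [:: (pos 6, (1, 4, 5)); (pos 6, (3, 5, 6))]; [::];
    [:: (pos 6, (3, 4, 5))]];
  [::
    [:: (pos 12, (3, 4, 6))]; [:: (neg 6, (2, 3, 4))];
    [:: (pos 6, (1, 3, 4)); (neg 6, (2, 3, 5))];
    [:: (neg 6, (1, 2, 4)); (neg 6, (2, 3, 6))]; [:: (pos 6, (4, 5, 6))];
    [::]; [::]];
  [::
    [:: (neg 12, (1, 4, 5))]; [::]; [:: (pos 6, (1, 3, 5))];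
    [:: (neg 6, (1, 2, 5)); (pos 6, (1, 3, 6))]; [::]; [::]; [::]];
  [::
    [:: (neg 12, (2, 5, 6))]; [::]; [::]; [:: (neg 6, (1, 2, 6))]; [::];
    [::]; [::]]].

(** Each matrix is skew-symmetric, a combination of the infinitesimal rotations of two coordinate
    planes: this is the compact algebra inside so(7). *)
Definition basis1_list : seq (seq (nat * nat * int)) := [::
    [:: (0, 4, neg 1); (1, 3, neg 1); (3, 1, pos 1); (4, 0, pos 1)];
    [:: (0, 3, pos 1); (1, 4, neg 1); (3, 0, neg 1); (4, 1, pos 1)];
    [:: (0, 1, neg 1); (1, 0, pos 1); (3, 4, neg 1); (4, 3, pos 1)];
    [:: (0, 5, neg 1); (2, 3, neg 1); (3, 2, pos 1); (5, 0, pos 1)];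
    [:: (1, 5, neg 1); (2, 4, neg 1); (4, 2, pos 1); (5, 1, pos 1)];
    [:: (0, 3, pos 1); (2, 5, neg 1); (3, 0, neg 1); (5, 2, pos 1)];
    [:: (0, 2, neg 1); (2, 0, pos 1); (3, 5, neg 1); (5, 3, pos 1)];
    [:: (1, 2, neg 1); (2, 1, pos 1); (4, 5, neg 1); (5, 4, pos 1)];
    [:: (0, 6, neg 1); (2, 4, neg 1); (4, 2, pos 1); (6, 0, pos 1)];
    [:: (1, 6, neg 1); (2, 3, pos 1); (3, 2, neg 1); (6, 1, pos 1)];
    [:: (1, 3, neg 1); (2, 6, neg 1); (3, 1, pos 1); (6, 2, pos 1)];
    [:: (1, 2, pos 1); (2, 1, neg 1); (3, 6, neg 1); (6, 3, pos 1)];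
    [:: (0, 2, neg 1); (2, 0, pos 1); (4, 6, neg 1); (6, 4, pos 1)];
    [:: (0, 1, pos 1); (1, 0, neg 1); (5, 6, neg 1); (6, 5, pos 1)]].

Definition pos1_list : seq (nat * nat) := [::
    (4, 0); (4, 1); (4, 3); (5, 0); (5, 1); (5, 2); (5, 3); (5, 4); (6, 0);
    (6, 1); (6, 2); (6, 3); (6, 4); (6, 5)].

Definition span1_list : seq (seq (seq (int * (nat * nat * nat)))) := [::
  [::

    [:: (pos 2, (0, 1, 2)); (pos 2, (0, 3, 6)); (neg 2, (0, 4, 5));
        (neg 1, (1, 3, 5)); (neg 1, (1, 4, 6)); (pos 1, (2, 3, 4)); (neg 1, (2, 5, 6))];
    [:: (pos 6, (0, 4, 6))]; [:: (pos 6, (0, 5, 6))];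
    [:: (neg 3, (0, 1, 5)); (pos 3, (0, 2, 4)); (pos 3, (1, 2, 3)); (pos 3, (3, 4, 5))];
    [:: (neg 3, (0, 1, 6)); (neg 3, (0, 2, 3)); (pos 3, (1, 2, 4)); (neg 3, (3, 4, 6))];
    [:: (pos 3, (0, 1, 3)); (neg 3, (0, 2, 6)); (pos 3, (1, 2, 5)); (neg 3, (3, 5, 6))];
    [:: (pos 3, (0, 1, 4)); (pos 3, (0, 2, 5)); (pos 3, (1, 2, 6));
        (neg 3, (4, 5, 6))]];
  [::

    [:: (pos 3, (0, 3, 5)); (neg 3, (0, 4, 6)); (pos 3, (1, 3, 6)); (neg 3, (1, 4, 5))];
    [:: (pos 2, (0, 1, 2)); (neg 1, (0, 3, 6)); (pos 1, (0, 4, 5));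
        (pos 2, (1, 3, 5)); (pos 2, (1, 4, 6)); (pos 1, (2, 3, 4)); (neg 1, (2, 5, 6))];
    [:: (pos 6, (1, 5, 6))];
    [:: (pos 3, (0, 1, 6)); (neg 3, (0, 2, 3)); (pos 3, (1, 2, 4)); (neg 3, (3, 4, 6))];
    [:: (neg 3, (0, 1, 5)); (neg 3, (0, 2, 4)); (neg 3, (1, 2, 3)); (neg 3, (3, 4, 5))];
    [:: (pos 3, (0, 1, 4)); (neg 3, (0, 2, 5)); (neg 3, (1, 2, 6)); (neg 3, (4, 5, 6))];
    [:: (neg 3, (0, 1, 3)); (neg 3, (0, 2, 6)); (pos 3, (1, 2, 5));
        (pos 3, (3, 5, 6))]];
  [::

    [:: (neg 3, (0, 3, 4)); (neg 3, (0, 5, 6)); (pos 3, (2, 3, 6)); (neg 3, (2, 4, 5))];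
    [:: (neg 3, (1, 3, 4)); (neg 3, (1, 5, 6)); (pos 3, (2, 3, 5)); (pos 3, (2, 4, 6))];
    [:: (pos 2, (0, 1, 2)); (neg 1, (0, 3, 6)); (pos 1, (0, 4, 5));
        (neg 1, (1, 3, 5)); (neg 1, (1, 4, 6)); (neg 2, (2, 3, 4)); (pos 2, (2, 5, 6))];
    [:: (pos 3, (0, 1, 3)); (pos 3, (0, 2, 6)); (pos 3, (1, 2, 5)); (neg 3, (3, 5, 6))];
    [:: (pos 3, (0, 1, 4)); (neg 3, (0, 2, 5)); (pos 3, (1, 2, 6)); (neg 3, (4, 5, 6))];
    [:: (pos 3, (0, 1, 5)); (pos 3, (0, 2, 4)); (neg 3, (1, 2, 3)); (neg 3, (3, 4, 5))];
    [:: (pos 3, (0, 1, 6)); (neg 3, (0, 2, 3)); (neg 3, (1, 2, 4));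
        (neg 3, (3, 4, 6))]];
  [::
    [:: (neg 6, (3, 4, 5))]; [:: (pos 6, (3, 4, 6))];
    [:: (pos 6, (3, 5, 6))];
    [:: (neg 1, (0, 1, 2)); (pos 2, (0, 3, 6)); (pos 1, (0, 4, 5));
        (pos 2, (1, 3, 5)); (neg 1, (1, 4, 6)); (neg 2, (2, 3, 4)); (neg 1, (2, 5, 6))];
    [:: (neg 3, (0, 3, 5)); (pos 3, (0, 4, 6)); (pos 3, (1, 3, 6)); (pos 3, (1, 4, 5))];
    [:: (pos 3, (0, 3, 4)); (pos 3, (0, 5, 6)); (pos 3, (2, 3, 6)); (pos 3, (2, 4, 5))];
    [:: (neg 3, (1, 3, 4)); (neg 3, (1, 5, 6)); (neg 3, (2, 3, 5));
        (pos 3, (2, 4, 6))]];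
  [::
    [::]; [::]; [:: (pos 6, (4, 5, 6))]; [::];
    [:: (neg 1, (0, 1, 2)); (neg 1, (0, 3, 6)); (neg 2, (0, 4, 5));
        (neg 1, (1, 3, 5)); (pos 2, (1, 4, 6)); (neg 2, (2, 3, 4)); (neg 1, (2, 5, 6))];
    [:: (pos 3, (1, 3, 4)); (pos 3, (1, 5, 6)); (neg 3, (2, 3, 5)); (pos 3, (2, 4, 6))];
    [:: (pos 3, (0, 3, 4)); (pos 3, (0, 5, 6)); (neg 3, (2, 3, 6));
        (neg 3, (2, 4, 5))]];
  [::
    [::]; [::]; [::]; [::]; [::];
    [:: (neg 1, (0, 1, 2)); (neg 1, (0, 3, 6)); (neg 2, (0, 4, 5));
        (pos 2, (1, 3, 5)); (neg 1, (1, 4, 6)); (pos 1, (2, 3, 4)); (pos 2, (2, 5, 6))];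
    [:: (pos 3, (0, 3, 5)); (neg 3, (0, 4, 6)); (pos 3, (1, 3, 6));
        (pos 3, (1, 4, 5))]];
  [::
    [::]; [::]; [::]; [::]; [::]; [::];
    [:: (neg 1, (0, 1, 2)); (pos 2, (0, 3, 6)); (pos 1, (0, 4, 5));
        (neg 1, (1, 3, 5)); (pos 2, (1, 4, 6)); (pos 1, (2, 3, 4));
        (pos 2, (2, 5, 6))]]].

End G2Tables.

Definition basis0 (l : nat) : itable := sparse (nth [::] G2Tables.basis0_list l).
Definition basis1 (l : nat) : itable := sparse (nth [::] G2Tables.basis1_list l).
Definition pos0 (l : nat) := nth (0, 0)%N G2Tables.pos0_list l.
Definition pos1 (l : nat) := nth (0, 0)%N G2Tables.pos1_list l.

Lemma span_table0 : span_table iOmega0 basis0 pos0 24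
  (fun r s => nth [::] (nth [::] G2Tables.span0_list r) s).
Proof. by vm_compute. Qed.

Lemma span_table1 : span_table (iOmega_pm 1) basis1 pos1 6
  (fun r s => nth [::] (nth [::] G2Tables.span1_list r) s).
Proof. by vm_compute. Qed.

Section Bases.
Variable F : numFieldType.

Lemma der0_span (M : 'M[F]_7) : der_mx (Omega0 F) M ->
  M = \sum_(l < 14) M (inord (pos0 l).1) (inord (pos0 l).2) *: imx F (basis0 l).
Proof.
move=> /(der_mxP _ (Omega0_table F)).
apply: (der_span span_table0); first by rewrite pnatr_eq0.
by apply: allnP; vm_compute.
Qed.

Lemma der1_span (M : 'M[F]_7) : der_mx (Omega1 F) M ->
  M = \sum_(l < 14) M (inord (pos1 l).1) (inord (pos1 l).2) *: imx F (basis1 l).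
Proof.
move=> /(der_mxP _ (Omega1_table F)).
apply: (der_span span_table1); first by rewrite pnatr_eq0.
by apply: allnP; vm_compute.
Qed.

Lemma der0_basis l : (l < 14)%N -> der_mx (Omega0 F) (imx F (basis0 l)).
Proof.
move=> l14; apply: (der_imx (Omega0_table F)); move: l l14; apply: allnP.
by vm_compute.
Qed.

Lemma der1_basis l : (l < 14)%N -> der_mx (Omega1 F) (imx F (basis1 l)).
Proof.
move=> l14; apply: (der_imx (Omega1_table F)); move: l l14; apply: allnP.
by vm_compute.
Qed.

End Bases.

(** * Derivations of the octonions *)

Definition ioct_n : itable := fun i j =>
  - (idelta i 0 * idelta j 0)
  - 2 * (idelta i 1 * idelta j 4 + idelta i 4 * idelta j 1
       + (idelta i 2 * idelta j 5 + idelta i 5 * idelta j 2)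
       + (idelta i 3 * idelta j 6 + idelta i 6 * idelta j 3)).

Definition skew_table (b : itable) : bool :=
  alln 7 (fun i => alln 7 (fun j =>
    isum 7 (fun a => b i a * ioct_n a j) + isum 7 (fun a => ioct_n i a * b j a)
    == 0)).

Section OctonionDerivations.
Variable F : numFieldType.
Local Notation V := 'rV[F]_7.

Lemma oct_nE (X Y : V) : oct_n X Y = (X *m imx F ioct_n *m Y^T) 0 0.
Proof.
have h (i j : 'I_7) :
    oct_n (delta_mx 0 i) (delta_mx 0 j) = (ioct_n i j)%:~R :> F.
  rewrite /oct_n sum13 /Est /Fst !crd_delta // /ioct_n.
  ring.
have n0 A : oct_n A 0 = 0 :> F := linear_fun0 (W := F^o) (oct_n_lin2 A).
have sumr A (f : 'I_7 -> F) (U : 'I_7 -> V) :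
    oct_n A (\sum_i f i *: U i) = \sum_i f i * oct_n A (U i).
  elim/big_rec2: _ => [|i y x _ <-]; first exact: n0.
  by rewrite oct_n_lin2.
rewrite {1}[X]row_sum_delta oct_nC sumr mxE.
under eq_bigr do rewrite oct_nC {1}[Y]row_sum_delta sumr mulr_sumr.
rewrite exchange_big /=. apply: eq_bigr => j _ /=.
rewrite !mxE mulr_suml; apply: eq_bigr => i _.
by rewrite mxE h mulrA mulrAC.
Qed.

Lemma skew_basis0 l : (l < 14)%N ->
  imx F (basis0 l) *m imx F ioct_n + imx F ioct_n *m (imx F (basis0 l))^T = 0.
Proof.
have chk : alln 14 (fun l => skew_table (basis0 l)).
  by vm_compute.
move=> /(allnP chk) {}chk; apply/matrixP => i j; rewrite !mxE.
have /eqP/(congr1 (fun z : int => z%:~R : F)) :=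
  allnP (allnP chk (ltn_ord i)) (ltn_ord j).
rewrite intrD !intr_isum mulr0z => E; rewrite -[RHS]E.
by congr (_ + _); apply: eq_bigr => a _; rewrite !mxE intrM.
Qed.

(** Invariance of the 3-form forces invariance of the norm. Skewness is linear in [M], so it is
    checked on the spanning matrices only. *)
Lemma der0_skew (M : 'M[F]_7) : der_mx (Omega0 F) M ->
  forall X Y, oct_n (X *m M) Y + oct_n X (Y *m M) = 0.
Proof.
move=> /der0_span E; have sk : M *m imx F ioct_n + imx F ioct_n *m M^T = 0.
  rewrite E mulmx_suml linear_sum mulmx_sumr -big_split big1 // => l _ /=.
  rewrite -scalemxAl linearZ -scalemxAr -scalerDr.
  by rewrite skew_basis0 ?scaler0.
move=> X Y; rewrite !oct_nE trmx_mul !mulmxA.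
transitivity ((X *m (M *m imx F ioct_n + imx F ioct_n *m M^T) *m Y^T) 0 0).
  by rewrite mulmxDr mulmxDl !mulmxA [RHS]mxE.
by rewrite sk mulmx0 mul0mx mxE.
Qed.

Lemma der0_cross (M : 'M[F]_7) : der_mx (Omega0 F) M ->
  forall X Y, oct_cross X Y *m M = oct_cross (X *m M) Y + oct_cross X (Y *m M).
Proof.
move=> dM X Y; apply: oct_n_inj => Z.
have := oct_n_lin1 Z 1; move/(_ (oct_cross (X *m M) Y) (oct_cross X (Y *m M))).
rewrite scale1r mul1r => ->; rewrite !oct_crossP.
apply: (addIr (Omega0 F X Y (Z *m M))).
by rewrite dM -oct_crossP; exact: der0_skew.
Qed.

Lemma der0_of_cross (f : 'M[F]_7) :
  (forall X Y, oct_n (X *m f) Y + oct_n X (Y *m f) = 0) ->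
  (forall X Y, oct_cross X Y *m f = oct_cross (X *m f) Y + oct_cross X (Y *m f)) ->
  der_mx (Omega0 F) f.
Proof.
move=> sk cr X Y Z; rewrite -!oct_crossP.
have := oct_n_lin1 Z 1; move/(_ (oct_cross (X *m f) Y) (oct_cross X (Y *m f))).
by rewrite scale1r mul1r => <-; rewrite -cr sk.
Qed.

Definition oct_ext (M : 'M[F]_7) : gl (octonion F) :=
  linfun (fun p : octonion F => (0, p.2 *m M) : octonion F).

Lemma oct_extE M p : oct_ext M p = (0, p.2 *m M).
Proof.
have lin : linear (fun p : octonion F => (0, p.2 *m M) : octonion F).
  move=> a x y; congr (_, _); first by rewrite /= scaler0 addr0.
  by rewrite /= mulmxDl scalemxAl.
pose fL : {linear octonion F -> octonion F} :=
  HB.pack_for {linear octonion F -> octonion F}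
   (fun p : octonion F => (0, p.2 *m M) : octonion F)
  (GRing.isLinear.Build F (octonion F) (octonion F) _ _ lin).
exact: (lfunE fL).
Qed.

Lemma oct_ext_der M : der_mx (Omega0 F) M -> is_der_oct (oct_ext M).
Proof.
move=> dM x y; rewrite !oct_extE; congr (_, _) => /=.
  rewrite mul0r mulr0 !sub0r -opprD.
  by rewrite der0_skew // oppr0.
rewrite !mulmxDl -!scalemxAl der0_cross // !scale0r !add0r !addr0.
by rewrite [X in X + _ = _]addrC addrACA.
Qed.

Section Restriction.
Variables (d : gl (octonion F)) (dd : is_der_oct d).

(** From 1 = 1 . 1 comes d(1) = d(1) + d(1). *)
Lemma der_oct1 : d (1, 0) = 0.
Proof.
have n0 A : oct_n (A : V) 0 = 0 := linear_fun0 (W := F^o) (oct_n_lin2 A).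
have n0' A : oct_n (0 : V) A = 0 by rewrite oct_nC n0.
have l1 p : oct_mul (1, 0) p = p :> octonion F.
  have cp : oct_cross 0 p.2 = 0 := linear_fun0 (oct_cross_lin1 p.2).
  case: p cp => a X cp; congr (_, _) => /=.
    by rewrite mul1r n0' subr0.
  by rewrite scale1r scaler0 cp !addr0.
have l2 p : oct_mul p (1, 0) = p :> octonion F.
  have cp : oct_cross p.2 0 = 0 := linear_fun0 (oct_cross_lin2 p.2).
  case: p cp => a X cp; congr (_, _) => /=.
    by rewrite mulr1 n0 subr0.
  by rewrite scale1r scaler0 cp add0r addr0.
have := dd (1, 0) (1, 0); rewrite l1 l2 l1 => /eqP.
by rewrite -subr_eq0 opprD addrA subrr sub0r oppr_eq0 => /eqP.
Qed.

Lemma der_oct_real a : d (a, 0) = 0.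
Proof.
have -> : (a, 0) = a *: (1, 0) :> octonion F.
  by congr (_, _); rewrite /= ?scaler0 // /GRing.scale /= mulr1.
by rewrite linearZ /= der_oct1 scaler0.
Qed.

Definition oct_res : 'M[F]_7 := lin1_mx (fun X : V => (d (0, X)).2).

Lemma oct_resE X : X *m oct_res = (d (0, X)).2.
Proof.
have lin : linear (fun X : V => (d (0, X)).2).
  move=> a Y Z.
  have -> : (0, a *: Y + Z) = a *: (0, Y) + (0, Z) :> octonion F.
    by congr (_, _); rewrite /= scaler0 addr0.
  by rewrite linearP.
pose fL : {linear V -> V} := HB.pack_for {linear V -> V}
  (fun X : V => (d (0, X)).2) (GRing.isLinear.Build F V V _ _ lin).
exact: (mul_rV_lin1 fL).
Qed.

Lemma cross_xx (X : V) : oct_cross X X = 0.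
Proof.
case: (form3P (Omega0 F)) => _ _ _ alt _ _.
apply: oct_n_inj => Z; rewrite oct_crossP alt.
exact: esym (linear_fun0 (W := F^o) (oct_n_lin1 Z)).
Qed.

Lemma cross_anti (X Y : V) : oct_cross X Y = - oct_cross Y X.
Proof.
have := cross_xx (X + Y); have := oct_cross_lin1 (X + Y) 1 X Y.
rewrite !scale1r => ->; have := oct_cross_lin2 X 1 X Y.
have := oct_cross_lin2 Y 1 X Y; rewrite !scale1r => -> ->.
by rewrite !cross_xx addr0 add0r => /eqP; rewrite addr_eq0 => /eqP.
Qed.

(** The square of an imaginary X is a scalar, hence killed by d. If a is the real part of d(X), the
    imaginary part of d(X) X + X d(X) = 0 is 2 a X, so a = 0. *)
Lemma der_oct_im X : d (0, X) = (0, X *m oct_res).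
Proof.
rewrite oct_resE; case: (eqVneq X 0) => [->|X0].
  by rewrite (_ : (0, 0) = 0) // linear0.
have := dd (0, X) (0, X); rewrite /oct_mul /= cross_xx !scale0r !addr0.
rewrite der_oct_real; case: (d (0, X)) => a Y /= [_].
rewrite add0r addrACA [oct_cross Y X]cross_anti addNr addr0.
move/esym/eqP; rewrite -mulr2n -scaler_nat scalerA scaler_eq0 (negPf X0) orbF.
by rewrite mulf_eq0 pnatr_eq0 /= => /eqP ->.
Qed.

Lemma oct_res_der : der_mx (Omega0 F) oct_res.
Proof.
have E X Y := dd (0, X) (0, Y).
suff E2 X Y : - oct_n (X *m oct_res) Y - oct_n X (Y *m oct_res) = 0 /\
    oct_cross X Y *m oct_res
      = oct_cross (X *m oct_res) Y + oct_cross X (Y *m oct_res).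
  apply: der0_of_cross => X Y; last exact: (E2 X Y).2.
  by apply: oppr_inj; rewrite oppr0 opprD; exact: (E2 X Y).1.
have := E X Y; rewrite !der_oct_im /oct_mul /= !scale0r !add0r !mul0r !sub0r.
have -> : (- oct_n X Y, oct_cross X Y)
    = (- oct_n X Y, 0) + (0, oct_cross X Y) :> octonion F.
  by congr (_, _); rewrite /= ?addr0 ?add0r.
rewrite linearD /= der_oct_real der_oct_im add0r => -[<- ->].
by [].
Qed.

End Restriction.

Lemma DerOct_model : exists mu, mx_model (L := DerOct F) (der_mx (Omega0 F)) mu.
Proof.
have dP (d : DerOct F) : is_der_oct (val d) by case: d => d /= /asboolP.
exists (fun d => oct_res (val d)); split.
- move=> a f g; apply/row_matrixP => i.
  rewrite !rowE mulmxDr -scalemxAr !oct_resE.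
  by rewrite [val _]/(a *: val f + val g) gl_addE gl_scaleE.
- move=> f g fg; apply/val_inj/lfunP => -[a X].
  have -> : (a, X) = (a, 0) + (0, X) :> octonion F.
    by congr (_, _); rewrite /= ?addr0 ?add0r.
  rewrite !linearD /= !der_oct_real ?add0r; try exact: dP.
  rewrite !der_oct_im ?fg //; exact: dP.
- by move=> d; apply/oct_res_der/dP.
- move=> M dM; have dE : oct_ext M \in lsub_pred (DerOct F).
    exact/asboolP/oct_ext_der.
  exists (SubLie dE); apply/row_matrixP => i.
  by rewrite !rowE oct_resE /= oct_extE.
- move=> f g; apply/row_matrixP => i.
  rewrite !rowE mulmxBr !mulmxA !oct_resE.
  rewrite [val _]/(gl_lbr (val f) (val g)) gl_lbrE /=.
  by rewrite !der_oct_im /= ?oct_resE //; exact: dP.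
Qed.

End OctonionDerivations.

(** * Representations of a principal sl2 *)

Section PrincipalRepresentations.
Variable C : numClosedFieldType.
Local Notation V := 'rV[C]_7.
Implicit Types (h e f g : 'M[C]_7) (v : V).

Lemma eigen_bound h (s : seq C) : uniq s ->
  (forall a, a \in s -> exists2 v : V, v *m h = a *: v & v != 0) ->
  (size s <= 7)%N.
Proof.
move=> us rs; have := @max_poly_roots _ (char_poly h) s.
rewrite size_char_poly ltnS; apply=> //; last first.
  by apply/allP => a /rs/eigenvalueP; rewrite eigenvalue_root_char.
by rewrite -size_poly_eq0 size_char_poly.
Qed.

Lemma eigen_shift h g c a v i : g *m h = h *m g + c *: g ->
  v *m h = a *: v -> v *m g ^+ i *m h = (a + c *+ i) *: (v *m g ^+ i).
Proof.
move=> hg hv; elim: i => [|i IHi]; first by rewrite expr0 mulmx1 mulr0n addr0.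
rewrite exprSr -mulmxE mulmxA -[X in X = _]mulmxA hg mulmxDr mulmxA IHi.
by rewrite -scalemxAl -scalemxAr -scalerDl mulrSr addrA.
Qed.

(** As long as they are nonzero, the vectors [v *m g ^+ i] are eigenvectors of [h] for distinct
    eigenvalues, of which there are at most 7. *)
Lemma string_end h g c a v : c != 0 -> g *m h = h *m g + c *: g ->
  v != 0 -> v *m h = a *: v ->
  exists k, [/\ (k <= 6)%N, forall i, (i <= k)%N -> v *m g ^+ i != 0
              & v *m g ^+ k.+1 = 0].
Proof.
move=> c0 hg v0 hv.
have bound k : (forall i, (i <= k)%N -> v *m g ^+ i != 0) -> (k <= 6)%N.
  move=> nz; have := @eigen_bound h [seq a + c *+ i | i <- iota 0 k.+1].
  rewrite size_map size_iota ltnS; apply.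
    rewrite map_inj_in_uniq ?iota_uniq // => i j _ _ /addrI/eqP.
    rewrite -[c *+ i]mulr_natr -[c *+ j]mulr_natr (inj_eq (mulfI c0)).
    by rewrite eqr_nat => /eqP.
  move=> _ /mapP[i + ->]; rewrite mem_iota add0n ltnS => ik.
  by exists (v *m g ^+ i); [exact: eigen_shift | exact: nz].
have [k vk] : exists k, v *m g ^+ k == 0.
  apply: contrapT => nz; suff /bound : forall i, (i <= 7)%N -> v *m g ^+ i != 0 by [].
  by move=> i _; apply/negP => vi; apply: nz; exists i.
have exk : exists k, v *m g ^+ k == 0 by exists k.
case: (ex_minnP exk) => -[|m] /eqP vm minm.
  by move: v0; rewrite -[v]mulmx1 -[1%:M]/(g ^+ 0) vm eqxx.
have nz i : (i <= m)%N -> v *m g ^+ i != 0.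
  by move=> im; apply/negP => /minm; rewrite leqNgt ltnS im.
by exists m; split=> //; exact: bound.
Qed.

(** Matrices act on the right, so [f *m e] is f followed by e. Read as operators, these are the
    usual relations [h, e] = 2 e, [h, f] = - 2 f and [e, f] = h: e raises weights by 2. *)
Record sl2_triple h e f : Prop := Sl2Triple {
  sl2_he : e *m h = h *m e + 2 *: e;
  sl2_hf : f *m h = h *m f - 2 *: f;
  sl2_ef : f *m e = e *m f + h
}.

(** Turns statements on highest weight vectors into statements on lowest weight vectors. *)
Lemma sl2_swap h e f : sl2_triple h e f -> sl2_triple (- h) f e.
Proof.
case=> he hf ef; split.
- by rewrite mulmxN mulNmx hf opprB addrC.
- by rewrite mulmxN mulNmx he opprD.
- by rewrite ef addrK.
Qed.

Lemma sl2_lower h e f a v i : sl2_triple h e f -> v *m e = 0 ->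
  v *m h = a *: v ->
  v *m f ^+ i.+1 *m e = (i.+1%:R * (a - i%:R)) *: (v *m f ^+ i).
Proof.
case=> he hf ef ve vh.
have hfi i' : v *m f ^+ i' *m h = (a + (- 2) *+ i') *: (v *m f ^+ i').
  by apply: eigen_shift => //; rewrite scaleNr.
elim: i => [|i IHi].
  by rewrite expr1 expr0 mulmx1 subr0 mul1r -mulmxA ef mulmxDr mulmxA ve mul0mx add0r.
rewrite exprSr -mulmxE mulmxA -mulmxA ef mulmxDr mulmxA IHi hfi.
rewrite -scalemxAl -mulmxA mulmxE -exprSr -scalerDl; congr (_ *: _).
by rewrite -mulr_natr -!natr1; ring.
Qed.

(** If the string of f ends after step k, [sl2_lower] gives (k + 1) (a - k) = 0 there, so the weight
    is the length of the string. *)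
Lemma sl2_primitive h e f a v : sl2_triple h e f -> v != 0 ->
  v *m e = 0 -> v *m h = a *: v ->
  exists n, [/\ (n <= 6)%N, a = n%:R, forall i, (i <= n)%N -> v *m f ^+ i != 0
              & v *m f ^+ n.+1 = 0].
Proof.
move=> S v0 ve vh; have [he hf ef] := S.
have [//||k [k6 nz vk]] := @string_end h f (- 2) a v _ _ v0 vh.
- by rewrite oppr_eq0 pnatr_eq0.
- by rewrite scaleNr.
exists k; split=> //.
have /eqP := sl2_lower k S ve vh; rewrite vk mul0mx eq_sym scaler_eq0.
by rewrite (negPf (nz k _)) // orbF mulf_eq0 pnatr_eq0 subr_eq0 => /eqP.
Qed.

Lemma sl2_highest h e f a v : sl2_triple h e f -> v != 0 -> v *m h = a *: v ->
  exists n k, [/\ (n <= 6)%N, a + (2 * k)%:R = n%:R &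
   exists u : V, [/\ u != 0, u *m e = 0, u *m h = n%:R *: u,
     forall i, (i <= n)%N -> u *m f ^+ i != 0 & u *m f ^+ n.+1 = 0]].
Proof.
move=> S v0 vh; have [he hf ef] := S.
have [//|//|k [k6 nz vk]] := @string_end h e 2 a v _ _ v0 vh.
  by rewrite pnatr_eq0.
pose u := v *m e ^+ k; have u0 : u != 0 by exact: nz.
have ue : u *m e = 0 by rewrite -mulmxA mulmxE -exprSr vk.
have uh : u *m h = (a + 2 *+ k) *: u by exact: eigen_shift.
have [n [n6 an nzn un]] := sl2_primitive S u0 ue uh.
exists n, k; rewrite -an natrM mulr_natr; split=> //.
by exists u; split=> //; rewrite an.
Qed.

Lemma sl2_weight_lt h e f m v : sl2_triple h e f -> (6 < m)%N ->
  v *m h = m%:R *: v \/ v *m h = - m%:R *: v -> v = 0.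
Proof.
have main g e' f' : sl2_triple g e' f' -> (6 < m)%N -> v *m g = m%:R *: v -> v = 0.
  move=> S m6 vh; apply/eqP/negPn/negP => v0.
  have [n [k [n6 + _]]] := sl2_highest S v0 vh.
  by move=> /eqP; rewrite -natrD eqr_nat; lia.
move=> S m6 [|vh]; first exact: main S m6.
by apply: (main _ _ _ (sl2_swap S) m6); rewrite mulmxN vh scaleNr opprK.
Qed.

(* The [x k] span a copy of the 11-dimensional irreducible representation;
   together with [h], [e], [f] they satisfy relations that hold in the complex
   Lie algebra of type G2 for a principal sl2. *)
Record principal h e f (x : nat -> 'M[C]_7) : Prop := Principal {
  principal_sl2 : sl2_triple h e f;
  principal_hx : forall k, (k <= 10)%N ->
    x k *m h = h *m x k + (10 - (2 * k)%:R) *: x k;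
  principal_ex : x 0%N *m e = e *m x 0%N;
  principal_fx : forall k, (k < 10)%N ->
    x k *m f - f *m x k = k.+1%:R *: x k.+1;
  principal_rel :
    14 *: (x 10%N *m x 0%N - x 0%N *m x 10%N) = - 15 *: h - x 5%N
}.

(** For the characteristic polynomial p of h, one has p(h + c) g = g p(h) = 0. If p(X) and p(X + c)
    were coprime, Bezout would make p(h + c) invertible and g zero. This replaces a decomposition
    into generalized eigenspaces. *)
Lemma shift_common_root h g c : g != 0 -> g *m h = h *m g + c *: g ->
  exists a, eigenvalue h a /\ eigenvalue h (a + c).
Proof.
move=> g0 hg; pose p := char_poly h; pose q := p \Po ('X + c%:P).
have ph : horner_mx h p = 0 by exact: Cayley_Hamilton.
have qE r : horner_mx h (r \Po ('X + c%:P)) = horner_mx (h + c%:M) r.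
  elim/poly_ind: r => [|r d IHr]; first by rewrite comp_poly0 !rmorph0.
  rewrite comp_polyD comp_polyM comp_polyX comp_polyC !rmorphD !rmorphM /=.
  by rewrite IHr rmorphD /= !horner_mx_X !horner_mx_C.
have gE r : g *m horner_mx h r = horner_mx (h + c%:M) r *m g.
  elim/poly_ind: r => [|r d IHr]; first by rewrite !rmorph0 mulmx0 mul0mx.
  rewrite !rmorphD !rmorphM /= !horner_mx_X !horner_mx_C mulmxDr mulmxDl.
  rewrite -scalar_mxC -!mulmxE mulmxA IHr -!mulmxA; congr (_ *m _ + _).
  by rewrite hg mulmxDl mul_scalar_mx.
have : ~~ coprimep p q.
  apply/negP => /Bezout_eq1_coprimepP[[u w] /= /(congr1 (horner_mx h))].
  rewrite rmorphD !rmorphM rmorph1 /= ph mulr0 add0r => wq.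
  have : horner_mx h w * horner_mx h q * g = g by rewrite wq mul1r.
  rewrite -mulrA -!mulmxE qE -gE ph !mulmx0.
  by move=> g0'; rewrite -g0' eqxx in g0.
rewrite /coprimep => /closed_rootP[a]; rewrite root_gcd => /andP[pa qa].
exists a; rewrite !eigenvalue_root_char; split=> //.
by move: qa; rewrite /q /root horner_comp !hornerE.
Qed.

Section PrincipalChain.
Variables (h e f : 'M[C]_7) (x : nat -> 'M[C]_7) (pr : principal h e f x).
Variables (n : nat) (v : V).
Hypotheses (n5 : (4 < n)%N) (vh : v *m h = n%:R *: v).
Let w i : V := v *m f ^+ i.
Let S := principal_sl2 pr.

Lemma principal_wS i : w i *m f = w i.+1.
Proof. by rewrite /w -mulmxA mulmxE -exprSr. Qed.

Lemma principal_wh i : w i *m h = (n%:R - (2 * i)%:R) *: w i.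
Proof.
rewrite /w (eigen_shift (c := - 2) i _ vh); last by rewrite scaleNr; case: S.
by rewrite natrM mulr_natr mulNrn.
Qed.

Lemma principal_wx i k : (k <= 10)%N -> w i *m x k *m h =
  ((n + 10)%:R - (2 * (i + k))%:R) *: (w i *m x k).
Proof.
move=> k10; rewrite -mulmxA (principal_hx pr) // mulmxDr mulmxA principal_wh.
rewrite -scalemxAr -scalemxAl -scalerDl; congr (_ *: _).
by rewrite !natrM !natrD; ring.
Qed.

(** The weight n + 10 - 2 (i + k) exceeds 6, because n > 4. *)
Lemma principal_wx0 i k : (i + k <= 4)%N -> w i *m x k = 0.
Proof.
move=> ik; apply: (@sl2_weight_lt h e f (n + 10 - 2 * (i + k)) _ S); first lia.
by left; rewrite principal_wx; [rewrite natrB //; lia | lia].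
Qed.

Lemma principal_step k i a b (z : V) : (k < 10)%N -> w i *m x k *m f = a *: z ->
  w i.+1 *m x k = b *: z -> w i *m x k.+1 = ((a - b) / k.+1%:R) *: z.
Proof.
move=> k10 wf wS; have k0 : k.+1%:R != 0 :> C by rewrite pnatr_eq0.
apply: (scalerI k0); rewrite scalerA mulrCA divff // mulr1.
by rewrite scalemxAr -(principal_fx pr) // mulmxBr !mulmxA wf principal_wS wS scalerBl.
Qed.

(** By [principal_step], the product w_i x_(k+1) is known from w_i x_k and w_(i+1) x_k. Starting
    from the zero products with i + k <= 4, the families a, b, c below run along the lines i + k =
    5, 6, 7 and are multiples of u = w_5 x_0, of u f and of u f f. *)
Lemma principal_chain t : w 6 *m x 0 = t *: (w 5 *m x 0 *m f) -> w 7 = 0 ->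
  w 1 *m x 5 = ((5 - t) / 120) *: (w 5 *m x 0 *m f) /\
  w 2 *m x 5 = ((t - 2) / 24) *: (w 5 *m x 0 *m f *m f).
Proof.
set u := w 5 *m x 0 => w6 w7.
have st k i a b c (z : V) : (k < 10)%N -> w i *m x k *m f = a *: z ->
    w i.+1 *m x k = b *: z -> (a - b) / k.+1%:R = c -> w i *m x k.+1 = c *: z.
  by move=> k10 wf wS <-; exact: principal_step.
have s0 k i : (i + k <= 4)%N -> w i *m x k *m f = 0 *: u.
  by move=> ik; rewrite principal_wx0 // mul0mx scale0r.
have sf i k c (z : V) : w i *m x k = c *: z -> w i *m x k *m f = c *: (z *m f).
  by move=> ->; rewrite scalemxAl.
have a0 : w 5 *m x 0 = 1 *: u by rewrite scale1r.
have a1 : w 4 *m x 1 = (- 1) *: u by apply: st (s0 _ _ _) a0 _ => //; field.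
have a2 : w 3 *m x 2 = (1 / 2) *: u by apply: st (s0 _ _ _) a1 _ => //; field.
have a3 : w 2 *m x 3 = (- 1 / 6) *: u by apply: st (s0 _ _ _) a2 _ => //; field.
have a4 : w 1 *m x 4 = (1 / 24) *: u by apply: st (s0 _ _ _) a3 _ => //; field.
have b1 : w 5 *m x 1 = (1 - t) *: (u *m f).
  by apply: st (sf _ _ _ _ a0) w6 _ => //; field.
have b2 : w 4 *m x 2 = ((t - 2) / 2) *: (u *m f).
  by apply: st (sf _ _ _ _ a1) b1 _ => //; field.
have b3 : w 3 *m x 3 = ((3 - t) / 6) *: (u *m f).
  by apply: st (sf _ _ _ _ a2) b2 _ => //; field.
have b4 : w 2 *m x 4 = ((t - 4) / 24) *: (u *m f).
  by apply: st (sf _ _ _ _ a3) b3 _ => //; field.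
have b5 : w 1 *m x 5 = ((5 - t) / 120) *: (u *m f).
  by apply: st (sf _ _ _ _ a4) b4 _ => //; field.
have c0 : w 7 *m x 0 = 0 *: (u *m f *m f) by rewrite w7 mul0mx scale0r.
have c1 : w 6 *m x 1 = t *: (u *m f *m f).
  by apply: st (sf _ _ _ _ w6) c0 _ => //; field.
have c2 : w 5 *m x 2 = ((1 - 2 * t) / 2) *: (u *m f *m f).
  by apply: st (sf _ _ _ _ b1) c1 _ => //; field.
have c3 : w 4 *m x 3 = ((t - 1) / 2) *: (u *m f *m f).
  by apply: st (sf _ _ _ _ b2) c2 _ => //; field.
have c4 : w 3 *m x 4 = ((6 - 4 * t) / 24) *: (u *m f *m f).
  by apply: st (sf _ _ _ _ b3) c3 _ => //; field.
have c5 : w 2 *m x 5 = ((t - 2) / 24) *: (u *m f *m f).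
  by apply: st (sf _ _ _ _ b4) c4 _ => //; field.
by [].
Qed.

(** Both x_0 and x_10 push w_i out of the range -6..6 of weights, so the bracket in [principal_rel]
    vanishes on w_i and x_5 acts there as - 15 h. *)
Lemma principal_rel_w i : (n <= 3 + 2 * i)%N -> (i <= 2)%N ->
  w i *m x 5 = (- 15 * (n%:R - (2 * i)%:R)) *: w i.
Proof.
move=> ni i2; have x0 : w i *m x 0 = 0 by apply: principal_wx0; lia.
have x10 : w i *m x 10 = 0.
  apply: (@sl2_weight_lt h e f (10 + 2 * i - n) _ S); first lia.
  right; rewrite principal_wx //; congr (_ *: _).
  rewrite natrB; last lia.
  by rewrite !natrM !natrD; ring.
have := congr1 (mulmx (w i)) (principal_rel pr).
rewrite -scalemxAr !mulmxBr -scalemxAr !mulmxA x0 x10 !mul0mx subrr scaler0.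
by move/esym/eqP; rewrite subr_eq0 principal_wh scalerA => /eqP <-.
Qed.

End PrincipalChain.

(** There are weights a and a + 10. Climbing from the one and descending from the other gives a
    highest weight n and a lowest weight - n' with n + n' >= 10 and n, n' <= 6, so one of them is 6
    or both are 5. *)
Lemma principal_top h e f x : principal h e f x -> x 0 != 0 ->
  exists v : V, [/\ v != 0, v *m e = 0, v *m h = 6 *: v,
    forall i, (i <= 6)%N -> v *m f ^+ i != 0 & v *m f ^+ 7 = 0].
Proof.
move=> pr x0; have S := principal_sl2 pr; have [he hf ef] := S.
have [a []] := shift_common_root x0 (principal_hx pr (isT : (0 <= 10)%N)).
rewrite muln0 subr0 => /eigenvalueP[v1 vh1 v10] /eigenvalueP[v2 vh2 v20].
have [n [k [n6 nE [v [v0 ve vh nz vn]]]]] := sl2_highest S v20 vh2.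
have vh1' : v1 *m - h = (- a) *: v1 by rewrite mulmxN vh1 scaleNr.
have [n' [k' [n6' nE' [u [u0 uf uh uz un]]]]] :=
  sl2_highest (sl2_swap S) v10 vh1'.
have E : (n + n' = 10 + 2 * k + 2 * k')%N.
  apply/eqP; rewrite -(eqr_nat C) !natrD -nE -nE'; apply/eqP; ring.
have [n7|] := eqVneq n 6%N; first by subst n; exists v.
have [n7' _|ne' ne] := eqVneq n' 6%N.
  subst n'; exists (u *m e ^+ 6); have nz6 : u *m e ^+ 6 != 0 by exact: uz.
  have e6 : u *m e ^+ 6 *m e = 0 by rewrite -mulmxA mulmxE -exprSr.
  have h6 : u *m e ^+ 6 *m h = 6 *: (u *m e ^+ 6).
    rewrite (@eigen_shift h e 2 (- 6)) //.
      by congr (_ *: _); rewrite -mulr_natr; ring.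
    by rewrite scaleNr -uh mulmxN opprK.
  have [m [m6 /eqP]] := sl2_primitive S nz6 e6 h6.
  by rewrite eqr_nat => /eqP <-.
(* The case of V_5: here w_6 = 0, so [principal_chain] applies with t = 0, and its two conclusions
   contradict [principal_rel_w] on w_1 and w_2. *)
have n5 : n = 5%N by lia.
subst n; exfalso; pose w i : V := v *m f ^+ i.
have w7 : w 7 = 0 by rewrite /w exprSr -mulmxE mulmxA vn mul0mx.
have [|r1 r2] := principal_chain pr (isT : 4 < 5)%N vh (t := 0) _ w7.
  by rewrite scale0r vn mul0mx.
have := principal_rel_w pr (isT : 4 < 5)%N vh (i := 1) isT isT.
have := principal_rel_w pr (isT : 4 < 5)%N vh (i := 2) isT isT.
rewrite r1 r2 => h2 /(congr1 (mulmxr f)) /=; rewrite -!scalemxAl.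
rewrite (principal_wS f v 1) => h1.
(* With z = u f f, the relations read z / 24 = - 45 w_2, after applying f to the first, and - z / 12
   = - 15 w_2. Eliminating z leaves the factor 12 * 15 + 24 * 45 = 1260. *)
have /eqP : (1260 : C) *: w 2 = 0.
  transitivity ((-12 : C) *: ((- 15 * (5 - (2 * 2)%:R)) *: w 2)
              - 24 *: ((- 15 * (5 - (2 * 1)%:R)) *: w 2)).
    by rewrite !scalerA -scalerBl; congr (_ *: _); ring.
  rewrite -h1 -h2 !scalerA -scalerBl -[RHS](scale0r (v *m f ^+ 5 *m x 0 *m f *m f)).
  by congr (_ *: _); field.
by rewrite scaler_eq0 pnatr_eq0 /= (negPf (nz _ _)).
Qed.

(** The four matrices describe h, f, e and x_0 in the basis v, v f, ..., v f^6 of V_6. The value 720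
    in [std_x] is forced by [principal_rel]; see [principal_conj]. *)
Definition std_h : 'M[C]_7 :=
  \matrix_(i, j) (if j == i :> nat then 6 - (2 * i)%:R else 0).
Definition std_f : 'M[C]_7 := \matrix_(i, j) (if j == i.+1 :> nat then 1 else 0).
Definition std_e : 'M[C]_7 :=
  \matrix_(i, j) (if i == j.+1 :> nat then (i * (7 - i))%:R else 0).
Definition std_x : 'M[C]_7 :=
  \matrix_(i, j) (if i == (j + 5)%N :> nat then 720 else 0).

Lemma horner_mx_eigen h a v p : v *m h = a *: v ->
  v *m horner_mx h p = p.[a] *: v.
Proof.
move=> hv; elim/poly_ind: p => [|p c IHp].
  by rewrite rmorph0 mulmx0 horner0 scale0r.
rewrite !hornerE rmorphD rmorphM /= horner_mx_X horner_mx_C -mulmxE mulmxDr.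
by rewrite mulmxA IHp -scalemxAl hv mul_mx_scalar scalerA scalerDl mulrC.
Qed.

(** Applied to a linear relation between the rows, the product of the [h - a i] over i != j kills
    every row but the j-th, so the j-th coefficient is zero. *)
Lemma eigen_rows_unit h (P : 'M[C]_7) (a : 'I_7 -> C) : injective a ->
  (forall i, row i P *m h = a i *: row i P) -> (forall i, row i P != 0) ->
  P \in unitmx.
Proof.
move=> inja hP nz; rewrite -row_free_unit -kermx_eq0.
apply/negPn/negP => /rowV0Pn[c /sub_kermxP cP]; apply/negP; rewrite negbK.
apply/eqP/rowP => j; rewrite mxE.
pose p : {poly C} := \prod_(i | i != j) ('X - (a i)%:P).
have pE i : p.[a i] = \prod_(k | k != j) (a i - a k).
  by rewrite horner_prod; apply: eq_bigr => k _; rewrite !hornerE.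
have := congr1 (mulmxr (horner_mx h p)) cP; rewrite /= mul0mx [c *m P]mulmx_sum_row.
rewrite mulmx_suml (bigD1 j) //= big1 => [|i ij].
  rewrite -scalemxAl (horner_mx_eigen _ (hP j)) scalerA addr0 => /eqP.
  rewrite scaler_eq0 (negPf (nz j)) orbF mulf_eq0 pE prodf_seq_eq0 => /orP[/eqP //|].
  by case/hasP => k _ /andP[kj]; rewrite subr_eq0 (inj_eq inja) eq_sym (negPf kj).
rewrite -scalemxAl (horner_mx_eigen _ (hP i)) pE (bigD1 i) //= subrr mul0r.
by rewrite scale0r scaler0.
Qed.

(** For weight reasons x_0 can only send w_5 to a multiple of w_0 and w_6 to a multiple of w_1; the
    other relations determine these two scalars. *)
Lemma principal_conj h e f x : principal h e f x -> x 0 != 0 ->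
  exists2 P : 'M[C]_7, P \in unitmx
    & [/\ P *m h = std_h *m P, P *m e = std_e *m P, P *m f = std_f *m P
        & P *m x 0 = std_x *m P].
Proof.
move=> pr x0; have S := principal_sl2 pr; have [he hf ef] := S.
have [v [v0 ve vh nz v7]] := principal_top pr x0.
pose w (i : nat) : V := v *m f ^+ i; pose P : 'M[C]_7 := \matrix_(i < 7) w i.
have wh i : w i *m h = (6 - (2 * i)%:R) *: w i by exact: principal_wh pr 6 v vh i.
have rowE (i : 'I_7) : row i P = w i by rewrite rowK.
have rowM (A : 'M[C]_7) (i : 'I_7) : row i (A *m P) = \sum_(j < 7) A i j *: w j.
  rewrite row_mul mulmx_sum_row; apply: eq_bigr => j _.
  by rewrite rowE mxE.
have Pu : P \in unitmx.
  apply: (@eigen_rows_unit h P (fun i => 6 - (2 * i)%:R)).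
  - move=> i j /addrI/oppr_inj/eqP; rewrite eqr_nat eqn_pmul2l // => /eqP.
    exact: val_inj.
  - by move=> i; rewrite rowE wh.
  - by move=> i; rewrite rowE nz // -ltnS.
have Ph : P *m h = std_h *m P.
  apply/row_matrixP => i; rewrite row_mul rowE rowM wh (bigD1 i) //= big1 => [|j ji].
    by rewrite mxE eqxx addr0.
  by rewrite mxE val_eqE (negPf ji) scale0r.
(* Weight spaces are lines, since the weights 6 - 2k are distinct. *)
have wt (k : 'I_7) u : u *m h = (6 - (2 * k)%:R) *: u -> exists c, u = c *: w k.
  move=> uh; have [c cP] : exists c, c *m P = u.
    by exists (u *m invmx P); rewrite mulmxKV.
  exists (c 0 k); rewrite -cP mulmx_sum_row (bigD1 k) //= big1 ?addr0 => [|j jk].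
    by rewrite rowE.
  have /rowP/(_ j) : c *m std_h = (6 - (2 * k)%:R) *: c.
    apply: (can_inj (mulmxK Pu)).
    by rewrite -mulmxA -Ph mulmxA cP uh -scalemxAl cP.
  rewrite !mxE (bigD1 j) //= big1 => [|l lj]; last first.
    by rewrite mxE eq_sym val_eqE (negPf lj) mulr0.
  rewrite mxE eqxx addr0 mulrC => /eqP; rewrite -subr_eq0 -mulrBl mulf_eq0.
  rewrite opprD addrACA subrr add0r opprK addrC subr_eq0 eqr_nat eqn_pmul2l //.
  by rewrite val_eqE eq_sym (negPf jk) => /eqP ->; rewrite scale0r.
have [al al5] : exists al, w 5 *m x 0 = al *: w 0.
  apply: (wt 0); rewrite (principal_wx pr vh) //; congr (_ *: _).
  by rewrite -!natrB.
have [be be6] : exists be, w 6 *m x 0 = be *: w 1.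
  apply: (wt (lift ord0 ord0)); rewrite (principal_wx pr vh) //; congr (_ *: _).
  by rewrite -!natrB.
have wS i : w i *m f = w i.+1 by exact: principal_wS.
have we i : w i.+1 *m e = (i.+1%:R * (6 - i%:R)) *: w i.
  exact: (sl2_lower i S ve vh).
(* x_0 commutes with e; compare the two products on w_6. *)
have al_be : al = be.
  have := congr1 (mulmx (w 6)) (principal_ex pr).
  rewrite !mulmxA be6 -scalemxAl !we -scalemxAl al5 !scalerA => /eqP.
  rewrite -subr_eq0 -scalerBl scaler_eq0 (negPf (nz 0%N _)) // orbF subr_eq0.
  move=> /eqP E; have six : 6 != 0 :> C by rewrite pnatr_eq0.
  by apply: (mulfI six); transitivity (6 * (6 - 5) * al); [ring | rewrite -E; ring].
(* Since al = be, the chain has t = 1, and on w_2 the relation reads - al / 24 = - 15 * 2. *)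
have al720 : al = 720.
  have [|r1 r2] := principal_chain pr (isT : 4 < 6)%N vh (t := 1) _ v7.
    rewrite -/(w 6) -/(w 5) be6 al5 -al_be scale1r -scalemxAl wS //.
  have := principal_rel_w pr (isT : 4 < 6)%N vh (i := 2) isT isT.
  rewrite r2 -/(w 2) -/(w 5) al5 -!scalemxAl !wS scalerA => /eqP.
  rewrite -subr_eq0 -scalerBl scaler_eq0 (negPf (nz 2%N _)) // orbF subr_eq0.
  move=> /eqP E; transitivity (- 24 * ((1 - 2) / 24 * al)); first by field.
  by rewrite E; ring.
have x0w (i : nat) : (i <= 4)%N -> w i *m x 0 = 0.
  by move=> i4; apply: (principal_wx0 pr (isT : 4 < 6)%N vh); rewrite addn0.
have v7' : w 7 = 0 by [].
exists P => //; split=> //; apply/row_matrixP => i; rewrite row_mul rowE rowM.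
- case: i => [[|i] lti] /=.
    by rewrite /w expr0 mulmx1 ve big1 // => j _; rewrite mxE /= scale0r.
  rewrite we (bigD1 (Ordinal (ltnW lti))) //= big1 => [|j ji].
    by rewrite mxE /= eqxx addr0 subSS natrM natrB //; lia.
  rewrite mxE /= eqSS eq_sym; move: ji; rewrite -val_eqE /= => /negPf ->.
  by rewrite scale0r.
- rewrite wS; case: (ltnP i.+1 7) => i7.
    rewrite (bigD1 (Ordinal i7)) //= big1 => [|j ji].
      by rewrite mxE /= eqxx addr0 scale1r.
    by rewrite mxE; move: ji; rewrite -val_eqE /= => /negPf ->; rewrite scale0r.
  have -> : nat_of_ord i = 6%N by apply/eqP; rewrite eqn_leq -ltnS ltn_ord.
  rewrite v7' big1 // => j _; rewrite mxE; case: eqP => [E|]; last by rewrite scale0r.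
  by move: (ltn_ord j); rewrite E; lia.
- case: (leqP i 4) => i4.
    rewrite x0w // big1 // => j _; rewrite mxE ifF ?scale0r //; apply/eqP; lia.
  have i5 : (i - 5 < 7)%N by have := ltn_ord i; lia.
  rewrite (bigD1 (Ordinal i5)) //= big1 => [|j ji].
    rewrite mxE /= subnK // eqxx addr0 -al720.
    have [->|->] : i = 5%N :> nat \/ i = 6%N :> nat by have := ltn_ord i; lia.
      exact: al5.
    by rewrite al_be.
  rewrite mxE ifF ?scale0r //; apply/negbTE; move: ji; rewrite -val_eqE /=; lia.
Qed.

End PrincipalRepresentations.

(** * Schur's lemma and equivariant products for V_6 *)

Section StandardBasis.
Variable C : numClosedFieldType.
Local Notation V := 'rV[C]_7.
Variables (h e f P : 'M[C]_7).
Hypotheses (Pu : P \in unitmx) (Ph : P *m h = std_h C *m P)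
  (Pe : P *m e = std_e C *m P) (Pf : P *m f = std_f C *m P).
Let w (i : nat) : V := row (inord i) P.

Lemma std_rowM (A : 'M[C]_7) (i : 'I_7) :
  row i (A *m P) = \sum_(j < 7) A i j *: w j.
Proof.
rewrite row_mul mulmx_sum_row; apply: eq_bigr => j _.
by rewrite mxE /w inord_val.
Qed.

Lemma std_wh i : (i < 7)%N -> w i *m h = (6 - (2 * i)%:R) *: w i.
Proof.
move=> i7; rewrite /w -row_mul Ph std_rowM (bigD1 (inord i)) //= big1 => [|j ji].
  by rewrite mxE eqxx addr0 inordK.
by rewrite mxE val_eqE (negPf ji) scale0r.
Qed.

Lemma std_w0e : w 0 *m e = 0.
Proof.
rewrite /w -row_mul Pe std_rowM big1 // => j _.
by rewrite mxE inordK // scale0r.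
Qed.

Lemma std_we i : (i < 6)%N -> w i.+1 *m e = (i.+1 * (6 - i))%:R *: w i.
Proof.
move=> i6; rewrite /w -row_mul Pe std_rowM (bigD1 (inord i)) //= big1 => [|j ji].
  by rewrite mxE !inordK ?eqxx ?addr0 // ltnS ltnW.
rewrite mxE inordK // eqSS ifF ?scale0r //; apply/negbTE.
apply: contra ji => /eqP ij; apply/eqP/val_inj; rewrite /= inordK //; lia.
Qed.

Lemma std_wf i : (i < 6)%N -> w i *m f = w i.+1.
Proof.
move=> i6; rewrite /w -row_mul Pf std_rowM (bigD1 (inord i.+1)) //= big1 => [|j ji].
  by rewrite mxE !inordK ?eqxx ?addr0 ?scale1r // ltnW.
rewrite mxE inordK ?ifF ?scale0r //; last lia; apply/negbTE.
apply: contra ji => /eqP ij; apply/eqP/val_inj; rewrite /= inordK //; lia.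
Qed.

Lemma std_expand (u : V) : exists c : V, u = \sum_(j < 7) c 0 j *: w j.
Proof.
exists (u *m invmx P); rewrite -[LHS](mulmxKV Pu) mulmx_sum_row.
by apply: eq_bigr => j _; rewrite /w inord_val.
Qed.

Lemma std_w0 : w 0 != 0.
Proof.
apply/eqP => w00; have : (delta_mx 0 (inord 0) : V) = 0.
  by rewrite -[LHS](mulmxK Pu) -rowE -/(w 0) w00 mul0mx.
by move/rowP/(_ (inord 0)); rewrite !mxE !eqxx => /eqP; rewrite oner_eq0.
Qed.

(** The subdiagonal entries i (7 - i) of [std_e] are nonzero, which kills every coordinate but the
    first. *)
Lemma std_ker_e (u : V) : u *m e = 0 -> exists c, u = c *: w 0.
Proof.
move=> ue; pose c := u *m invmx P; exists (c 0 0).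
have uE : u = c *m P by rewrite mulmxKV.
have ce : c *m std_e C = 0.
  by apply: (can_inj (mulmxK Pu)); rewrite -mulmxA -Pe mulmxA -uE ue mul0mx.
rewrite {1}uE mulmx_sum_row (bigD1 0) //= big1 => [|j j0].
  by rewrite addr0 /w; congr (_ *: row _ _); apply/val_inj; rewrite /= inordK.
case: j j0 => [[|j] lj] //= _.
have lj' : (j < 7)%N by rewrite ltnW.
move: c ce {uE} => c /rowP/(_ (Ordinal lj')); rewrite !mxE.
rewrite (bigD1 (Ordinal lj)) //= big1 => [|k kj].
  rewrite mxE /= eqxx addr0 => /eqP; rewrite mulf_eq0 pnatr_eq0.
  have /negPf -> : (j.+1 * (7 - j.+1) != 0)%N by rewrite muln_eq0; lia.
  by rewrite orbF => /eqP ->; rewrite scale0r.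
rewrite mxE /= ifF ?mulr0 //; apply/negbTE; move: kj; rewrite -val_eqE /=; lia.
Qed.

Lemma std_ext (A B : 'M[C]_7) : (forall i, (i < 7)%N -> w i *m A = w i *m B) ->
  A = B.
Proof.
move=> AB; apply: (can_inj (mulKmx Pu)); apply/row_matrixP => i.
by have := AB i (ltn_ord i); rewrite /w inord_val -!row_mul.
Qed.

(** M preserves the kernel of e, the line of w_0, and f carries the eigenvalue from w_0 to every
    w_i. *)
Lemma std_schur (M : 'M[C]_7) : M *m e = e *m M -> M *m f = f *m M ->
  exists c, M = c%:M.
Proof.
move=> Me Mf; have [c w0M] : exists c, w 0 *m M = c *: w 0.
  by apply: std_ker_e; rewrite -mulmxA Me mulmxA std_w0e mul0mx.
exists c; apply: std_ext => i; rewrite mul_mx_scalar.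
elim: i => [|i IHi] i7 //.
by rewrite -std_wf // -mulmxA -Mf mulmxA IHi ?scalemxAl // ltnW.
Qed.

Section Equivariant.
Variable b : V -> V -> V.
Hypotheses (bl : forall Y, linear (b^~ Y)) (br : forall X, linear (b X)).
Definition equivariant (A : 'M[C]_7) :=
  forall X Y, b (X *m A) Y + b X (Y *m A) = b X Y *m A.
Hypotheses (bh : equivariant h) (be : equivariant e) (bf : equivariant f).

Let b0l Y : b 0 Y = 0.
Proof. exact: linear_fun0 (bl Y). Qed.
Let b0r X : b X 0 = 0.
Proof. exact: linear_fun0 (br X). Qed.
Let bZl a X Y : b (a *: X) Y = a *: b X Y.
Proof. exact: (linear_funZ _ _ (bl Y)). Qed.
Let bZr a X Y : b X (a *: Y) = a *: b X Y.
Proof. exact: (linear_funZ _ _ (br X)). Qed.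

Lemma equivariant_weight i j : (i < 7)%N -> (j < 7)%N ->
  b (w i) (w j) *m h = (12 - (2 * (i + j))%:R) *: b (w i) (w j).
Proof.
move=> i7 j7; rewrite -bh !std_wh // bZl bZr -scalerDl; congr (_ *: _).
by rewrite !natrM natrD; ring.
Qed.

(** A vector killed by e is a multiple of w_0, hence of weight 6, whereas b(w_0, w_j) has weight 12
    - 2j; the two agree only for j = 3. *)
Lemma equivariant_eq0_w0 j : (j < 7)%N -> j != 3%N -> b (w 0) (w j) *m e = 0 ->
    b (w 0) (w j) = 0.
Proof.
move=> j7 j3 /std_ker_e[c cE]; have := equivariant_weight (isT : 0 < 7)%N j7.
rewrite cE -scalemxAl std_wh // !scalerA => /eqP.
rewrite -subr_eq0 -scalerBl scaler_eq0 (negPf std_w0) orbF mulrC -mulrBl.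
rewrite mulf_eq0 => /orP[|/eqP ->]; last by rewrite scale0r.
rewrite muln0 subr0 add0n opprD addrCA => /eqP E.
have : (2 * j)%:R = 6%:R :> C.
  by apply/eqP; rewrite -subr_eq0 -E; apply/eqP; ring.
by move/eqP; rewrite eqr_nat -[6%N]/(2 * 3)%N eqn_pmul2l // (negPf j3).
Qed.

Lemma equivariant_w0w3 : (forall j, (j < 3)%N -> b (w 0) (w j) = 0) /\
  exists c, b (w 0) (w 3) = c *: w 0.
Proof.
have low j : (j < 3)%N -> b (w 0) (w j) = 0.
  elim: j => [|j IHj] j3; apply: equivariant_eq0_w0 => //; try lia.
    by rewrite -be std_w0e b0l b0r addr0.
  rewrite -be std_w0e b0l add0r std_we ?bZr ?IHj ?scaler0 //; lia.
split=> //; apply: std_ker_e.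
by rewrite -be std_w0e b0l add0r std_we // bZr low ?scaler0.
Qed.

(** This is the multiplicity one of V_6 in V_6 (x) V_6. Applying e propagates the vanishing along
    the pairs (w_0, w_j), and applying f passes from w_i to w_(i+1) in the first argument. *)
Lemma equivariant_eq0 : b (w 0) (w 3) = 0 -> forall X Y, b X Y = 0.
Proof.
move=> b03; have [low _] := equivariant_w0w3.
have row0 j : (j < 7)%N -> b (w 0) (w j) = 0.
  elim: j => [_|j IHj j7]; first exact: low.
  case: (ltngtP j.+1 3) => [j3|j3|->] //; first exact: low.
  apply: equivariant_eq0_w0 => //; first by move: j3; lia.
  by rewrite -be std_w0e b0l add0r std_we // bZr IHj ?scaler0 // ltnW.
have wf7 : w 6 *m f = 0.
  rewrite /w -row_mul Pf std_rowM big1 // => j _.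
  rewrite mxE inordK // ifF ?scale0r //; apply/negbTE.
  by have := ltn_ord j; lia.
have all i : (i < 7)%N -> forall j, (j < 7)%N -> b (w i) (w j) = 0.
  elim: i => [|i IHi] i7 j j7; first exact: row0.
  have := bf (w i) (w j); rewrite std_wf // [b (w i) (w j)]IHi ?mul0mx //; last lia.
  have -> : b (w i) (w j *m f) = 0.
    case: (ltnP j 6) => j6; first by rewrite std_wf // IHi // ltnW.
    have -> : j = 6%N by lia.
    by rewrite wf7 b0r.
  by rewrite addr0.
move=> X Y; have [c ->] := std_expand X; have [d ->] := std_expand Y.
have suml (g : 'I_7 -> C) (U : 'I_7 -> V) Z :
    b (\sum_j g j *: U j) Z = \sum_j g j *: b (U j) Z.
  by elim/big_rec2: _ => [|j y x _ <-]; [exact: b0l | rewrite bl].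
have sumr (g : 'I_7 -> C) (U : 'I_7 -> V) Z :
    b Z (\sum_j g j *: U j) = \sum_j g j *: b Z (U j).
  by elim/big_rec2: _ => [|j y x _ <-]; [exact: b0r | rewrite br].
rewrite suml big1 // => i _; rewrite sumr big1 ?scaler0 // => j _.
by rewrite all ?scaler0.
Qed.

End Equivariant.

End StandardBasis.

(** * Uniqueness of the 7-dimensional representation *)

Module PrincipalTables.
Local Open Scope nat_scope.
Local Notation neg n := (- (n%:Z))%R.
Local Notation pos n := (n%:Z)%R (only parsing).

(** With the scale of x_0 imposed by [principal_rel], the entries of the x_k have denominators 3 and
    5; the factor 15 clears them. *)
Definition principal_list : seq (seq (nat * nat * int)) := [::
    [:: (1, 1, pos 6); (2, 2, neg 4); (3, 3, neg 2); (4, 4, neg 6); (5, 5, pos 4);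
        (6, 6, pos 2)];
    [:: (0, 6, pos 3); (2, 3, neg 2); (3, 0, neg 6); (4, 2, pos 3); (5, 1, neg 3);
        (6, 5, pos 2)];
    [:: (0, 3, neg 2); (1, 5, neg 2); (2, 4, pos 2); (3, 2, neg 5); (5, 6, pos 5);
        (6, 0, pos 4)];
    [:: (2, 1, neg 27); (4, 5, pos 27)];
    [:: (3, 1, neg 135); (4, 6, pos 135)];
    [:: (0, 1, neg 135); (2, 6, neg 135); (3, 5, pos 135); (4, 0, pos 270)];
    [:: (0, 5, pos 180); (2, 0, neg 360); (4, 3, neg 180); (6, 1, pos 180)];
    [:: (0, 6, pos 225); (2, 3, pos 270); (3, 0, neg 450); (4, 2, pos 225);
        (5, 1, neg 225); (6, 5, neg 270)];
    [:: (1, 1, neg 90); (2, 2, neg 360); (3, 3, pos 450); (4, 4, pos 90);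
        (5, 5, pos 360); (6, 6, neg 450)];
    [:: (0, 3, pos 150); (1, 5, pos 150); (2, 4, neg 150); (3, 2, neg 675);
        (5, 6, pos 675); (6, 0, neg 300)];
    [:: (0, 2, neg 300); (1, 6, pos 300); (3, 4, neg 300); (5, 0, pos 600)];
    [:: (0, 4, neg 150); (1, 0, pos 300); (5, 3, neg 150); (6, 2, pos 150)];
    [:: (1, 3, neg 100); (6, 4, pos 100)];
    [:: (1, 2, pos 50); (5, 4, neg 50)]].

(** An item (c, s) writes c times a matrix of [basis0] as the combination s of the matrices above,
    which therefore span the derivations. *)
Definition principal_comb_list : seq (nat * seq (nat * int)) := [::
    (135, [:: (5, pos 1)]); (300, [:: (10, pos 1)]);
    (420, [:: (2, pos 135); (9, neg 1)]); (150, [:: (11, pos 1)]);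
    (180, [:: (6, pos 1)]); (630, [:: (1, neg 135); (7, neg 1)]);
    (27, [:: (3, pos 1)]); (135, [:: (4, pos 1)]); (50, [:: (13, neg 1)]);
    (1050, [:: (2, pos 75); (9, pos 1)]); (100, [:: (12, pos 1)]);
    (420, [:: (1, pos 75); (7, neg 1)]);
    (1260, [:: (0, pos 225); (8, pos 1)]);
    (630, [:: (0, pos 90); (8, neg 1)])].

End PrincipalTables.

(* [h], [e], [f], followed by [15 x_0], ..., [15 x_10]. *)
Definition principal_mx (l : nat) : itable :=
  sparse (nth [::] PrincipalTables.principal_list l).

Definition coefs (s : seq (nat * int)) (k : nat) : int :=
  foldr (fun t acc => if t.1 == k then t.2 + acc else acc) 0 s.

Definition ibracket (b b' : itable) : itable := fun r s =>
  isum 7 (fun t => b' r t * b t s) - isum 7 (fun t => b r t * b' t s).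

Definition bracket_table (Y : nat -> itable) (i j : nat) (a : int)
    (c : nat -> int) : bool :=
  alln 7 (fun r => alln 7 (fun s =>
    a * ibracket (Y i) (Y j) r s == isum 14 (fun k => c k * Y k r s))).

Definition lie_hom_mx (F : fieldType) (L : lieAlgType F) (rho : L -> 'M[F]_7) :=
  linear rho /\ forall x y, rho (lbr x y) = rho y *m rho x - rho x *m rho y.

Section LinearMaps.
Variables (F : fieldType) (L : lieAlgType F) (rho : L -> 'M[F]_7).
Hypothesis lrho : linear rho.

Let rho0 : rho 0 = 0 := linear_fun0 lrho.

Lemma linear_mxZ a x : rho (a *: x) = a *: rho x.
Proof. by have := lrho a x 0; rewrite !addr0 rho0 addr0. Qed.

Lemma linear_mx_sum n (c : 'I_n -> F) (y : 'I_n -> L) :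
  rho (\sum_i c i *: y i) = \sum_i c i *: rho (y i).
Proof. by elim/big_rec2: _ => [|i u v _ <-]; [exact: rho0 | rewrite lrho]. Qed.

End LinearMaps.

Lemma sum_coefs (F : fieldType) (U : lmodType F) (y : nat -> U) s :
  all (fun t => t.1 < 14)%N s ->
  \sum_(k < 14) (coefs s k)%:~R *: y k = \sum_(t <- s) t.2%:~R *: y t.1.
Proof.
elim: s => [_|[i c] s IHs /= /andP[i14 /IHs {}IHs]].
  by rewrite big_nil big1 // => k _; rewrite scale0r.
rewrite big_cons -IHs /= (bigD1 (Ordinal i14)) //= [in RHS](bigD1 (Ordinal i14)) //=.
rewrite eqxx intrD scalerDl -addrA; congr (_ + (_ + _)).
by apply: eq_bigr => k ki; rewrite ifN // eq_sym.
Qed.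

Lemma bracket_tableP (F : fieldType) (L : lieAlgType F) D
    (mu : L -> 'M[F]_7) (Y : nat -> itable) (y : nat -> L) i j a c :
  mx_model D mu -> (forall k, (k < 14)%N -> mu (y k) = imx F (Y k)) ->
  (i < 14)%N -> (j < 14)%N -> bracket_table Y i j a c ->
  a%:~R *: lbr (y i) (y j) = \sum_(k < 14) (c k)%:~R *: y k.
Proof.
move=> [lmu imu _ _ bmu] yY i14 j14 chk; apply: imu.
rewrite linear_mxZ // linear_mx_sum // bmu !yY //; apply/matrixP => r s.
have /eqP/(congr1 (fun z : int => z%:~R : F)) :=
  allnP (allnP chk (ltn_ord r)) (ltn_ord s).
rewrite intrM intrB !intr_isum summxE !mxE => E.
transitivity (a%:~R * (ibracket (Y i) (Y j) r s)%:~R : F).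
  rewrite intrB !intr_isum; congr (_ * (_ - _)); apply: eq_bigr => t _;
    by rewrite !mxE intrM.
rewrite /ibracket intrB !intr_isum E; apply: eq_bigr => k _.
by rewrite yY // !mxE intrM.
Qed.

Section PrincipalModel.
Variable C : numClosedFieldType.
Variables (L : lieAlgType C) (mu : L -> 'M[C]_7).
Hypothesis mod_mu : mx_model (der_mx (Omega0 C)) mu.

Lemma principal_der l : (l < 14)%N -> der_mx (Omega0 C) (imx C (principal_mx l)).
Proof.
move=> l14; apply: (der_imx (Omega0_table C)); move: l l14; apply: allnP.
by vm_compute.
Qed.

Lemma principal_elt : exists y : nat -> L,
  forall l, (l < 14)%N -> mu (y l) = imx C (principal_mx l).
Proof.
have [_ _ _ sm _] := mod_mu.
have h l : {x | (l < 14)%N -> mu x = imx C (principal_mx l)}.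
  apply: cid; case: (ltnP l 14) => l14; last by exists 0.
  by have [x xE] := sm _ (principal_der l14); exists x.
by exists (fun l => sval (h l)) => l; exact: svalP (h l).
Qed.

Variable y : nat -> L.
Hypothesis yE : forall l, (l < 14)%N -> mu (y l) = imx C (principal_mx l).

Lemma principal_bracket i j (a : int) (s : seq (nat * int)) rho :
  (i < 14)%N -> (j < 14)%N ->
  bracket_table principal_mx i j a (coefs s) -> all (fun t => t.1 < 14)%N s ->
  lie_hom_mx rho ->
  a%:~R *: (rho (y j) *m rho (y i) - rho (y i) *m rho (y j))
  = \sum_(t <- s) t.2%:~R *: rho (y t.1).
Proof.
move=> i14 j14 chk s14 [lr br]; rewrite -br -linear_mxZ //.
rewrite (bracket_tableP mod_mu yE i14 j14 chk) linear_mx_sum //.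
exact: (sum_coefs (fun k => rho (y k))).
Qed.

(** The brackets are decided on integer matrices, pulled back to [L] by the injective [mu], and
    pushed forward by [rho]. *)
Lemma principal_model rho : lie_hom_mx rho ->
  principal (rho (y 0)) (rho (y 1)) (rho (y 2))
    (fun k => 15^-1 *: rho (y (3 + k)%N)).
Proof.
move=> hr; have n15 : 15 != 0 :> C by rewrite pnatr_eq0.
have rel i j a s (i14 : (i < 14)%N) (j14 : (j < 14)%N)
  (chk : bracket_table principal_mx i j a (coefs s))
  (s14 : all (fun t => t.1 < 14)%N s) := principal_bracket i14 j14 chk s14 hr.
have sl2 : sl2_triple (rho (y 0)) (rho (y 1)) (rho (y 2)).
  split; apply/eqP; rewrite addrC -subr_eq -?scaleNr; apply/eqP.
  - have chk : bracket_table principal_mx 0 1 1 (coefs [:: (1, 2)]).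
      by vm_compute.
    by have := rel 0%N 1%N _ _ isT isT chk isT; rewrite big_seq1 scale1r.
  - have chk : bracket_table principal_mx 0 2 1 (coefs [:: (2, - 2)]).
      by vm_compute.
    by have := rel 0%N 2%N _ _ isT isT chk isT; rewrite big_seq1 scale1r.
  - have chk : bracket_table principal_mx 1 2 1 (coefs [:: (0, 1)]).
      by vm_compute.
    by have := rel 1%N 2%N _ _ isT isT chk isT; rewrite big_seq1 !scale1r.
split=> //.
- move=> k k10; rewrite -scalemxAl -scalemxAr scalerA mulrC -scalerA -scalerDr.
  congr (_ *: _); apply/eqP; rewrite addrC -subr_eq; apply/eqP.
  have k14 : (3 + k < 14)%N by lia.
  have chk : bracket_table principal_mx 0 (3 + k) 1
      (coefs [:: ((3 + k)%N, 10 - (2 * k)%:R)]).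
    by move: k k10 {k14}; apply: (allnP (n := 11)); vm_compute.
  have := rel 0%N (3 + k)%N _ _ isT k14 chk; rewrite /= k14 => /(_ isT).
  by rewrite big_seq1 /= scale1r intrB !rmorph_nat.
- rewrite -scalemxAl -scalemxAr; congr (_ *: _); apply/eqP; rewrite -subr_eq0.
  have chk : bracket_table principal_mx 1 3 1 (coefs [::]) by vm_compute.
  by have := rel 1%N 3%N _ _ isT isT chk isT; rewrite big_nil scale1r => /eqP.
- move=> k k10; rewrite -scalemxAl -scalemxAr -scalerBr scalerA mulrC -scalerA.
  congr (_ *: _); have k14 : (3 + k < 14)%N by lia.
  have k14' : ((3 + k).+1 < 14)%N by lia.
  have chk : bracket_table principal_mx 2 (3 + k) 1
      (coefs [:: ((3 + k).+1, k.+1%:R)]).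
    by move: k k10 {k14 k14'}; apply: (allnP (n := 10)); vm_compute.
  have := rel 2%N (3 + k)%N _ _ isT k14 chk; rewrite /= k14' => /(_ isT).
  by rewrite big_seq1 /= scale1r rmorph_nat.
(* Multiplying [principal_rel] by 225 turns x_0 and x_10 into elements 3 and 13 of the list, and
   leaves - 15 * 225 times h and - 15 times element 8, which is 15 x_5. *)
- have chk : bracket_table principal_mx 3 13 14
      (coefs [:: (0, - (15 * 225)); (8, - 15)]) by vm_compute.
  have := rel 3%N 13%N _ _ isT isT chk isT; rewrite big_cons big_seq1.
  rewrite -[snd (_, - (15 * 225))]/(- (15 * 225)) -[snd (_, - 15)]/(- 15) => E.
  rewrite -!scalemxAl -!scalemxAr -!scalerBr 2!scalerA mulrC -scalerA.
  rewrite [X in _ *: X = _]E scalerDr !scalerA; congr (_ *: _ + _); first by field.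
  by rewrite -scaleNr; congr (_ *: _); field.
Qed.

Lemma principal_comb l : (l < 14)%N ->
  let c := nth (0, [::])%N PrincipalTables.principal_comb_list l in
  [/\ c.1%:R *: imx C (basis0 l)
      = \sum_(t <- c.2) t.2%:~R *: imx C (principal_mx t.1),
    c.1%:R != 0 :> C & all (fun t => t.1 < 14)%N c.2].
Proof.
move=> l14 c; have chk : alln 14 (fun l =>
    let c := nth (0, [::])%N PrincipalTables.principal_comb_list l in
    [&& c.1 != 0%N, all (fun t => t.1 < 14)%N c.2 &
    alln 7 (fun r => alln 7 (fun s => c.1%:Z * basis0 l r s ==
      isum 14 (fun k => coefs c.2 k * principal_mx k r s)))]).
  by vm_compute.
have /and3P[c0 s14 {}chk] := allnP chk l14; rewrite -/c in c0 s14 chk.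
split; rewrite ?pnatr_eq0 //.
rewrite -(sum_coefs (fun k => imx C (principal_mx k))) //.
apply/matrixP => r s; rewrite summxE !mxE.
have /eqP/(congr1 (fun z : int => z%:~R : C)) :=
  allnP (allnP chk (ltn_ord r)) (ltn_ord s).
rewrite intrM intr_isum => ->; apply: eq_bigr => k _.
by rewrite !mxE intrM.
Qed.

(** The elements [y] span [L]: by [principal_comb] their matrices span [basis0], hence all
    derivations. *)
Lemma principal_ind (G : L -> Prop) : G 0 ->
  (forall a x z, G x -> G z -> G (a *: x + z)) ->
  (forall l, (l < 14)%N -> G (y l)) -> forall z, G z.
Proof.
move=> G0 GP Gy z; have [lmu imu dmu _ _] := mod_mu.
have mu0 := linear_fun0 lmu.
pose H M := exists2 x, mu x = M & G x.
suff HD : forall M, der_mx (Omega0 C) M -> H M.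
  by have [x /imu <-] := HD _ (dmu z).
have HP a M N : H M -> H N -> H (a *: M + N).
  by move=> [x <- Gx] [x' <- Gx']; exists (a *: x + x'); [exact: lmu|exact: GP].
have H0 : H 0 by exists 0.
move=> M /der0_span ->; elim/big_rec: _ => [//|l N _ HN]; apply: (HP) => //.
have [] := principal_comb (ltn_ord l); set c := nth _ _ _ => E c0 s14.
have -> : imx C (basis0 l) = c.1%:R^-1 *: (c.1%:R *: imx C (basis0 l)) + 0.
  by rewrite addr0 scalerA mulVf ?scale1r.
apply: (HP) => //; rewrite {}E; elim: c.2 s14 => [|[i a] s IHs] /=.
  by rewrite big_nil.
move=> /andP[i14 /IHs Hs]; rewrite big_cons; apply: (HP) => //.
by exists (y i); [exact: yE | exact: Gy].
Qed.

End PrincipalModel.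

Section Uniqueness.
Variable C : numClosedFieldType.

(** Both representations are conjugate to the same standard matrices for h, e, f and x_0. These
    generate: each further x_k is obtained by bracketing with f. *)
Lemma rep_unique (L : lieAlgType C) (mu rho : L -> 'M[C]_7) :
  mx_model (der_mx (Omega0 C)) mu -> lie_hom_mx rho -> injective rho ->
  exists2 P : 'M[C]_7, P \in unitmx & forall z, rho z *m P = P *m mu z.
Proof.
move=> mod_mu hrho irho; have [lmu imu dmu smu bmu] := mod_mu.
have [lrho brho] := hrho.
have [y yE] := principal_elt mod_mu.
have hmu : lie_hom_mx mu by [].
(* A faithful representation cannot kill x_0, whose matrix under [mu] has a nonzero entry. *)
have nz (r : L -> 'M[C]_7) : linear r -> injective r -> 15^-1 *: r (y (3 + 0)%N) != 0.
  move=> lr ir; rewrite scaler_eq0 invr_eq0 pnatr_eq0 /=.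
  have r0 := linear_fun0 lr.
  rewrite -r0 (inj_eq ir); apply/eqP => y0; have := yE 3%N isT.
  rewrite y0 => /(congr1 (fun M : 'M[C]_7 => M (inord 4) (inord 5))).
  have mu0 := linear_fun0 lmu.
  rewrite mu0 !mxE !inordK // => /esym/eqP.
  have -> : principal_mx 3 4 5 = 27 by vm_compute.
  by rewrite pnatr_eq0.
have [P1 P1u [P1h P1e P1f P1x]] :=
  principal_conj (principal_model mod_mu yE hmu) (nz _ lmu imu).
have [P2 P2u [P2h P2e P2f P2x]] :=
  principal_conj (principal_model mod_mu yE hrho) (nz _ lrho irho).
pose P := invmx P2 *m P1.
have Pu : P \in unitmx by rewrite unitmx_mul unitmx_inv P2u.
exists P => //.
have lift A B S : P1 *m A = S *m P1 -> P2 *m B = S *m P2 -> B *m P = P *m A.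
  move=> h1 h2; have -> : B = invmx P2 *m S *m P2 by rewrite -mulmxA -h2 mulKmx.
  by rewrite /P -!mulmxA h1 mulKVmx.
clearbody P.
apply: (principal_ind mod_mu yE).
- by rewrite (linear_fun0 lrho) (linear_fun0 lmu) mul0mx mulmx0.
- move=> a u v Gu Gv; rewrite lrho lmu mulmxDl mulmxDr -scalemxAl -scalemxAr.
  by rewrite Gu Gv.
have G0 : rho (y 0%N) *m P = P *m mu (y 0%N) by exact: lift P1h P2h.
have G1 : rho (y 1%N) *m P = P *m mu (y 1%N) by exact: lift P1e P2e.
have G2 : rho (y 2) *m P = P *m mu (y 2) by exact: lift P1f P2f.
have n15 : 15^-1 != 0 :> C by rewrite invr_eq0 pnatr_eq0.
have GX k : (k <= 10)%N -> (15^-1 *: rho (y (3 + k)%N)) *m P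
    = P *m (15^-1 *: mu (y (3 + k)%N)).
  elim: k => [_|k IHk k10]; first exact: lift P1x P2x.
  have k0 : k.+1%:R != 0 :> C by rewrite pnatr_eq0.
  apply: (scalerI k0); rewrite scalemxAl scalemxAr.
  rewrite -(principal_fx (principal_model mod_mu yE hmu)) //.
  rewrite -(principal_fx (principal_model mod_mu yE hrho)) //.
  rewrite mulmxBl mulmxBr; congr (_ - _).
    by rewrite -mulmxA G2 !mulmxA IHk // ltnW.
  by rewrite -mulmxA IHk ?mulmxA ?G2 // ltnW.
have {}GX k : (k <= 10)%N -> rho (y (3 + k)%N) *m P = P *m mu (y (3 + k)%N).
  by move=> /GX; rewrite -scalemxAl -scalemxAr; exact: scalerI.
case=> [|[|[|k]]] k14 //; exact: GX.
Qed.

End Uniqueness.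

(** * Uniqueness of the invariant product on C^7 *)

Section CrossUnique.
Variable C : numClosedFieldType.
Local Notation V := 'rV[C]_7.

Lemma der0_std : exists h e f P : 'M[C]_7,
  [/\ der_mx (Omega0 C) h, der_mx (Omega0 C) e & der_mx (Omega0 C) f] /\
  [/\ P \in unitmx, P *m h = std_h C *m P, P *m e = std_e C *m P
    & P *m f = std_f C *m P].
Proof.
have [mu mod_mu] : exists mu, mx_model (L := Der3 (Omega0 C)) (der_mx (Omega0 C)) mu.
  by eexists; exact: Der3_model.
have [y yE] := principal_elt mod_mu; have [lmu imu dmu _ bmu] := mod_mu.
have [||P Pu [Ph Pe Pf _]] := principal_conj (principal_model mod_mu yE (rho := mu) _).
- by [].
- rewrite scaler_eq0 invr_eq0 pnatr_eq0 /= yE //.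
  apply/eqP => /matrixP/(_ (inord 4) (inord 5)); rewrite !mxE !inordK //.
  have -> : principal_mx (3 + 0) 4 5 = 27 by vm_compute.
  by move/eqP; rewrite pnatr_eq0.
by exists (mu (y 0%N)), (mu (y 1%N)), (mu (y 2)), P; split; split.
Qed.

Lemma der0_schur (M : 'M[C]_7) :
  (forall A, der_mx (Omega0 C) A -> M *m A = A *m M) -> exists c, M = c%:M.
Proof.
have [h [e [f [P [[dh de df] [Pu Ph Pe Pf]]]]]] := der0_std.
by move=> comm; apply: (std_schur Pu Pe Pf); apply: comm.
Qed.

Lemma cross_neq0 : exists X Y : V, oct_cross X Y != 0.
Proof.
exists (delta_mx 0 (inord 0)), (delta_mx 0 (inord 1)); apply/eqP => c0.
have := oct_crossP (delta_mx 0 (inord 0)) (delta_mx 0 (inord 1))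
  (delta_mx 0 (inord 4) : V).
rewrite c0 oct_nE mul0mx mul0mx mxE Omega0_table !inordK //.
have -> : iOmega0 0 1 4 = -2 by vm_compute.
by rewrite -[LHS]oppr0 => /oppr_inj/esym/eqP; rewrite pnatr_eq0.
Qed.

(** Subtract from b the multiple of the cross product with the same value at (w_0, w_3);
    [equivariant_eq0] kills the difference. This requires the cross product itself to be nonzero at
    (w_0, w_3), which is [s0]. *)
Lemma der0_cross_unique (b : V -> V -> V) :
  (forall Y, linear (b^~ Y)) -> (forall X, linear (b X)) ->
  (forall A, der_mx (Omega0 C) A ->
     forall X Y, b (X *m A) Y + b X (Y *m A) = b X Y *m A) ->
  exists t, forall X Y, b X Y = t *: oct_cross X Y.
Proof.
move=> bl br beq; have [h [e [f [P [[dh de df] [Pu Ph Pe Pf]]]]]] := der0_std.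
pose w i : V := row (inord i) P.
have ceq A : der_mx (Omega0 C) A -> equivariant (@oct_cross C) A.
  by move=> dA X Y; rewrite der0_cross.
have cl := @oct_cross_lin1 C; have cr := @oct_cross_lin2 C.
have [_ [s sE]] := equivariant_w0w3 Pu Ph Pe cl cr (ceq _ dh) (ceq _ de).
have [_ [t tE]] := equivariant_w0w3 Pu Ph Pe bl br (beq _ dh) (beq _ de).
have s0 : s != 0.
  apply/eqP => s0; rewrite s0 scale0r in sE.
  have [X [Y /eqP]] := cross_neq0; apply.
  exact: (equivariant_eq0 Pu Ph Pe Pf cl cr (ceq _ dh) (ceq _ de) (ceq _ df)).
pose d X Y := (- (t / s)) *: oct_cross X Y + b X Y.
exists (t / s) => X Y; apply/eqP; rewrite -subr_eq0 addrC -scaleNr; apply/eqP.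
apply: (equivariant_eq0 (b := d) Pu Ph Pe Pf) => {X Y}.
- move=> Y a X X'; rewrite /d cl bl !scalerDr !scalerA [- _ * a]mulrC -!scalerA.
  by rewrite addrACA.
- move=> Y a X X'; rewrite /d cr br !scalerDr !scalerA [- _ * a]mulrC -!scalerA.
  by rewrite addrACA.
- by move=> X Y; rewrite /d addrACA -scalerDr ceq // beq // mulmxDl scalemxAl.
- by move=> X Y; rewrite /d addrACA -scalerDr ceq // beq // mulmxDl scalemxAl.
- by move=> X Y; rewrite /d addrACA -scalerDr ceq // beq // mulmxDl scalemxAl.
rewrite /d sE tE scalerA -scalerDl -mulNr -mulrA mulVf // mulr1 addNr.
by rewrite scale0r.
Qed.

End CrossUnique.

Section CrossIdentities.
Variable F : numFieldType.
Local Notation V := 'rV[F]_7.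
Implicit Types X Y Z : V.

Lemma oct_crossE X Y (k : 'I_7) : oct_cross X Y 0 k =
  let x i := X 0 (inord i) in let y i := Y 0 (inord i) in
  let m i j := x i * y j - x j * y i in
  nth 0 [:: 2 * (m 1 4 + m 2 5 + m 3 6);
     m 0 1 - 2 * m 5 6; m 0 2 - 2 * m 6 4; m 0 3 - 2 * m 4 5;
     2 * m 2 3 - m 0 4; 2 * m 3 1 - m 0 5; 2 * m 1 2 - m 0 6] k.
Proof.
rewrite mxE.
case: k => [[|[|[|[|[|[|[|k]]]]]]] lk] //=;
  rewrite /Omega0_fun sum13 /wedge3 /Est /Fst !crd_delta // /crd !inordK //= /idelta /=;
  by field.
Qed.

Lemma cross_cross X Y :
  oct_cross X (oct_cross X Y) = - oct_n X X *: Y + oct_n X Y *: X.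
Proof.
have vE (Z : V) (k : 'I_7) : Z 0 k = Z 0 (inord k) by rewrite inord_val.
apply/rowP => k; rewrite oct_crossE !mxE [Y 0 k]vE [X 0 k]vE.
rewrite /oct_n !sum13 /Est /Fst /crd.
case: k => [[|[|[|[|[|[|[|k]]]]]]] lk] //=;
rewrite !oct_crossE !inordK //=; by ring.
Qed.

End CrossIdentities.

(** * Frames in cross product algebras *)

(** Multiplication table of a frame, stored row by row: the product of vectors i and j is
    [frame_sign g i j] times vector [frame_index i j]. On the diagonal the sign is 0 and the index
    is a dummy. *)
Definition frame_sign (g : int) (i j : nat) : int := nth 0
  [:: 0; 1; -1; 1; -1; 1; -1;
      -1; 0; 1; 1; 1; -1; -1;
      1; -1; 0; -1; 1; 1; -1;
      -1; -1; 1; 0; - g; g; g;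
      1; -1; -1; g; 0; - g; g;
      -1; 1; -1; - g; g; 0; g;
      1; 1; 1; - g; - g; - g; 0] (7 * i + j).

Definition frame_index (i j : nat) : nat := nth 0%N
  [:: 0; 2; 1; 6; 5; 4; 3;
      2; 0; 0; 5; 6; 3; 4;
      1; 0; 0; 4; 3; 6; 5;
      6; 5; 4; 0; 2; 1; 0;
      5; 6; 3; 2; 0; 0; 1;
      4; 3; 6; 1; 0; 0; 2;
      3; 4; 5; 0; 1; 2; 0]%N (7 * i + j).

Definition frame_norm (g : int) (i : nat) : int := if (i < 3)%N then 1 else g.

Lemma frame_table g : g * g = 1 -> forall i j k, (i < 7)%N -> (j < 7)%N ->
  (k < 7)%N -> (frame_index i j < 7)%N /\
  frame_sign g i j * (if frame_index i j == k
     then frame_norm g (frame_index i j) else 0)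
  = iOmega_pm g i j k.
Proof.
move=> g2; pose chk g := alln 7 (fun i => alln 7 (fun j => alln 7 (fun k =>
  (frame_index i j < 7)%N && (frame_sign g i j * (if frame_index i j == k
     then frame_norm g (frame_index i j) else 0) == iOmega_pm g i j k)))).
have /orP[/eqP->|/eqP->] : (g == 1) || (g == -1).
  have /eqP : (g - 1) * (g + 1) = 0.
    by transitivity (g * g - 1); [ring | rewrite g2 subrr].
  by rewrite mulf_eq0 subr_eq0 addr_eq0.
- have c : chk 1 by vm_compute.
  move=> i j k i7 j7 k7.
  by have /andP[-> /eqP ->] := allnP (allnP (allnP c i7) j7) k7.
- have c : chk (-1) by vm_compute.
  move=> i j k i7 j7 k7.
  by have /andP[-> /eqP ->] := allnP (allnP (allnP c i7) j7) k7.
Qed.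

Section CrossProductAlgebra.
Variables (F : numFieldType) (V : lmodType F).
Variables (n : V -> V -> F) (cr : V -> V -> V).
Implicit Types X Y Z : V.
Hypotheses (nC : forall X Y, n X Y = n Y X)
  (nDl : forall X Y Z, n (X + Y) Z = n X Z + n Y Z)
  (nZl : forall a X Z, n (a *: X) Z = a * n X Z)
  (crC : forall X Y, cr X Y = - cr Y X)
  (crDl : forall X Y Z, cr (X + Y) Z = cr X Z + cr Y Z)
  (cr_cyc : forall X Y Z, n (cr X Y) Z = n (cr Y Z) X)
  (crcr : forall X Y, cr X (cr X Y) = - n X X *: Y + n X Y *: X).

Let n0l Z : n 0 Z = 0. Proof. by rewrite -(scale0r 0) nZl mul0r. Qed.
Let nNl X Z : n (- X) Z = - n X Z. Proof. by rewrite -scaleN1r nZl mulN1r. Qed.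
Let nDr X Y Z : n Z (X + Y) = n Z X + n Z Y.
Proof. by rewrite nC nDl !(nC _ Z). Qed.
Let crDr X Y Z : cr Z (X + Y) = cr Z X + cr Z Y.
Proof. by rewrite crC crDl opprD -!crC. Qed.
Let crNl X Z : cr (- X) Z = - cr X Z.
Proof.
have c0 : cr 0 Z = 0 by apply: (addrI (cr 0 Z)); rewrite -crDl !addr0.
by apply/eqP; rewrite -addr_eq0 -crDl addNr c0.
Qed.
Let crNr X Z : cr Z (- X) = - cr Z X.
Proof. by rewrite crC crNl -crC. Qed.
Let crxx X : cr X X = 0.
Proof.
have /eqP := crC X X; rewrite -subr_eq0 opprK -mulr2n -scaler_nat.
by rewrite scaler_eq0 pnatr_eq0 => /eqP.
Qed.
Let cr_n0l X Y : n (cr X Y) X = 0. Proof. by rewrite -cr_cyc crxx n0l. Qed.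
Let cr_n0r X Y : n (cr X Y) Y = 0. Proof. by rewrite cr_cyc crxx n0l. Qed.

(** Polarization of [crcr], obtained by evaluating it at X + Y. *)
Lemma cr_swap X Y Z : n X Y = 0 -> n X Z = 0 -> n Y Z = 0 ->
  cr X (cr Y Z) = - cr Y (cr X Z).
Proof.
move=> xy xz yz; apply/eqP; rewrite -addr_eq0; apply/eqP.
have := crcr (X + Y) Z; rewrite (crDl X Y Z) (crDl X Y) 2!crDr.
rewrite 2!crcr (nDl X Y Z) (nDl X Y) 2!nDr (nC Y X) xy xz yz.
rewrite addr0 add0r addr0 !scale0r !addr0 [cr Y _ + _]addrC addrACA.
by rewrite (opprD (n X X)) (scalerDl Z (- n X X)) -[X in _ = X -> _]addr0 => /addrI.
Qed.

Lemma cr_n X Y Z : n (cr X Y) (cr X Z) = n X X * n Y Z - n X Y * n X Z.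
Proof.
rewrite cr_cyc cr_cyc crC nNl crcr nDl !nZl.
by rewrite (mulNr (n X X)) (opprD (- (n X X * n Z Y))) opprK (nC Z Y) [n X Z * _]mulrC.
Qed.

Variables (e1 e2 e7 : V) (g : int).
Hypotheses (n11 : n e1 e1 = 1) (n22 : n e2 e2 = 1) (n12 : n e1 e2 = 0).
Hypotheses (g2 : g * g = 1) (n77 : n e7 e7 = g%:~R).
Hypotheses (n17 : n e1 e7 = 0) (n27 : n e2 e7 = 0) (n37 : n (cr e1 e2) e7 = 0).

(** A Cayley-Dickson doubling: 1, e_1, e_2 and e_3 = e_1 x e_2 span a quaternion algebra, and e_7,
    of norm g = 1 or -1, is the doubling element, which yields e_4, e_5, e_6. *)
Definition frame (i : nat) : V := nth 0
  [:: e1; e2; cr e1 e2; cr e7 e1; cr e7 e2; cr e7 (cr e1 e2); e7] i.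

Lemma frame_mulP i j : (i < 7)%N -> (j < 7)%N ->
  cr (frame i) (frame j) = (frame_sign g i j)%:~R *: frame (frame_index i j).
Proof.
move: n37; rewrite /frame; set e3 := cr e1 e2 => n37'.
have c12 : cr e1 e2 = e3 by [].
have c21 : cr e2 e1 = - e3 by rewrite crC.
have n13 : n e1 e3 = 0 by rewrite nC cr_n0l.
have n23 : n e2 e3 = 0 by rewrite nC cr_n0r.
have c13 : cr e1 e3 = - e2.
  by rewrite crcr n11 n12 scale0r addr0 scaleN1r.
have c31 : cr e3 e1 = e2 by rewrite crC c13 opprK.
have c23 : cr e2 e3 = e1.
  have := crcr e2 e1; rewrite c21 crNr n22 nC n12 scale0r addr0.
  by rewrite scaleN1r => /oppr_inj.
have c32 : cr e3 e2 = - e1 by rewrite crC c23.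
have n33 : n e3 e3 = 1 by rewrite cr_n n11 n22 n12 mul0r subr0 mul1r.
clearbody e3.
have p7 x : n x e7 = 0 -> cr e7 (cr e7 x) = (- g)%:~R *: x.
  by move=> x7; rewrite crcr n77 nC x7 scale0r addr0 intrN.
have q7 x : n x e7 = 0 -> n x x = 1 -> cr x (cr e7 x) = e7.
  move=> x7 xx; rewrite [cr e7 x]crC crNr crcr xx x7.
  by rewrite scale0r addr0 scaleN1r opprK.
have s7 x y : n x y = 0 -> n x e7 = 0 -> n y e7 = 0 ->
    cr x (cr e7 y) = - cr e7 (cr x y).
  by move=> xy x7 y7; rewrite cr_swap // nC.
set e4 := cr e7 e1; set e5 := cr e7 e2; set e6 := cr e7 e3.
have n47 : n e4 e7 = 0 by rewrite cr_n0l.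
have n57 : n e5 e7 = 0 by rewrite cr_n0l.
have n67 : n e6 e7 = 0 by rewrite cr_n0l.
have n51 : n e5 e1 = 0 by rewrite cr_cyc c21 nNl n37' oppr0.
have n61 : n e6 e1 = 0 by rewrite cr_cyc c31.
have n62 : n e6 e2 = 0 by rewrite cr_cyc c32 nNl n17 oppr0.
have c71 : cr e7 e1 = e4 by [].
have c72 : cr e7 e2 = e5 by [].
have c73 : cr e7 e3 = e6 by [].
have c74 : cr e7 e4 = (- g)%:~R *: e1 by exact: p7.
have c75 : cr e7 e5 = (- g)%:~R *: e2 by exact: p7.
have c76 : cr e7 e6 = (- g)%:~R *: e3 by exact: p7.
have c14 : cr e1 e4 = e7 by exact: q7.
have c25 : cr e2 e5 = e7 by exact: q7.
have c36 : cr e3 e6 = e7 by exact: q7.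
have c15 : cr e1 e5 = - e6 by rewrite s7 // c12.
have c16 : cr e1 e6 = e5 by rewrite s7 // c13 crNr opprK.
have c24 : cr e2 e4 = e6 by rewrite s7 ?c21 ?crNr ?opprK // nC.
have c26 : cr e2 e6 = - e4 by rewrite s7 // c23.
have c34 : cr e3 e4 = - e5 by rewrite s7 ?c31 // nC.
have c35 : cr e3 e5 = e4 by rewrite s7 ?c32 ?crNr ?opprK // nC.
have c51 : cr e5 e1 = e6 by rewrite crC c15 opprK.
have c61 : cr e6 e1 = - e5 by rewrite crC c16.
have c62 : cr e6 e2 = e4 by rewrite crC c26 opprK.
have c54 : cr e5 e4 = g%:~R *: e3.
  by rewrite s7 // c51 c76 intrN scaleNr opprK.
have c64 : cr e6 e4 = (- g)%:~R *: e2.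
  by rewrite s7 // c61 crNr opprK c75.
have c65 : cr e6 e5 = g%:~R *: e1.
  by rewrite s7 // c62 c74 intrN scaleNr opprK.
clearbody e4 e5 e6.
have flip x y c z : cr x y = c *: z -> cr y x = (- c) *: z.
  by move=> E; rewrite crC E scaleNr.
have one x y z : cr x y = z -> cr x y = 1%:~R *: z by move=> ->; rewrite scale1r.
have mone x y z : cr x y = - z -> cr x y = (-1)%:~R *: z.
  by move=> ->; rewrite scaleN1r.
have zz x z : cr x x = 0%:~R *: z by rewrite crxx scale0r.
have neg x y z : cr x y = z -> cr y x = (-1)%:~R *: z.
  by move=> E; rewrite crC E scaleN1r.
have nneg x y z : cr x y = - z -> cr y x = 1%:~R *: z.
  by move=> E; rewrite crC E opprK scale1r.
have gf x y z : cr x y = (- g)%:~R *: z -> cr y x = g%:~R *: z.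
  by move=> E; rewrite crC E intrN scaleNr opprK.
have gn x y z : cr x y = g%:~R *: z -> cr y x = (- g)%:~R *: z.
  by move=> E; rewrite crC E intrN scaleNr.
case: i => [|[|[|[|[|[|[|i]]]]]]] //; case: j => [|[|[|[|[|[|[|j]]]]]]] // _ _;
  rewrite /frame_sign /frame_index /=; first [exact: zz | exact: one | exact: mone
  | exact: neg | exact: nneg | exact: gf | exact: gn | assumption].
Qed.

Lemma frame_n i j : (i < 7)%N -> (j < 7)%N ->
  n (frame i) (frame j) = (if i == j then frame_norm g i else 0)%:~R.
Proof.
move: n37; rewrite /frame; set e3 := cr e1 e2 => n37'.
have n13 : n e1 e3 = 0 by rewrite nC cr_n0l.
have n23 : n e2 e3 = 0 by rewrite nC cr_n0r.
have n33 : n e3 e3 = 1 by rewrite cr_n n11 n22 n12 mul0r subr0 mul1r.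
have c13 : cr e1 e3 = - e2.
  by rewrite crcr n11 n12 scale0r addr0 scaleN1r.
have c23 : cr e2 e3 = e1.
  have := crcr e2 e1; rewrite -[cr e2 e1]opprK -crC crNr n22 nC n12 scale0r addr0.
  by rewrite scaleN1r => /oppr_inj.
have c12 : cr e1 e2 = e3 by [].
clearbody e3.
have n77' : n e7 e7 = g%:~R by [].
have na x : n (cr e7 x) e7 = 0 by rewrite cr_n0l.
have nb x y : n x e7 = 0 -> n (cr e7 x) (cr e7 y) = g%:~R * n x y.
  by move=> x7; rewrite cr_n n77 nC [n e7 x]nC x7 mul0r subr0 nC.
have nc x y : n (cr x y) e7 = 0 -> n (cr e7 x) y = 0.
  by move=> E; rewrite cr_cyc.
have nd x y : n (cr x y) e7 = 0 -> n (cr e7 y) x = 0.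
  by move=> E; rewrite cr_cyc crC nNl E oppr0.
have b11 : n (cr e1 e1) e7 = 0 by rewrite crxx n0l.
have b22 : n (cr e2 e2) e7 = 0 by rewrite crxx n0l.
have b33 : n (cr e3 e3) e7 = 0 by rewrite crxx n0l.
have b12 : n (cr e1 e2) e7 = 0 by rewrite c12.
have b13 : n (cr e1 e3) e7 = 0 by rewrite c13 nNl n27 oppr0.
have b23 : n (cr e2 e3) e7 = 0 by rewrite c23.
have sym x y (c : F) : n x y = c -> n y x = c by rewrite nC.
have d11 : n (cr e7 e1) (cr e7 e1) = g%:~R by rewrite nb // n11 mulr1.
have d22 : n (cr e7 e2) (cr e7 e2) = g%:~R by rewrite nb // n22 mulr1.
have d33 : n (cr e7 e3) (cr e7 e3) = g%:~R by rewrite nb // n33 mulr1.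
have d12 : n (cr e7 e1) (cr e7 e2) = 0 by rewrite nb // n12 mulr0.
have d13 : n (cr e7 e1) (cr e7 e3) = 0 by rewrite nb // n13 mulr0.
have d23 : n (cr e7 e2) (cr e7 e3) = 0 by rewrite nb // n23 mulr0.
case: i => [|[|[|[|[|[|[|i]]]]]]] //; case: j => [|[|[|[|[|[|[|j]]]]]]] // _ _;
  rewrite /frame_norm /= ?mulr0z ?mulr1z;
  first [assumption | apply: sym; assumption | exact: na | apply: sym; exact: na
   | apply: nc; assumption | apply: nd; assumption
   | apply: sym; apply: nc; assumption | apply: sym; apply: nd; assumption].
Qed.

Lemma frame_form i j k : (i < 7)%N -> (j < 7)%N -> (k < 7)%N ->
  n (cr (frame i) (frame j)) (frame k) = (iOmega_pm g i j k)%:~R.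
Proof.
move=> i7 j7 k7; have [ij7 <-] := frame_table g2 i7 j7 k7.
by rewrite frame_mulP // nZl frame_n // intrM.
Qed.

End CrossProductAlgebra.

(** * Real and complex models *)

Section PullBack.
Variable F : fieldType.
Local Notation V := 'rV[F]_7.

Fact form3_pull_subproof (w : form3 V) (S : 'M[F]_7) :
  is_form3 (fun X Y Z : V => w (X *m S) (Y *m S) (Z *m S)).
Proof.
case: (form3P w) => p1 p2 p3 p4 p5 p6.
split=> [Y Z a X X'|X Z a Y Y'|X Y a Z Z'|X Z|X Y|X Y] //;
  by rewrite mulmxDl -scalemxAl ?p1 ?p2 ?p3.
Qed.
Definition form3_pull (w : form3 V) (S : 'M[F]_7) : form3 V :=
  Form3 (form3_pull_subproof w S).

Lemma der_mx_pull (w : form3 V) S M : S \in unitmx ->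
  der_mx (form3_pull w S) M <-> der_mx w (invmx S *m M *m S).
Proof.
move=> Su; split=> dM X Y Z.
  have := dM (X *m invmx S) (Y *m invmx S) (Z *m invmx S).
  by rewrite /= !mulmxA !mulmxKV.
have := dM (X *m S) (Y *m S) (Z *m S).
by rewrite /= !mulmxA !mulmxK.
Qed.

Lemma eq_der_mx (w w' : form3 V) : (forall X Y Z, w X Y Z = w' X Y Z) ->
  forall M : 'M[F]_7, der_mx w M <-> der_mx w' M.
Proof. by move=> E M; split=> dM X Y Z; [rewrite -!E|rewrite !E]. Qed.

Lemma der_eqD t (M N : 'M[F]_7) c i j k :
  der_eq t (M + c *: N) i j k = der_eq t M i j k + c * der_eq t N i j k.
Proof.
have E (u : 'I_7 -> F) l : \sum_(a < 7) (M + c *: N) l a * u a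
    = \sum_(a < 7) M l a * u a + c * \sum_(a < 7) N l a * u a.
  rewrite mulr_sumr -big_split; apply: eq_bigr => a _ /=.
  by rewrite !mxE mulrDl mulrA.
by rewrite /der_eq !E; ring.
Qed.

Lemma table_eq (w w' : form3 V) t : has_table w t -> has_table w' t ->
  forall X Y Z, w X Y Z = w' X Y Z.
Proof. by move=> tw tw'; apply: eq_form3 => i j k; rewrite tw tw'. Qed.

Lemma table_pull (w : form3 V) S t : has_table (form3_pull w S) t <->
  forall i j k, w (row i S) (row j S) (row k S) = (t i j k)%:~R.
Proof. by split=> h i j k; have := h i j k; rewrite /= -?rowE // !rowE. Qed.

Lemma imx_pull_table (w : form3 V) t t' (T : itable) : has_table w t ->
  alln 7 (fun i => alln 7 (fun j => alln 7 (fun k =>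
    isum 7 (fun a => mul_lazy (T i a) (fun=>
      isum 7 (fun b => mul_lazy (T j b) (fun=>
        isum 7 (fun c => mul_lazy (T k c) (fun=> t a b c)))))) == t' i j k))) ->
  has_table (form3_pull w (imx F T)) t'.
Proof.
move=> tw chk i j k; rewrite /= !delta_mul form3_suml.
have /eqP <- := allnP (allnP (allnP chk (ltn_ord i)) (ltn_ord j)) (ltn_ord k).
rewrite intr_isum; apply: eq_bigr => a _; rewrite mxE mul_lazyE intrM.
congr (_ * _); rewrite form3_summ intr_isum; apply: eq_bigr => b _.
rewrite mxE mul_lazyE intrM; congr (_ * _); rewrite form3_sumr intr_isum; apply: eq_bigr => c _.
by rewrite mxE mul_lazyE intrM tw.
Qed.

End PullBack.

Section Morphisms.
Variables (F F' : fieldType) (phi : {rmorphism F -> F'}).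
Local Notation "M ^f" := (map_mx phi M).

Lemma form3_map (w : form3 'rV[F]_7) (w' : form3 'rV[F']_7) t :
  has_table w t -> has_table w' t ->
  forall X Y Z, w' X^f Y^f Z^f = phi (w X Y Z).
Proof.
move=> tw tw' X Y Z; rewrite !form3_expand rmorph_sum.
apply: eq_bigr => i _; rewrite rmorph_sum; apply: eq_bigr => j _.
rewrite rmorph_sum; apply: eq_bigr => k _.
by rewrite !mxE tw tw' !rmorphM rmorph_int.
Qed.

Lemma map_imx b : (imx F b)^f = imx F' b.
Proof. by apply/matrixP => i j; rewrite !mxE rmorph_int. Qed.

Lemma der_eq_map t (M : 'M[F]_7) i j k : der_eq t M^f i j k = phi (der_eq t M i j k).
Proof.
by rewrite !rmorphD !rmorph_sum; do 2?congr (_ + _);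
   apply: eq_bigr => a _; rewrite mxE rmorphM rmorph_int.
Qed.

Lemma der_mx_map (w : form3 'rV[F]_7) (w' : form3 'rV[F']_7) t :
  has_table w t -> has_table w' t ->
  forall M : 'M[F]_7, der_mx w M <-> der_mx w' M^f.
Proof.
move=> tw tw' M.
have inj := fmorph_inj phi.
split=> [/(der_mxP _ tw) h|/(der_mxP _ tw') h].
  by apply/(der_mxP _ tw') => i j k; rewrite der_eq_map h rmorph0.
by apply/(der_mxP _ tw) => i j k; apply: inj; rewrite -der_eq_map h rmorph0.
Qed.

End Morphisms.

Lemma cplx_mulmxB (K : comNzRingType) n (i : K) (A A' B B' : 'M[K]_n) :
  i ^+ 2 = -1 ->
  (A + i *: A') *m (B + i *: B') - (B + i *: B') *m (A + i *: A')
  = A *m B - B *m A - (A' *m B' - B' *m A')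
    + i *: (A' *m B - B *m A' + (A *m B' - B' *m A)).
Proof.
move=> i2; rewrite !(mulmxDl, mulmxDr) -!scalemxAl -!scalemxAr !scalerA -expr2 i2.
rewrite !scaleN1r !(scalerDr, scalerN).
move: (A *m B) (B *m A) (A' *m B') (B' *m A') (i *: (A *m B')) (i *: (B' *m A))
  (i *: (A' *m B)) (i *: (B *m A')) => x1 x2 x3 x4 x5 x6 x7 x8.
by rewrite !opprD !opprK !addrA [LHS](ACl (1*5*4*8*3*6*2*7))/=.
Qed.

Section RealModels.
Variable R : realType.
Local Notation C := R[i].
Local Notation toC := (map_mx (real_complex R)).
Local Notation cj := (map_mx (@conjc R)).
Local Notation reM := (map_mx (@complex.Re R)).
Local Notation imM := (map_mx (@complex.Im R)).

Lemma mx_complexE m n (M : 'M[C]_(m, n)) : M = toC (reM M) + 'i%C *: toC (imM M).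
Proof. by apply/matrixP => i j; rewrite !mxE; case: (M i j) => a b; simpc. Qed.

Lemma reM_toC m n (M N : 'M[R]_(m, n)) : reM (toC M + 'i%C *: toC N) = M.
Proof. by apply/matrixP => i j; rewrite !mxE; simpc. Qed.

Lemma imM_toC m n (M N : 'M[R]_(m, n)) : imM (toC M + 'i%C *: toC N) = N.
Proof. by apply/matrixP => i j; rewrite !mxE; simpc. Qed.

Lemma cj_real m n (M : 'M[C]_(m, n)) : cj M = M -> M = toC (reM M).
Proof.
move=> h; apply/matrixP => i j; rewrite !mxE.
have /matrixP/(_ i j) := h; rewrite mxE; case: (M i j) => a b /= [/eqP].
by rewrite eq_sym -addr_eq0 -mulr2n mulrn_eq0 /= => /eqP ->.
Qed.

Variables (wR : form3 'rV[R]_7) (wC : form3 'rV[C]_7) (t : iform).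
Hypotheses (tR : has_table wR t) (tC : has_table wC t).

(** The derivation equations have integer coefficients, so a complex matrix satisfies them exactly
    when its real and imaginary parts do. *)
Lemma cplx_model (L : lieAlgType R) nu : mx_model (L := L) (der_mx wR) nu ->
  mx_model (L := complexification L) (der_mx wC)
    (fun z : complexification L => toC (nu z.1) + 'i%C *: toC (nu z.2)).
Proof.
move=> [lnu inu dnu snu bnu].
have nuZ a x : nu (a *: x) = a *: nu x := linear_funZ a x lnu.
have nuD x y : nu (x + y) = nu x + nu y by have := lnu 1 x y; rewrite !scale1r.
have nuN x : nu (- x) = - nu x by rewrite -scaleN1r nuZ scaleN1r.
have der_part (M : 'M[C]_7) : der_mx wC M <-> der_mx wR (reM M) /\ der_mx wR (imM M).
  have E i j k : der_eq t M i j k =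
      Complex (der_eq t (reM M) i j k) (der_eq t (imM M) i j k).
    by rewrite {1}[M]mx_complexE der_eqD !der_eq_map; simpc.
  split=> [/(der_mxP _ tC) dM|[/(der_mxP _ tR) dr /(der_mxP _ tR) di]].
    by split; apply/(der_mxP _ tR) => i j k; have := dM i j k; rewrite E => -[].
  by apply/(der_mxP _ tC) => i j k; rewrite E dr di.
split.
- move=> [a b] [x x'] [y y']; apply/matrixP => i j /=.
  rewrite !nuD nuN !nuZ !mxE; simpc.
  by congr (_ +i* _)%C; rewrite addrAC.
- move=> [x y] [x' y'] E; congr (_, _); apply: inu.
    by have := congr1 reM E; rewrite !reM_toC.
  by have := congr1 imM E; rewrite !imM_toC.
- by move=> [x y] /=; apply/der_part; rewrite reM_toC imM_toC; split; exact: dnu.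
- move=> M /der_part[/snu[x xE] /snu[y yE]].
  by exists (x, y); rewrite /= xE yE -mx_complexE.
- move=> [x y] [x' y'] /=.
  have toCB (M N : 'M[R]_7) :
      toC (M *m N - N *m M) = toC M *m toC N - toC N *m toC M.
    by rewrite map_mxB !map_mxM.
  rewrite nuD nuN nuD !bnu [toC (_ - _ + - _)]map_mxB [toC (_ - _ + _)]map_mxD !toCB.
  move: (toC (nu x)) (toC (nu y)) (toC (nu x')) (toC (nu y')) => A A' B B'.
  exact: esym (cplx_mulmxB B B' A A' (sqr_i _)).
Qed.

(* The matrices of [L], seen inside those of its complexification and moved by
   [S], are real, so that they preserve the real form [wR]. *)
Lemma descend_model (L : lieAlgType R) (mu : complexification L -> 'M[C]_7)
    (w0 : form3 'rV[C]_7) (S : 'M[C]_7) :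
  mx_model (der_mx w0) mu -> S \in unitmx ->
  (forall X Y Z, form3_pull w0 S X Y Z = wC X Y Z) ->
  (forall x, cj (S *m mu (x, 0) *m invmx S) = S *m mu (x, 0) *m invmx S) ->
  exists nu, mx_model (L := L) (der_mx wR) nu.
Proof.
move=> mod_mu Su pull real; have := conj_mx_model Su mod_mu.
move=> /(@eq_mx_model _ (complexification L) _ (der_mx wC)) mod_nu.
pose nuC x : 'M[C]_7 := S *m mu x *m invmx S.
have {mod_nu}[lnu inu dnu snu bnu] : mx_model (der_mx wC) nuC := mod_nu (fun M =>
  iff_trans (iff_sym (der_mx_pull w0 M Su)) (eq_der_mx pull M)).
have real' x : cj (nuC (x, 0)) = nuC (x, 0) := real x.
move: nuC real' lnu inu dnu snu bnu => {}nuC {}real lnu inu dnu snu bnu.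
have nuR x : toC (reM (nuC (x, 0))) = nuC (x, 0) by rewrite -cj_real // real.
pose nu (x : L) := reM (nuC (x, 0)).
have injC (M N : 'M[R]_7) : toC M = toC N -> M = N.
  by apply: map_mx_inj; exact: complexI.
have split_pair (x y : L) : nuC (x, y) = toC (nu x) + 'i%C *: toC (nu y).
  rewrite !nuR addrC -lnu; congr (nuC _); congr (_, _) => /=.
    by rewrite !scale0r scale1r subr0 add0r.
  by rewrite scale0r scale1r add0r addr0.
exists nu; split.
- move=> a x y; apply: injC; rewrite map_mxD map_mxZ !nuR -lnu; congr (nuC _).
  by congr (_, _); rewrite /= scale0r ?scaler0 ?subr0 ?addr0.
- move=> x y E; have /inu[] // : nuC (x, 0) = nuC (y, 0).
  by rewrite -nuR -[RHS]nuR; congr (toC _).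
- move=> x; apply/(der_mx_map (real_complex R) tR tC); rewrite nuR; exact: dnu.
- move=> M /(der_mx_map (real_complex R) tR tC)/snu[[x y] xyM].
  have E : toC (nu x) + 'i%C *: toC (nu y) = toC M by rewrite -split_pair.
  exists x; have := congr1 reM E; rewrite reM_toC => ->.
  by apply/matrixP => i j; rewrite !mxE.
- move=> x y; apply: injC; rewrite map_mxB !map_mxM !nuR -bnu; congr (nuC _).
  by congr (_, _); rewrite /= ?lbr0l ?linear0 ?subr0 ?addr0.
Qed.

End RealModels.

(** * Classification of the real forms *)

Section OctonionBilinear.
Variable F : numFieldType.
Implicit Types X Y Z : 'rV[F]_7.

Lemma oct_nDl X Y Z : oct_n (X + Y) Z = oct_n X Z + oct_n Y Z.
Proof. by have := oct_n_lin1 Z 1 X Y; rewrite scale1r mul1r. Qed.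

Lemma oct_nZl a X Z : oct_n (a *: X) Z = a * oct_n X Z.
Proof. exact: (linear_funZ (W := F^o) a X (oct_n_lin1 Z)). Qed.

Lemma oct_n0l Z : oct_n 0 Z = 0.
Proof. by rewrite -(scale0r 0) oct_nZl mul0r. Qed.

Lemma oct_nDr X Y Z : oct_n Z (X + Y) = oct_n Z X + oct_n Z Y.
Proof. by rewrite oct_nC oct_nDl !(oct_nC _ Z). Qed.

Lemma oct_nZr a X Z : oct_n Z (a *: X) = a * oct_n Z X.
Proof. by rewrite oct_nC oct_nZl oct_nC. Qed.

Lemma crossDl X Y Z : oct_cross (X + Y) Z = oct_cross X Z + oct_cross Y Z.
Proof. by have := oct_cross_lin1 Z 1 X Y; rewrite !scale1r. Qed.

Lemma crossZl a X Z : oct_cross (a *: X) Z = a *: oct_cross X Z.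
Proof. exact: linear_funZ (oct_cross_lin1 Z). Qed.

Lemma crossZr a X Z : oct_cross Z (a *: X) = a *: oct_cross Z X.
Proof. exact: linear_funZ (oct_cross_lin2 Z). Qed.

Lemma cross_cyc X Y Z : oct_n (oct_cross X Y) Z = oct_n (oct_cross Y Z) X.
Proof.
have ac (A B D : 'rV[F]_7) : oct_n (oct_cross A B) D = - oct_n (oct_cross A D) B.
  case: (form3P (Omega0 F)) => _ p2 p3 _ _ alt; rewrite !oct_crossP.
  have := alt A (B + D); have := p2 A (B + D) 1 B D; rewrite scale1r mul1r => ->.
  have := p3 A B 1 B D; have := p3 A D 1 B D; rewrite !scale1r !mul1r => -> ->.
  by rewrite !alt addr0 add0r => /eqP; rewrite addr_eq0 => /eqP.
by rewrite cross_anti -scaleN1r oct_nZl mulN1r ac opprK.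
Qed.

Lemma cross_nM X Y :
  oct_n (oct_cross X Y) (oct_cross X Y) = oct_n X X * oct_n Y Y - oct_n X Y ^+ 2.
Proof.
rewrite cross_cyc cross_cyc cross_anti cross_cross.
rewrite -scaleN1r oct_nZl oct_nDl !oct_nZl; ring.
Qed.

End OctonionBilinear.

(** * The antilinear involution of C^7 attached to a real form *)

Section RealStructure.
Variable R : realType.
Local Notation C := R[i].
Local Notation V := 'rV[C]_7.
Local Notation cj := (map_mx (@conjc R)).
Local Notation n := (@oct_n C).
Local Notation cr := (@oct_cross C).

Lemma cjK m k : involutive (map_mx (@conjc R) : 'M[C]_(m, k) -> 'M[C]_(m, k)).
Proof. by move=> M; apply/matrixP => i j; rewrite !mxE conjcK. Qed.

Lemma cj_n (X Y : V) : n (cj X) (cj Y) = conjc (n X Y).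
Proof.
by rewrite !oct_nE -(map_imx conjc ioct_n) map_trmx -!map_mxM [LHS]mxE map_imx.
Qed.

Lemma cj_cross (X Y : V) : cr (cj X) (cj Y) = cj (cr X Y).
Proof.
apply: oct_n_inj => Z; rewrite -[Z]cjK cj_n !oct_crossP.
exact: (form3_map conjc (Omega0_table C) (Omega0_table C)).
Qed.

(** The identity [cross_cross] recovers n from the product. Comparing it before and after P gives p
    Y = q X for scalars p and q, where p = n(X, X) - n(XP, XP) does not depend on Y. *)
Lemma cross_autn (P : 'M[C]_7) : P \in unitmx ->
  (forall X Y, cr (X *m P) (Y *m P) = cr X Y *m P) ->
  forall X Y, n (X *m P) (Y *m P) = n X Y.
Proof.
move=> Pu aut.
have E X Y : (n X X - n (X *m P) (X *m P)) *: Y = (n X Y - n (X *m P) (Y *m P)) *: X.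
  have := cross_cross (X *m P) (Y *m P); rewrite !aut cross_cross !scalemxAl -mulmxDl.
  move=> /(can_inj (mulmxK Pu)) h.
  have alg (a a' b b' : V) : - a' + b' = - a + b -> a - a' = b - b'.
    by move=> e; have -> : b = a - a' + b'; rewrite ?addrK // -addrA e addNKr.
  move: (n X X) (n X Y) (n (X *m P) (X *m P)) (n (X *m P) (Y *m P)) h => a b a' b'.
  by rewrite !scaleNr => h; rewrite !scalerBl; exact: alg.
have diag X : n (X *m P) (X *m P) = n X X.
  case: (eqVneq X 0) => [->|X0]; first by rewrite mul0mx.
  have [j Xj] : exists j, X 0 j != 0.
    apply/existsP; rewrite -negb_forall; apply: contra X0 => /forallP h.
    by apply/eqP/rowP => j; rewrite mxE; apply/eqP.
  (* For any i != j, the basis vector i is not a multiple of X, whose j-th coordinate is nonzero;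
     taken as Y it forces q = 0, then p = 0. *)
  pose i := lift j (0 : 'I_6).
  have ij : i != j by rewrite eq_sym neq_lift.
  apply/eqP; rewrite eq_sym -subr_eq0; apply/eqP.
  move: (_ - _) (_ - _) (E X (delta_mx 0 i)) => p q e.
  have := congr1 (fun Z : V => Z 0 j) e; rewrite !mxE /= eq_sym (negPf ij) mulr0.
  move=> /esym/eqP; rewrite mulf_eq0 (negPf Xj) orbF => /eqP q0.
  have := congr1 (fun Z : V => Z 0 i) e.
  by rewrite q0 !mxE !eqxx mulr1 mul0r.
move=> X Y; have := diag (X + Y); rewrite mulmxDl !oct_nDl !oct_nDr.
rewrite !diag (oct_nC Y X) (oct_nC (Y *m P)).
move: (n X X) (n Y Y) (n X Y) (n (X *m P) _) => a b p q e.
have two : 2 != 0 :> C by rewrite pnatr_eq0.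
apply: (mulfI two); transitivity (a + q + (q + b) - a - b); first by ring.
by rewrite e; ring.
Qed.

Variables (L : lieAlgType R) (mu : complexification L -> 'M[C]_7).
Hypothesis mod_mu : mx_model (der_mx (Omega0 C)) mu.

Definition cj_elt (z : complexification L) : complexification L := (z.1, - z.2).

(** Conjugation in the complexification and conjugation of matrix entries are both antilinear, so
    their combination is complex linear and [rep_unique] applies to it. *)
Lemma cj_rep : lie_hom_mx (fun z => cj (mu (cj_elt z))).
Proof.
have [lmu imu dmu smu bmu] := mod_mu; split.
- move=> a z z'.
  have -> : cj_elt (a *: z + z') = conjc a *: cj_elt z + cj_elt z'.
    case: a z z' => [a b] [x x'] [y y']; congr (_, _).
      by rewrite /= scalerN scaleNr opprK.
    by rewrite /= !opprD scalerN scaleNr.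
  by rewrite lmu map_mxD map_mxZ /= (conjcK a).
- move=> z z'; have -> : cj_elt (lbr z z') = lbr (cj_elt z) (cj_elt z').
    case: z z' => [x x'] [y y']; congr (_, _).
      by rewrite /= lbrNl lbrNr opprK.
    by rewrite /= lbrNl lbrNr opprD.
  by rewrite bmu map_mxB !map_mxM.
Qed.

(** The antilinear map is X |-> [cj X *m P]; the condition [cj P *m P = 1%:M] says that it is an
    involution. *)
Lemma real_structure : exists P : 'M[C]_7,
  [/\ P \in unitmx, forall X Y, cr (X *m P) (Y *m P) = cr X Y *m P,
    cj P *m P = 1%:M & forall z, cj (mu (cj_elt z)) *m P = P *m mu z].
Proof.
have [lmu imu dmu smu bmu] := mod_mu; have hrho := cj_rep.
have cje_inv z : cj_elt (cj_elt z) = z by case: z => x y; rewrite /cj_elt opprK.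
have irho : injective (fun z => cj (mu (cj_elt z))).
  by move=> z z' /(can_inj (@cjK _ _))/imu/(can_inj cje_inv).
have [P Pu PE] := rep_unique mod_mu hrho irho.
have drho z : der_mx (Omega0 C) (cj (mu (cj_elt z))).
  exact: (proj1 (der_mx_map conjc (Omega0_table C) (Omega0_table C) _) (dmu _)).
have comm z : mu z *m invmx P = invmx P *m cj (mu (cj_elt z)).
  by rewrite -[LHS](mulKmx Pu) [P *m (_ *m _)]mulmxA -PE mulmxK.
(* The cross product transported by P. P intertwines two actions by derivations, so b is
   equivariant, hence a multiple of the cross product. *)
pose b (X Y : V) := cr (X *m invmx P) (Y *m invmx P) *m P.
have [t tE] : exists t, forall X Y, b X Y = t *: cr X Y.
  apply: der0_cross_unique.
  - by move=> Y a X X'; rewrite /b mulmxDl -scalemxAl oct_cross_lin1 mulmxDl scalemxAl.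
  - by move=> X a Y Y'; rewrite /b mulmxDl -scalemxAl oct_cross_lin2 mulmxDl scalemxAl.
  - move=> A /smu[z <-] X Y; rewrite /b -!mulmxA comm -mulmxDl !mulmxA.
    rewrite -der0_cross //.
    by rewrite -[LHS]mulmxA PE mulmxA.
have t0 : t != 0.
  apply/eqP => t0; have [X [Y /eqP]] := cross_neq0 C; apply.
  have := tE (X *m P) (Y *m P); rewrite /b t0 scale0r !mulmxK // => e.
  by apply: (can_inj (mulmxK Pu)); rewrite e mul0mx.
(* The rule for automorphisms is quadratic in P on one side and linear on the other, so scaling by t
   absorbs the factor. *)
pose Q := t *: P.
have Qu : Q \in unitmx by rewrite unitmxZ // unitfE.
have Qaut X Y : cr (X *m Q) (Y *m Q) = cr X Y *m Q.
  rewrite /Q -!scalemxAr crossZl crossZr scalerA.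
  have := tE (X *m P) (Y *m P); rewrite /b !mulmxK // => ->.
  by rewrite scalerA.
have QE z : cj (mu (cj_elt z)) *m Q = Q *m mu z.
  by rewrite /Q -scalemxAr PE scalemxAl.
have cjQaut X Y : cr (X *m cj Q) (Y *m cj Q) = cr X Y *m cj Q.
  by rewrite -[X]cjK -[Y]cjK -!map_mxM !cj_cross Qaut map_mxM cj_cross.
have [c cE] : exists c, cj Q *m Q = c%:M.
  apply: der0_schur => A /smu[z <-].
  have := congr1 cj (QE (cj_elt z)); rewrite !map_mxM cje_inv cjK => e.
  by rewrite -mulmxA -QE mulmxA -e -mulmxA.
suff c1 : c = 1.
  by exists Q; split=> //; rewrite cE c1.
have [X [Y XY]] := cross_neq0 C.
(* The scalar matrix [cj Q *m Q] respects the cross product, being a composite of two maps that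
   do. *)
have cc : c * c = c.
  have := cjQaut X Y; move/(congr1 (mulmxr Q)); rewrite /= -Qaut -!mulmxA cE.
  rewrite !mul_mx_scalar crossZl crossZr scalerA => /eqP.
  by rewrite -subr_eq0 -scalerBl scaler_eq0 (negPf XY) orbF subr_eq0 => /eqP.
have c0 : c != 0.
  apply/eqP => c0; have : cj Q *m Q \in unitmx by rewrite unitmx_mul map_unitmx Qu.
  by rewrite cE c0 unitmxE det_scalar expr0n unitr0.
by apply: (mulfI c0); rewrite cc mulr1.
Qed.

End RealStructure.

Section FrameMatrix.
Variable F : numFieldType.
Local Notation V := 'rV[F]_7.
Variables (e1 e2 e7 : V) (g : int).
Hypotheses (n11 : oct_n e1 e1 = 1) (n22 : oct_n e2 e2 = 1) (n12 : oct_n e1 e2 = 0).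
Hypotheses (g2 : g * g = 1) (n77 : oct_n e7 e7 = g%:~R).
Hypotheses (n17 : oct_n e1 e7 = 0) (n27 : oct_n e2 e7 = 0)
  (n37 : oct_n (oct_cross e1 e2) e7 = 0).

Definition frame_mx : 'M[F]_7 := \matrix_(i < 7) frame (@oct_cross F) e1 e2 e7 i.

Lemma frame_mx_unit : frame_mx \in unitmx.
Proof.
rewrite -row_free_unit -kermx_eq0; apply/negPn/negP => /rowV0Pn[c /sub_kermxP cS].
apply/negP; rewrite negbK; apply/eqP/rowP => j; rewrite mxE.
have nE := frame_n (@oct_nC F) (@oct_nDl F) (@oct_nZl F) (@cross_anti F)
  (@crossDl F) (@cross_cyc F) (@cross_cross F) n11 n22 n12 n77 n17 n27 n37.
have := congr1 (fun X => oct_n X (frame (@oct_cross F) e1 e2 e7 j)) cS.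
rewrite oct_n0l mulmx_sum_row.
have nsum (I : finType) (f : I -> V) Z : oct_n (\sum_i f i) Z = \sum_i oct_n (f i) Z.
  by elim/big_rec2: _ => [|i x y _ <-]; rewrite ?oct_n0l ?oct_nDl.
rewrite nsum (bigD1 j) //= big1 => [|i ij].
  rewrite addr0 oct_nZl rowK nE // eqxx => /eqP; rewrite mulf_eq0.
  case/orP => [/eqP //|]; rewrite /frame_norm intr_eq0; case: ifP => // _ /eqP g0.
  by move: g2; rewrite g0.
by rewrite oct_nZl rowK nE // val_eqE (negPf ij) mulr0.
Qed.

Lemma frame_mx_table : has_table (form3_pull (Omega0 F) frame_mx) (iOmega_pm g).
Proof.
apply/table_pull => i j k; rewrite !rowK -oct_crossP.
by apply: (frame_form (@oct_nC F) (@oct_nDl F) (@oct_nZl F) (@cross_anti F)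
  (@crossDl F) (@cross_cyc F) (@cross_cross F)).
Qed.

End FrameMatrix.

(** * Orthonormal frames fixed by the involution *)

Section RealFrame.
Variable R : realType.
Local Notation C := R[i].
Local Notation V := 'rV[C]_7.
Local Notation cj := (map_mx (@conjc R)).
Local Notation n := (@oct_n C).
Local Notation cr := (@oct_cross C).
Variable P : 'M[C]_7.
Hypotheses (Pu : P \in unitmx)
  (Paut : forall X Y, cr (X *m P) (Y *m P) = cr X Y *m P) (PP : cj P *m P = 1%:M).

Definition real_vec (X : V) : Prop := cj X *m P = X.

Lemma real_vecD X Y : real_vec X -> real_vec Y -> real_vec (X + Y).
Proof. by move=> hX hY; rewrite /real_vec map_mxD mulmxDl hX hY. Qed.

Lemma real_vecZ (a : R) X : real_vec X -> real_vec (a%:C%C *: X).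
Proof. by move=> hX; rewrite /real_vec map_mxZ -scalemxAl hX /= oppr0. Qed.

Lemma real_vec_cross X Y : real_vec X -> real_vec Y -> real_vec (cr X Y).
Proof. by move=> hX hY; rewrite /real_vec -cj_cross -Paut hX hY. Qed.

Lemma real_vec_n X Y : real_vec X -> real_vec Y -> exists a : R, n X Y = a%:C%C.
Proof.
move=> hX hY; exists (complex.Re (n X Y)).
have : conjc (n X Y) = n X Y by rewrite -cj_n -(cross_autn Pu Paut) hX hY.
case: (n X Y) => a b [/eqP]; rewrite eq_sym -addr_eq0 -mulr2n mulrn_eq0 /=.
by move=> /eqP ->.
Qed.

Lemma real_vec_span X : exists Y Z, [/\ real_vec Y, real_vec Z & X = Y + 'i%C *: Z].
Proof.
pose J (Y : V) := cj Y *m P.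
have JJ Y : J (J Y) = Y by rewrite /J map_mxM cjK -mulmxA PP mulmx1.
have h2 : (2 : R) != 0 by rewrite pnatr_eq0.
exists ((2^-1)%:C%C *: (X + J X)), ((2^-1)%:C%C *: ('i%C *: (J X - X))); split.
- by apply: real_vecZ; rewrite /real_vec map_mxD mulmxDl -/(J X) -/(J (J X)) JJ addrC.
- apply: real_vecZ; rewrite /real_vec map_mxZ map_mxB -scalemxAl mulmxBl.
  rewrite -/(J X) -/(J (J X)) JJ /= -[J X - X]opprB scalerN -scaleNr; congr (_ *: _).
  by simpc.
rewrite !scalerA mulrAC -expr2 sqr_i mulN1r scaleNr -scalerN opprB -scalerDr.
rewrite addrACA subrr addr0 -mulr2n -scaler_nat scalerA.
have -> : (2^-1)%:C%C * 2 = 1 :> C.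
  by rewrite rmorphV /= ?unitfE // rmorph_nat mulVf // pnatr_eq0.
by rewrite scale1r.
Qed.

(* Zero vectors are allowed, the corresponding projection being [0 / 0 = 0]. *)
Lemma real_vec_anisotropic (u1 u2 u3 : V) :
  (forall u, u \in [:: u1; u2; u3] -> real_vec u /\ (n u u = 0 -> u = 0)) ->
  n u1 u2 = 0 -> n u1 u3 = 0 -> n u2 u3 = 0 ->
  exists X, [/\ real_vec X, n X X != 0, n X u1 = 0, n X u2 = 0 & n X u3 = 0].
Proof.
move=> hu n12 n13 n23.
have [r1 z1] : real_vec u1 /\ (n u1 u1 = 0 -> u1 = 0).
  by apply: hu; rewrite inE eqxx.
have [r2 z2] : real_vec u2 /\ (n u2 u2 = 0 -> u2 = 0).
  by apply: hu; rewrite !inE eqxx orbT.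
have [r3 z3] : real_vec u3 /\ (n u3 u3 = 0 -> u3 = 0).
  by apply: hu; rewrite !inE eqxx !orbT.
(* Otherwise n vanishes on the real vectors orthogonal to the three, by polarization and
   complexification on their whole orthogonal complement; nondegeneracy makes the projection [pr]
   zero, and three vectors would span C^7. *)
apply: contrapT => no.
have iso X : real_vec X -> n X u1 = 0 -> n X u2 = 0 -> n X u3 = 0 -> n X X = 0.
  move=> rX x1 x2 x3; apply/eqP/negPn/negP => nX; apply: no.
  by exists X.
pose pc u X := n X u / n u u.
pose pr X := X - (pc u1 X *: u1 + pc u2 X *: u2 + pc u3 X *: u3).
have nN X Z : n (- X) Z = - n X Z by rewrite -scaleN1r oct_nZl mulN1r.
have pcK u X : (n u u = 0 -> u = 0) -> pc u X * n u u = n X u.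
  move=> z; rewrite /pc; case: (eqVneq (n u u) 0) => [e|e]; last by rewrite divfK.
  by rewrite (z e) oct_nC oct_n0l mul0r mul0r.
have pr1 X : n (pr X) u1 = 0.
  rewrite oct_nDl nN !oct_nDl !oct_nZl (oct_nC u2) (oct_nC u3) n12 n13 !mulr0 !addr0.
  by rewrite pcK // subrr.
have pr2 X : n (pr X) u2 = 0.
  rewrite oct_nDl nN !oct_nDl !oct_nZl (oct_nC u3) n12 n23 !mulr0 !addr0 add0r.
  by rewrite pcK // subrr.
have pr3 X : n (pr X) u3 = 0.
  rewrite oct_nDl nN !oct_nDl !oct_nZl n13 n23 !mulr0 !add0r.
  by rewrite pcK // subrr.
have real_pc u X : real_vec u -> real_vec X -> exists a : R, pc u X = a%:C%C.
  move=> ru rX; have [a aE] := real_vec_n rX ru; have [b bE] := real_vec_n ru ru.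
  by exists (a / b); rewrite /pc aE bE rmorphM fmorphV.
have real_pr X : real_vec X -> real_vec (pr X).
  move=> rX; rewrite /pr -scaleN1r -[-1](rmorphN1 (real_complex R)).
  apply: real_vecD => //; apply: real_vecZ.
  have [a1 ->] := real_pc u1 X r1 rX; have [a2 ->] := real_pc u2 X r2 rX.
  have [a3 ->] := real_pc u3 X r3 rX.
  by apply: real_vecD; [apply: real_vecD|]; apply: real_vecZ.
have lin_pr a X Y : pr (a *: X + Y) = a *: pr X + pr Y.
  have lpc u : pc u (a *: X + Y) = a * pc u X + pc u Y.
    by rewrite /pc oct_nDl oct_nZl mulrDl mulrA.
  rewrite /pr !lpc; move: (pc u1 X) (pc u1 Y) (pc u2 X) (pc u2 Y) (pc u3 X) (pc u3 Y).
  move=> a1 b1 a2 b2 a3 b3; apply/rowP => j; rewrite !mxE; ring.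
have pp X Y : n (pr X) Y = n (pr X) (pr Y).
  rewrite /(pr Y) oct_nC [RHS]oct_nC [RHS]oct_nDl nN !oct_nDl !oct_nZl.
  by rewrite !(oct_nC _ (pr X)) pr1 pr2 pr3 !mulr0 !addr0 subr0.
have prE X : pr X = 0 -> X = pc u1 X *: u1 + pc u2 X *: u2 + pc u3 X *: u3.
  by move=> h; apply/eqP; rewrite -subr_eq0; apply/eqP.
clearbody pr.
have pr0 X Y : real_vec X -> real_vec Y -> n (pr X) (pr Y) = 0.
  move=> rX rY.
  have q Z : real_vec Z -> n (pr Z) (pr Z) = 0.
    by move=> rZ; apply: iso => //; exact: real_pr.
  have := q (1 *: X + Y); rewrite lin_pr !scale1r oct_nDl !oct_nDr !q // add0r addr0.
  rewrite (oct_nC (pr Y)) => /(_ (real_vecD rX rY))/eqP.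
  by rewrite -mulr2n mulrn_eq0 /= => /eqP.
have prX X : pr X = 0.
  apply: oct_n_inj => Y; rewrite oct_n0l.
  rewrite pp; have [X1 [X2 [rX1 rX2 ->]]] := real_vec_span X.
  have [Y1 [Y2 [rY1 rY2 ->]]] := real_vec_span Y.
  rewrite ![_ + _ *: _]addrC !lin_pr oct_nDl !oct_nDr !oct_nZl !oct_nZr.
  by rewrite !pr0 // !mulr0 !addr0.
have : (\dim {:V} <= size [:: u1; u2; u3])%N.
  apply: leq_trans (dim_span _); apply/dimvS/subvP => X _.
  by rewrite (prE X (prX X)) !rpredD // rpredZ // memv_span // !inE eqxx ?orbT.
by rewrite dimvf /dim /= mul1n.
Qed.

Lemma real_vec_unit (u1 u2 u3 : V) :
  (forall u, u \in [:: u1; u2; u3] -> real_vec u /\ (n u u = 0 -> u = 0)) ->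
  n u1 u2 = 0 -> n u1 u3 = 0 -> n u2 u3 = 0 ->
  exists X (s : bool), [/\ real_vec X, n X X = (-1) ^+ s, n X u1 = 0, n X u2 = 0
    & n X u3 = 0].
Proof.
move=> hu n12 n13 n23; have [X [rX nX x1 x2 x3]] := real_vec_anisotropic hu n12 n13 n23.
have [a aE] := real_vec_n rX rX.
have a0 : a != 0 by apply: contra nX => /eqP a0; rewrite aE a0.
pose c := (Num.sqrt `|a|)^-1.
exists (c%:C%C *: X), (a < 0); split; try by rewrite oct_nZl ?x1 ?x2 ?x3 mulr0.
  exact: real_vecZ.
rewrite oct_nZl oct_nZr aE -!rmorphM /= mulrA -expr2 /c exprVn sqr_sqrtr //.
have -> : `|a|^-1 * a = (-1) ^+ (a < 0)%R.
  by rewrite {2}[a]numEsign mulrCA mulVf ?mulr1 // normr_eq0.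
by rewrite rmorph_sign.
Qed.

Lemma real_vec0 : real_vec 0.
Proof. by rewrite /real_vec map_mx0 mul0mx. Qed.

(** Two orthogonal vectors of norm 1 exist in either signature, so only the sign of the norm of e_7
    remains free. *)
Lemma real_frame : exists (e1 e2 e7 : V) (s : bool),
  [/\ real_vec e1, real_vec e2 & real_vec e7] /\
  [/\ n e1 e1 = 1, n e2 e2 = 1, n e1 e2 = 0 & n e7 e7 = (-1) ^+ s] /\
  [/\ n e1 e7 = 0, n e2 e7 = 0 & n (cr e1 e2) e7 = 0].
Proof.
have n0l Z : n 0 Z = 0 by exact: oct_n0l.
have n0r Z : n Z 0 = 0 by rewrite oct_nC n0l.
have c1 X Y : n (cr X Y) X = 0 by rewrite -cross_cyc cross_xx n0l.
have c2 X Y : n (cr X Y) Y = 0 by rewrite cross_cyc cross_xx n0l.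
have ok0 : real_vec 0 /\ (n 0 0 = 0 -> (0 : V) = 0) by split=> //; exact: real_vec0.
have ok X s : real_vec X -> n X X = (-1) ^+ s -> real_vec X /\ (n X X = 0 -> X = 0).
  by move=> rX nX; split=> // /eqP; rewrite nX signr_eq0.
have sel u1 u2 u3 : (real_vec u1 /\ (n u1 u1 = 0 -> u1 = 0)) ->
    (real_vec u2 /\ (n u2 u2 = 0 -> u2 = 0)) ->
    (real_vec u3 /\ (n u3 u3 = 0 -> u3 = 0)) ->
    n u1 u2 = 0 -> n u1 u3 = 0 -> n u2 u3 = 0 ->
    exists X (s : bool), [/\ real_vec X, n X X = (-1) ^+ s, n X u1 = 0, n X u2 = 0
      & n X u3 = 0].
  move=> k1 k2 k3; apply: real_vec_unit => u; rewrite !inE.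
  by case/or3P => /eqP ->.
(* The product of two orthogonal vectors of negative norm has positive norm. *)
have [e1 [r1 n11]] : exists e1, real_vec e1 /\ n e1 e1 = 1.
  have [X [s [rX nX _ _ _]]] := sel 0 0 0 ok0 ok0 ok0 (n0l _) (n0l _) (n0l _).
  case: s nX => nX; last by exists X.
  have [Y [s [rY nY yx _ _]]] := sel X 0 0 (ok _ _ rX nX) ok0 ok0 (n0r _) (n0r _) (n0l _).
  case: s nY => nY; last by exists Y.
  exists (cr X Y); split; first exact: real_vec_cross.
  by rewrite cross_nM nX nY oct_nC yx expr0n subr0 -signr_addb.
have ok1 := ok e1 false r1 n11.
have [e2 [r2 n22 n12]] : exists e2, [/\ real_vec e2, n e2 e2 = 1 & n e1 e2 = 0].
  have [X [s [rX nX x1 _ _]]] := sel e1 0 0 ok1 ok0 ok0 (n0r _) (n0r _) (n0l _).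
  case: s nX => nX; last by exists X; rewrite oct_nC.
  have nZ : n (cr e1 X) (cr e1 X) = (-1) ^+ true.
    by rewrite cross_nM n11 nX (oct_nC e1 X) x1 expr0n subr0 mul1r.
  have rZ : real_vec (cr e1 X) by exact: real_vec_cross.
  (* Orthogonality of Y to e_1 x X makes X x Y orthogonal to e_1, by cyclicity. *)
  have [||| Y [s [rY nY y1 yx yz]]] := sel e1 X (cr e1 X) ok1 (ok _ _ rX nX) (ok _ _ rZ nZ).
  - by rewrite oct_nC.
  - by rewrite oct_nC c1.
  - by rewrite oct_nC c2.
  case: s nY => nY; last by exists Y; rewrite oct_nC.
  exists (cr X Y); split; first exact: real_vec_cross.
    by rewrite cross_nM nX nY (oct_nC X Y) yx expr0n subr0 -signr_addb.
  by rewrite oct_nC -cross_cyc oct_nC.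
have n33 : n (cr e1 e2) (cr e1 e2) = (-1) ^+ false.
  by rewrite cross_nM n11 n22 n12 expr0n subr0 mulr1.
have r3 : real_vec (cr e1 e2) by exact: real_vec_cross.
have [||e7 [s [r7 n77 n71 n72 n73]]] :=
  sel e1 e2 (cr e1 e2) ok1 (ok e2 false r2 n22) (ok _ _ r3 n33) n12.
- by rewrite oct_nC c1.
- by rewrite oct_nC c2.
by exists e1, e2, e7, s; split=> //; split; split=> //; rewrite oct_nC.
Qed.

Lemma real_frame_mx : exists (S : 'M[C]_7) (s : bool),
  [/\ S \in unitmx, cj S *m P = S
    & has_table (form3_pull (Omega0 C) S) (iOmega_pm ((-1) ^+ s))].
Proof.
have [e1 [e2 [e7 [s [[r1 r2 r7] [[n11 n22 n12 n77] [n17 n27 n37]]]]]]] := real_frame.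
have g2 : (-1) ^+ s * (-1) ^+ s = 1 :> int by rewrite -signr_addb addbb.
have n77' : n e7 e7 = ((-1) ^+ s : int)%:~R by rewrite n77 rmorph_sign.
exists (frame_mx e1 e2 e7), s; split.
- exact: frame_mx_unit g2 n77' n17 n27 n37.
- apply/row_matrixP => i; rewrite row_mul -map_row rowK.
  have r3 := real_vec_cross r1 r2.
  by case: i => [[|[|[|[|[|[|[|i]]]]]]] //= _]; rewrite /frame /=;
    do ?apply: real_vec_cross.
exact: frame_mx_table.
Qed.

End RealFrame.

(** * From frames to Omega0 and Omega1 *)

Module ChangeOfBasis.
Local Open Scope nat_scope.
Local Notation neg n := (- (n%:Z))%R.
Local Notation pos n := (n%:Z)%R (only parsing).

Definition split_list : seq (nat * nat * int) := [:: (0, 6, pos 1);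
  (1, 0, neg 1); (1, 3, neg 1); (2, 1, neg 1); (2, 4, neg 1);
  (3, 2, neg 1); (3, 5, neg 1); (4, 0, pos 1); (4, 3, neg 1);
  (5, 1, pos 1); (5, 4, neg 1); (6, 2, pos 1); (6, 5, neg 1)].

Definition split_inv_list : seq (nat * nat * int) := [:: (6, 0, pos 2);
  (0, 1, neg 1); (3, 1, neg 1); (1, 2, neg 1); (4, 2, neg 1);
  (2, 3, neg 1); (5, 3, neg 1); (0, 4, pos 1); (3, 4, neg 1);
  (1, 5, pos 1); (4, 5, neg 1); (2, 6, pos 1); (5, 6, neg 1)].

End ChangeOfBasis.

(* The rows express E_0, E_i, F_i in a basis in which the form is
   [iOmega_pm (-1)]: E_0 = e_7, E_i = - e_i - e_(i+3), F_i = e_i - e_(i+3). *)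
Definition split_mx (F : fieldType) : 'M[F]_7 :=
  imx F (sparse ChangeOfBasis.split_list).

Lemma split_mx_unit (F : numFieldType) : split_mx F \in unitmx.
Proof.
pose T' : 'M[F]_7 := imx F (sparse ChangeOfBasis.split_inv_list).
suff : split_mx F *m (2^-1 *: T') = 1%:M by case/mulmx1_unit.
rewrite -scalemxAr; apply/matrixP => i j.
have chk : alln 7 (fun i => alln 7 (fun j => isum 7 (fun k =>
    sparse ChangeOfBasis.split_list i k * sparse ChangeOfBasis.split_inv_list k j)
    == 2 * idelta i j)) by vm_compute.
have /eqP/(congr1 (fun z : int => z%:~R : F)) :=
  allnP (allnP chk (ltn_ord i)) (ltn_ord j).
rewrite intr_isum intrM => E.
transitivity (2^-1 * (2 * (idelta i j)%:~R) : F).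
  rewrite -[2 in RHS]/(2%:~R) -E 2!mxE; congr (_ * _); apply: eq_bigr => k _.
  by rewrite !mxE intrM.
rewrite mulKf ?pnatr_eq0 // !mxE /idelta -val_eqE.
by case: (_ == _).
Qed.

Lemma split_mx_table (F : numFieldType) (w : form3 'rV[F]_7) :
  has_table w (iOmega_pm (-1)) -> has_table (form3_pull w (split_mx F)) iOmega0.
Proof. by move=> tw; apply: (imx_pull_table tw); vm_compute. Qed.

(** Once -1 is a square, the algebra of Omega0 has a frame with all norms 1, and in such a frame the
    form is Omega1. *)
Lemma Omega1_pull (C : numFieldType) (i : C) : i * i = -1 ->
  exists2 S : 'M[C]_7, S \in unitmx &
  forall X Y Z, form3_pull (Omega0 C) S X Y Z = Omega1 C X Y Z.
Proof.
move=> i2.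
(* e_1 = (F_1 - E_1) / 2 and e_2 = (F_2 - E_2) / 2 have norm 1 because n(E_k, F_k) = - 2, and e_7 =
   i E_0 because n(E_0, E_0) = - 1. *)
pose e1 : 'rV[C]_7 := 2^-1 *: (delta_mx 0 (inord 4) - delta_mx 0 (inord 1)).
pose e2 : 'rV[C]_7 := 2^-1 *: (delta_mx 0 (inord 5) - delta_mx 0 (inord 2)).
pose e7 : 'rV[C]_7 := i *: delta_mx 0 (inord 0).
have cd m k : (m < 7)%N -> (k < 7)%N ->
    crd k (delta_mx 0 (inord m) : 'rV[C]_7) = (idelta m k)%:~R.
  by move=> m7 k7; rewrite crd_delta // inordK.
have cZB k a (A B : 'rV[C]_7) : crd k (a *: (A - B)) = a * (crd k A - crd k B).
  by rewrite /crd !mxE.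
have cZ k a (A : 'rV[C]_7) : crd k (a *: A) = a * crd k A by rewrite /crd !mxE.
have c1 k : (k < 7)%N -> crd k e1 = 2^-1 * ((idelta 4 k)%:~R - (idelta 1 k)%:~R).
  by move=> k7; rewrite cZB !cd.
have c2 k : (k < 7)%N -> crd k e2 = 2^-1 * ((idelta 5 k)%:~R - (idelta 2 k)%:~R).
  by move=> k7; rewrite cZB !cd.
have c7 k : (k < 7)%N -> crd k e7 = i * (idelta 0 k)%:~R.
  by move=> k7; rewrite cZ cd.
have g2 : 1 * 1 = 1 :> int by [].
have n11 : oct_n e1 e1 = 1.
  by rewrite /oct_n sum13 /Est /Fst !c1 // /idelta /=; field.
have n22 : oct_n e2 e2 = 1.
  by rewrite /oct_n sum13 /Est /Fst !c2 // /idelta /=; field.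
have n12 : oct_n e1 e2 = 0.
  by rewrite /oct_n sum13 /Est /Fst !c1 // !c2 // /idelta /=; field.
have n77 : oct_n e7 e7 = 1%:~R.
  rewrite /oct_n sum13 /Est /Fst !c7 // /idelta /=; ring: i2.
have n17 : oct_n e1 e7 = 0.
  by rewrite /oct_n sum13 /Est /Fst !c1 // !c7 // /idelta /=; ring.
have n27 : oct_n e2 e7 = 0.
  by rewrite /oct_n sum13 /Est /Fst !c2 // !c7 // /idelta /=; ring.
have n37 : oct_n (oct_cross e1 e2) e7 = 0.
  rewrite oct_crossP /Omega0 /= /Omega0_fun sum13 /wedge3 /Est /Fst.
  by rewrite !c1 // !c2 // !c7 // /idelta /=; ring.
exists (frame_mx e1 e2 e7); first exact: frame_mx_unit n11 n22 n12 g2 n77 n17 n27 n37.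
exact: table_eq (frame_mx_table n11 n22 n12 g2 n77 n17 n27 n37) (Omega1_table C).
Qed.

Section Classification.
Variable R : realType.
Local Notation C := R[i].
Local Notation cj := (map_mx (@conjc R)).

Lemma real_form_model (L : lieAlgType R) : real_form L (DerOct C) ->
  (exists nu, mx_model (L := L) (der_mx (Omega0 R)) nu) \/
  (exists nu, mx_model (L := L) (der_mx (Omega1 R)) nu).
Proof.
move=> iso; have [mu0 mod0] := DerOct_model C.
have [mu mod_mu] := iso_mx_model iso mod0.
have [P [Pu Paut PP PE]] := real_structure mod_mu.
have [S [s [Su SP Stab]]] := real_frame_mx Pu Paut PP.
(* The rows of T are fixed by the involution X |-> [cj X *m P], which commutes with the action of
   the real element (x, 0); so this action has a real matrix in the basis T. *)
have real (T : 'M[C]_7) x : T \in unitmx -> cj T *m P = T ->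
    cj (T *m mu (x, 0) *m invmx T) = T *m mu (x, 0) *m invmx T.
  move=> Tu TP; have cTu : cj T \in unitmx by rewrite map_unitmx.
  have := PE (x, 0); rewrite /cj_elt /= oppr0 => E.
  apply: (can_inj (mulmxK Tu)); rewrite mulmxKV // !map_mxM map_invmx.
  rewrite -[in X in _ *m X = _]TP mulmxA mulmxKV // -mulmxA E.
  by rewrite mulmxA TP.
case: s Stab => Stab; [left|right].
  pose T : 'M[C]_7 := split_mx C *m S.
  have Tu : T \in unitmx by rewrite unitmx_mul split_mx_unit.
  have tab : has_table (form3_pull (Omega0 C) T) iOmega0.
    move=> i j k; rewrite /= !mulmxA; exact: (split_mx_table Stab).
  apply: (descend_model (Omega0_table R) (Omega0_table C) mod_mu Tu).
    exact: table_eq tab (Omega0_table C).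
  by move=> x; apply: real => //; rewrite map_mxM map_imx -mulmxA SP.
apply: (descend_model (Omega1_table R) (Omega1_table C) mod_mu Su).
  exact: table_eq Stab (Omega1_table C).
by move=> x; apply: real.
Qed.

Lemma model_real_form (L : lieAlgType R) (wR : form3 'rV[R]_7)
    (wC : form3 'rV[C]_7) t (S : 'M[C]_7) nu :
  has_table wR t -> has_table wC t -> S \in unitmx ->
  (forall X Y Z, form3_pull (Omega0 C) S X Y Z = wC X Y Z) ->
  mx_model (L := L) (der_mx wR) nu -> real_form L (DerOct C).
Proof.
move=> tR tC Su pull mod_nu; have [mu mod_mu] := DerOct_model C.
have Siu : invmx S \in unitmx by rewrite unitmx_inv.
apply: (mx_model_iso (conj_mx_model Siu (cplx_model tR tC mod_nu)) mod_mu) => M.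
rewrite invmxK; apply: iff_trans (iff_sym (eq_der_mx pull _)) _.
apply: iff_trans (der_mx_pull _ _ Su) _.
have -> : invmx S *m (S *m M *m invmx S) *m S = M.
  by rewrite !mulmxA mulmxKV ?mulVmx ?mul1mx.
by [].
Qed.

Lemma Omega0_real_form (L : lieAlgType R) nu :
  mx_model (L := L) (der_mx (Omega0 R)) nu -> real_form L (DerOct C).
Proof.
apply: (model_real_form (Omega0_table R) (Omega0_table C) (unitmx1 _ _)).
by move=> X Y Z; rewrite /= !mulmx1.
Qed.

Lemma Omega1_real_form (L : lieAlgType R) nu :
  mx_model (L := L) (der_mx (Omega1 R)) nu -> real_form L (DerOct C).
Proof.
have i2 : 'i%C * 'i%C = -1 :> C by rewrite -expr2 sqr_i.
have [S Su pull] := Omega1_pull i2.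
exact: (model_real_form (Omega1_table R) (Omega1_table C) Su pull).
Qed.

End Classification.

(** * Killing forms *)

Section LfunTrace.
Variables (F : fieldType) (V : vectType F).

Lemma coord_trace_eq m n (e : m.-tuple V) (e' : n.-tuple V) (f : 'End(V)) :
  basis_of {:V} e -> basis_of {:V} e' ->
  \sum_(i < m) coord e i (f e`_i) = \sum_(j < n) coord e' j (f e'`_j).
Proof.
move=> be be'.
transitivity (\sum_(i < m) \sum_(j < n) coord e' j (f e`_i) * coord e i e'`_j).
  apply: eq_bigr => i _; rewrite {1}(coord_basis be' (memvf (f e`_i))) linear_sum.
  by apply: eq_bigr => j _; rewrite linearZ.
rewrite exchange_big /=; apply: eq_bigr => j _.
rewrite {2}(coord_basis be (memvf e'`_j)) !linear_sum; apply: eq_bigr => i _.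
by rewrite !linearZ /= mulrC.
Qed.

Lemma lfun_traceE n (e : n.-tuple V) (f : 'End(V)) : basis_of {:V} e ->
  lfun_trace f = \sum_(i < n) coord e i (f e`_i).
Proof.
move=> be; rewrite -(coord_trace_eq f (vbasisP {:V}) be).
by apply: eq_bigr => i _; rewrite mxE /= passmx.vecof_delta // mxE.
Qed.

End LfunTrace.

Section KillingModel.
Variables (F : numFieldType) (L : lieVectType F) (w : form3 'rV[F]_7).
Variables (mu : L -> 'M[F]_7) (B : nat -> itable) (pos : nat -> nat * nat).
Hypotheses (mod_mu : mx_model (der_mx w) mu)
  (derB : forall l, (l < 14)%N -> der_mx w (imx F (B l)))
  (spanB : forall M, der_mx w M ->
     M = \sum_(l < 14) M (inord (pos l).1) (inord (pos l).2) *: imx F (B l))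
  (posB : forall k, (k < 14)%N -> ((pos k).1 < 7)%N && ((pos k).2 < 7)%N)
  (dualB : forall k l, (k < 14)%N -> (l < 14)%N ->
     B l (pos k).1 (pos k).2 = idelta l k).

Let lmu : linear mu. Proof. by case: mod_mu. Qed.
Let imu : injective mu. Proof. by case: mod_mu. Qed.
Let dmu x : der_mx w (mu x). Proof. by case: mod_mu. Qed.
Let smu M : der_mx w M -> exists x, mu x = M.
Proof. by case: mod_mu => _ _ _ + _; apply. Qed.
Let bmu x y : mu (lbr x y) = mu y *m mu x - mu x *m mu y. Proof. by case: mod_mu. Qed.

Definition entry (l : nat) (x : L) : F := mu x (inord (pos l).1) (inord (pos l).2).

Lemma model_basis : exists b : 14.-tuple L,
  [/\ basis_of {:L} b, forall i : 'I_14, mu b`_i = imx F (B i)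
    & forall (i : 'I_14) x, coord b i x = entry i x].
Proof.
have h (l : 'I_14) : {x | mu x = imx F (B l)}.
  by apply: cid; apply/smu/derB.
pose b := [tuple sval (h i) | i < 14].
have bE (i : 'I_14) : mu b`_i = imx F (B i).
  by rewrite -tnth_nth tnth_mktuple; exact: svalP (h i).
have expand x : x = \sum_(i < 14) entry i x *: b`_i.
  apply: imu; rewrite (linear_mx_sum lmu) {1}(spanB (dmu x)).
  by apply: eq_bigr => i _; rewrite bE.
have fb : free b.
  apply/freeP => k kb i; have := congr1 mu kb.
  rewrite (linear_mx_sum lmu) (linear_fun0 lmu).
  move=> /matrixP/(_ (inord (pos i).1) (inord (pos i).2)).
  have /andP[p1 p2] := posB (ltn_ord i).
  rewrite summxE mxE (bigD1 i) //= big1 => [|j ji].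
    by rewrite bE !mxE !inordK // dualB // /idelta eqxx mulr1 addr0.
  by rewrite bE !mxE !inordK // dualB // /idelta (inj_eq val_inj) (negPf ji) mulr0.
have bb : basis_of {:L} b.
  rewrite /basis_of fb andbT eqEsubv subvf /=; apply/subvP => x _.
  rewrite (expand x); apply: rpred_sum => i _; apply: rpredZ.
  by apply: memv_span; apply: mem_nth; rewrite size_tuple.
exists b; split=> // i x; rewrite {1}(expand x).
exact: (coord_sum_free (fun i : 'I_14 => entry i x)).
Qed.

Lemma killing_coord : exists b : 14.-tuple L,
  [/\ basis_of {:L} b, forall i : 'I_14, mu b`_i = imx F (B i),
      forall (i : 'I_14) x, coord b i x = entry i x
    & forall x y, killing x y = \sum_(k < 14) coord b k (lbr x (lbr y b`_k))].
Proof.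
have [b [bb bE cE]] := model_basis; exists b; split=> // x y.
rewrite /killing (lfun_traceE _ bb); apply: eq_bigr => k _.
by rewrite comp_lfunE /ad lfunE /= lfunE.
Qed.

Lemma ibracketP x y X Y : mu x = imx F X -> mu y = imx F Y ->
  mu (lbr x y) = imx F (ibracket X Y).
Proof.
move=> xX yY; rewrite bmu xX yY; apply/matrixP => r s; rewrite !mxE intrB !intr_isum.
by congr (_ - _); apply: eq_bigr => t _; rewrite !mxE intrM.
Qed.

(** Coordinate m of [X, B_k], that is the matrix of ad X in the basis [B], read off at the positions
    [pos]. *)
Definition iad (X : itable) : itable := fun k m =>
  ibracket X (B k) (pos m).1 (pos m).2.

Lemma iadP x X y (k m : 'I_14) : mu x = imx F X -> mu y = imx F (B k) ->
  entry m (lbr x y) = (iad X k m)%:~R.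
Proof.
move=> xX yB; have /andP[p1 p2] := posB (ltn_ord m).
by rewrite /entry (ibracketP xX yB) mxE !inordK.
Qed.

Definition itrace (A A' : itable) : int :=
  isum 14 (fun k => isum 14 (fun m => A' k m * A m k)).

Lemma ikillingP x y X Y : mu x = imx F X -> mu y = imx F Y ->
  killing x y = (itrace (iad X) (iad Y))%:~R.
Proof.
move=> xX yY; have [b [bb bE cE ->]] := killing_coord.
rewrite intr_isum; apply: eq_bigr => k _.
rewrite {1}(coord_basis bb (memvf (lbr y b`_k))) intr_isum.
have lx : linear (fun z : L => lbr x z) by move=> a u v; rewrite lbrDr lbrZr.
pose f : {linear L -> F^o} := HB.pack_for {linear L -> F^o} (fun z => coord b k (lbr x z))
  (GRing.isLinear.Build F L F^o _ _ (fun a u v =>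
     etrans (congr1 (coord b k) (lx a u v)) (linearP (coord b k) a _ _))).
rewrite -[LHS]/(f _) linear_sum; apply: eq_bigr => m _.
by rewrite linearZ /= !cE (iadP _ xX (bE _)) (iadP _ yY (bE _)) intrM.
Qed.

Definition tabulate (A : itable) : seq (seq int) :=
  mkseq (fun k => mkseq (A k) 14) 14.

Definition lookup (T : seq (seq int)) : itable := fun k m => nth 0 (nth [::] T k) m.

Lemma itrace_tabulate A A' :
  itrace (lookup (tabulate A)) (lookup (tabulate A')) = itrace A A'.
Proof.
rewrite /itrace !isumE; apply: eq_bigr => k _; rewrite !isumE.
by apply: eq_bigr => m _; rewrite /lookup /tabulate !nth_mkseq.
Qed.

(* The matrices of [ad] are computed once and for all, hence the [let]. *)
Definition gram_table (E : nat -> itable) (g : nat -> int) : bool :=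
  let T := mkseq (fun i => tabulate (iad (E i))) 14 in
  alln 14 (fun i => alln 14 (fun j =>
    itrace (lookup (nth [::] T i)) (lookup (nth [::] T j)) ==
      if i == j then g i else 0)).

Lemma gram_tableP E g i j : gram_table E g -> (i < 14)%N -> (j < 14)%N ->
  itrace (iad (E i)) (iad (E j)) = if i == j then g i else 0.
Proof.
move=> chk i14 j14; have /eqP := allnP (allnP chk i14) j14.
by rewrite !(nth_mkseq _ _ i14) !(nth_mkseq _ _ j14) itrace_tabulate.
Qed.

Lemma killing_linl y : scalar (fun x : L => killing x y).
Proof.
have [b [_ _ _ kE]] := killing_coord => a x x'.
rewrite !kE mulr_sumr -big_split; apply: eq_bigr => k _ /=.
by rewrite lbrDl lbrZl linearP.
Qed.

Lemma killing_linr x : scalar (fun y : L => killing x y).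
Proof.
have [b [_ _ _ kE]] := killing_coord => a y y'.
rewrite !kE mulr_sumr -big_split; apply: eq_bigr => k _ /=.
by rewrite lbrDl lbrZl lbrDr lbrZr linearP.
Qed.

Lemma killing_suml (I : finType) (c : I -> F) (x : I -> L) y :
  killing (\sum_i c i *: x i) y = \sum_i c i * killing (x i) y.
Proof.
have l := killing_linl y.
have k0 : killing 0 y = 0 := linear_fun0 (W := F^o) l.
by elim/big_rec2: _ => [|i u v _ <-]; [exact: k0 | exact: l].
Qed.

Lemma killing_sumr (I : finType) (c : I -> F) (x : I -> L) y :
  killing y (\sum_i c i *: x i) = \sum_i c i * killing y (x i).
Proof.
have l := killing_linr y.
have k0 : killing y 0 = 0 := linear_fun0 (W := F^o) l.
by elim/big_rec2: _ => [|i u v _ <-]; [exact: k0 | exact: l].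
Qed.

Variables (E : nat -> itable) (g : nat -> int).
Hypotheses (derE : forall l, (l < 14)%N -> der_mx w (imx F (E l)))
  (orthE : gram_table E g)
  (g0 : forall i, (i < 14)%N -> g i != 0).

(** An orthogonal family of vectors of nonzero norm is free, and 14 is the dimension. *)
Lemma killing_orthogonal : exists e : 14.-tuple L, basis_of {:L} e /\
  forall i j : 'I_14, killing e`_i e`_j = (if i == j then (g i)%:~R else 0).
Proof.
have [b [bb _ _]] := model_basis.
have h (l : 'I_14) : {x | mu x = imx F (E l)}.
  by apply: cid; apply/smu/derE.
pose e := [tuple sval (h i) | i < 14].
have eE (i : 'I_14) : mu e`_i = imx F (E i).
  by rewrite -tnth_nth tnth_mktuple; exact: svalP (h i).
have K (i j : 'I_14) : killing e`_i e`_j = (if i == j then (g i)%:~R else 0).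
  rewrite (ikillingP (eE i) (eE j)) (gram_tableP orthE) // -val_eqE /=.
  by case: (_ == _).
suff fe : free e.
  by exists e; split=> //; rewrite basisEfree fe subvf (size_basis bb) size_tuple.
apply/freeP => c ce i.
have := congr1 (fun x => killing x e`_i) ce; rewrite killing_suml.
have -> : killing 0 e`_i = 0 := linear_fun0 (W := F^o) (killing_linl e`_i).
rewrite (bigD1 i) //= big1 => [|j ji]; last by rewrite K (negPf ji) mulr0.
rewrite addr0 K eqxx => /eqP; rewrite mulf_eq0 intr_eq0 (negPf (g0 _)) // orbF.
by move/eqP.
Qed.

End KillingModel.

Section Signature.
Variable R : realType.

Lemma signature_tuple (V : vectType R) (b : V -> V -> R) n (e : n.-tuple V) :
  basis_of {:V} e ->
  (forall i j : 'I_n, i != j -> b e`_i e`_j = 0) ->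
  has_signature b (#|[set i : 'I_n | 0 < b e`_i e`_i]|%:Z
                   - #|[set i : 'I_n | b e`_i e`_i < 0]|%:Z).
Proof.
move=> be; have d := size_basis be.
by case: n / d e be => e be orth; exists e; split.
Qed.

Lemma card_ord_count n (p : pred nat) : #|[set i : 'I_n | p i]| = count p (iota 0 n).
Proof.
rewrite -(val_enum_ord n) count_map -size_filter cardE /enum_mem -filter_predI.
by congr (size _); apply: eq_filter => i; rewrite /= !inE andbT.
Qed.

Lemma orthogonal_signature (V : vectType R) (b : V -> V -> R) n (e : n.-tuple V)
    (g : nat -> int) : basis_of {:V} e ->
  (forall i j : 'I_n, b e`_i e`_j = if i == j then (g i)%:~R else 0) ->
  has_signature b ((count (fun i => 0 < g i) (iota 0 n))%:Z
                   - (count (fun i => g i < 0) (iota 0 n))%:Z).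
Proof.
move=> be orth; rewrite -!card_ord_count.
have := signature_tuple be (b := b) _; set s1 := [set i | _]; set s2 := [set i | _].
have -> : s1 = [set i : 'I_n | 0 < g i].
  by apply/setP => i; rewrite !inE orth eqxx ltr0z.
have -> : s2 = [set i : 'I_n | g i < 0].
  by apply/setP => i; rewrite !inE orth eqxx ltrz0.
by apply=> i j ij; rewrite orth (negPf ij).
Qed.

Lemma signature_bound (V : vectType R) (b : V -> V -> R) s :
  (forall x, x != 0 -> b x x < 0) -> has_signature b s -> s <= 0.
Proof.
move=> neg [e [be _ ->]].
have -> : [set i : 'I_(\dim {:V}) | 0 < b e`_i e`_i] = set0.
  apply/setP => i; rewrite !inE; apply/negbTE; rewrite -leNgt ltW // neg //.
  have := basis_free be; apply: contraTneq => ei.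
  apply/negP => /freeP/(_ (fun j => (j == i)%:R)).
  rewrite (bigD1 i) //= big1 => [|j /negPf ->]; last by rewrite scale0r.
  rewrite ei scaler0 addr0 => /(_ erefl i)/eqP.
  by rewrite eqxx oner_eq0.
by rewrite cards0 sub0r oppr_le0.
Qed.

End Signature.

Module OrthogonalTables.
Local Open Scope nat_scope.
Local Notation neg n := (- (n%:Z))%R.
Local Notation pos n := (n%:Z)%R (only parsing).

(** Sums and differences of opposite root vectors, which contribute one positive and one negative
    norm per pair, then an orthogonal basis of the Cartan subalgebra. Hence the signature 2, the
    rank. *)
Definition ortho0_list : seq (seq (nat * int)) := [::
    [:: (0, pos 1); (3, pos 1)]; [:: (0, pos 1); (3, neg 1)];
    [:: (1, pos 1); (4, pos 1)]; [:: (1, pos 1); (4, neg 1)];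
    [:: (2, pos 1); (5, pos 1)]; [:: (2, pos 1); (5, neg 1)];
    [:: (6, pos 1); (8, pos 1)]; [:: (6, pos 1); (8, neg 1)];
    [:: (7, pos 1); (10, pos 1)]; [:: (7, pos 1); (10, neg 1)];
    [:: (9, pos 1); (11, pos 1)]; [:: (9, pos 1); (11, neg 1)];
    [:: (12, pos 1)]; [:: (12, neg 1); (13, pos 2)]].

(** The matrices of [basis1] fall into seven pairs sharing a rotation plane; each pair is
    orthogonalized in the manner of Gram-Schmidt, the second vector being doubled to stay
    integral. *)
Definition ortho1_list : seq (seq (nat * int)) := [::
    [:: (0, pos 1)]; [:: (1, pos 1)]; [:: (2, pos 1)]; [:: (3, pos 1)];
    [:: (4, pos 1)]; [:: (1, neg 1); (5, pos 2)]; [:: (6, pos 1)];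
    [:: (7, pos 1)]; [:: (4, neg 1); (8, pos 2)];
    [:: (3, pos 1); (9, pos 2)]; [:: (0, neg 1); (10, pos 2)];
    [:: (7, pos 1); (11, pos 2)]; [:: (6, neg 1); (12, pos 2)];
    [:: (2, pos 1); (13, pos 2)]].

End OrthogonalTables.

Definition icomb (B : nat -> itable) (s : seq (nat * int)) : itable := fun r c =>
  foldr (fun t acc => t.2 * B t.1 r c + acc) 0 s.

Lemma der_mx_icomb (F : fieldType) (w : form3 'rV[F]_7) (B : nat -> itable) s :
  (forall l, (l < 14)%N -> der_mx w (imx F (B l))) ->
  all (fun t : nat * int => (t.1 < 14)%N) s -> der_mx w (imx F (icomb B s)).
Proof.
move=> derB; case: (form3P w) => p1 p2 p3 _ _ _.
elim: s => [_|[l a] s IHs /= /andP[/derB dl /IHs ds]] X Y Z.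
  have -> : imx F (icomb B [::]) = 0 by apply/matrixP => i j; rewrite !mxE.
  by have [z1 z2 z3] := form3_0 w; rewrite !mulmx0 z1 z2 z3 !addr0.
have -> : imx F (icomb B ((l, a) :: s)) = a%:~R *: imx F (B l) + imx F (icomb B s).
  by apply/matrixP => i j; rewrite !mxE intrD intrM.
rewrite !mulmxDr -!scalemxAr p1 p2 p3.
transitivity (a%:~R * (w (X *m imx F (B l)) Y Z + w X (Y *m imx F (B l)) Z
    + w X Y (Z *m imx F (B l)))); last by rewrite dl mulr0.
by rewrite -[RHS]addr0 -(ds X Y Z); ring.
Qed.

Definition ortho0 (l : nat) := icomb basis0 (nth [::] OrthogonalTables.ortho0_list l).
Definition ortho1 (l : nat) := icomb basis1 (nth [::] OrthogonalTables.ortho1_list l).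

Definition ortho0_norm (l : nat) : int := nth 0
  [:: -48; 48; 48; -48; -48; 48; 16; -16; 16; -16; 16; -16; 16; 48] l.
Definition ortho1_norm (l : nat) : int := nth 0
  [:: -16; -16; -16; -16; -16; -48; -16; -16; -48; -48; -48; -48; -48; -48] l.

Section Types.
Variables (R : realType) (L : lieVectType R) (mu : L -> 'M[R]_7).

Lemma pos0_lt k : (k < 14)%N -> ((pos0 k).1 < 7)%N && ((pos0 k).2 < 7)%N.
Proof. by move: k; apply: allnP; vm_compute. Qed.

Lemma pos1_lt k : (k < 14)%N -> ((pos1 k).1 < 7)%N && ((pos1 k).2 < 7)%N.
Proof. by move: k; apply: allnP; vm_compute. Qed.

Lemma dual0 k l : (k < 14)%N -> (l < 14)%N ->
  basis0 l (pos0 k).1 (pos0 k).2 = idelta l k.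
Proof.
have chk : alln 14 (fun k => alln 14 (fun l =>
  basis0 l (pos0 k).1 (pos0 k).2 == idelta l k)) by vm_compute.
by move=> k14 l14; apply/eqP; exact: (allnP (allnP chk k14) l14).
Qed.

Lemma dual1 k l : (k < 14)%N -> (l < 14)%N ->
  basis1 l (pos1 k).1 (pos1 k).2 = idelta l k.
Proof.
have chk : alln 14 (fun k => alln 14 (fun l =>
  basis1 l (pos1 k).1 (pos1 k).2 == idelta l k)) by vm_compute.
by move=> k14 l14; apply/eqP; exact: (allnP (allnP chk k14) l14).
Qed.

Lemma ortho0_gram : gram_table basis0 pos0 ortho0 ortho0_norm.
Proof. by vm_compute. Qed.

Lemma ortho1_gram : gram_table basis1 pos1 ortho1 ortho1_norm.
Proof. by vm_compute. Qed.

Lemma killing0_orthogonal : mx_model (der_mx (Omega0 R)) mu ->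
  exists e : 14.-tuple L, basis_of {:L} e /\
  forall i j : 'I_14, killing e`_i e`_j = (if i == j then (ortho0_norm i)%:~R else 0).
Proof.
move=> mod_mu; have der l : (l < 14)%N -> der_mx (Omega0 R) (imx R (ortho0 l)).
  move=> l14; apply: der_mx_icomb; first exact: der0_basis.
  by move: l l14; apply: allnP; vm_compute.
apply: (killing_orthogonal mod_mu (@der0_basis R) (@der0_span R) pos0_lt dual0 der
  ortho0_gram).
by apply: allnP; vm_compute.
Qed.

Lemma killing1_orthogonal : mx_model (der_mx (Omega1 R)) mu ->
  exists e : 14.-tuple L, basis_of {:L} e /\
  forall i j : 'I_14, killing e`_i e`_j = (if i == j then (ortho1_norm i)%:~R else 0).
Proof.
move=> mod_mu; have der l : (l < 14)%N -> der_mx (Omega1 R) (imx R (ortho1 l)).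
  move=> l14; apply: der_mx_icomb; first exact: der1_basis.
  by move: l l14; apply: allnP; vm_compute.
apply: (killing_orthogonal mod_mu (@der1_basis R) (@der1_span R) pos1_lt dual1 der
  ortho1_gram).
by apply: allnP; vm_compute.
Qed.

Lemma model_compact : mx_model (der_mx (Omega1 R)) mu -> is_g2_compact L.
Proof.
move=> mod_mu; have [e [be orth]] := killing1_orthogonal mod_mu; split.
- exact: Omega1_real_form mod_mu.
- move=> x x0; rewrite (coord_basis be (memvf x)).
  have ls := killing_suml mod_mu (@der1_basis R) (@der1_span R) pos1_lt dual1.
  have rs := killing_sumr mod_mu (@der1_basis R) (@der1_span R) pos1_lt dual1.
  have neg i : (i < 14)%N -> ortho1_norm i < 0.
    by move: i; apply: allnP; vm_compute.
  have -> : killing (\sum_i coord e i x *: e`_i) (\sum_i coord e i x *: e`_i)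
      = \sum_(i < 14) coord e i x ^+ 2 * (ortho1_norm i)%:~R.
    rewrite ls; apply: eq_bigr => i _; rewrite rs (bigD1 i) //= big1 => [|j ji].
      by rewrite orth eqxx addr0 mulrA expr2.
    by rewrite orth eq_sym (negPf ji) mulr0.
  rewrite -oppr_gt0 -sumrN lt_def; apply/andP; split; last first.
    apply: sumr_ge0 => i _; rewrite -mulrN mulr_ge0 ?sqr_ge0 // oppr_ge0.
    by rewrite lerz0 ltW // neg.
  apply: contra x0; rewrite psumr_eq0 => [/allP h|i _]; last first.
    rewrite -mulrN mulr_ge0 ?sqr_ge0 // oppr_ge0.
    by rewrite lerz0 ltW // neg.
  apply/eqP; rewrite (coord_basis be (memvf x)) big1 // => i _.
  have := h i (mem_index_enum i); rewrite /= oppr_eq0 mulf_eq0 sqrf_eq0 intr_eq0.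
  by rewrite (lt_eqF (neg _ (ltn_ord i))) orbF => /eqP ->; rewrite scale0r.
by have := orthogonal_signature be orth.
Qed.

End Types.

(** * The split Cartan subalgebra *)

Lemma ad_diagonalizable_tuple (F : fieldType) (L : lieVectType F) (h : L) n
    (e : n.-tuple L) : basis_of {:L} e ->
  (forall i : 'I_n, exists c : F, lbr h e`_i = c *: e`_i) -> ad_diagonalizable h.
Proof.
move=> be; have d := size_basis be.
by case: n / d e be => e be eig; exists e.
Qed.

Section Split.
Variables (F : numFieldType) (L : lieVectType F) (mu : L -> 'M[F]_7).
Hypothesis mod_mu : mx_model (der_mx (Omega0 F)) mu.

Let lmu : linear mu. Proof. by case: mod_mu. Qed.
Let imu : injective mu. Proof. by case: mod_mu. Qed.
Let bmu x y : mu (lbr x y) = mu y *m mu x - mu x *m mu y. Proof. by case: mod_mu. Qed.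

Definition diag_elt (x : L) : Prop := is_diag_mx (mu x).

Let diagP x : diag_elt x <-> forall i j, i != j -> mu x i j = 0.
Proof.
split=> [/is_diag_mxP h i j ij|h]; first by apply: h; rewrite val_eqE.
by apply/is_diag_mxP => i j ij; apply: h; rewrite -val_eqE.
Qed.

Lemma diag_lbr x y : diag_elt x -> diag_elt y -> lbr x y = 0.
Proof.
move=> dx dy; apply: imu; rewrite bmu (linear_fun0 lmu).
have [X ->] := diag_mxP _ dx; have [Y ->] := diag_mxP _ dy.
by rewrite !mulmx_diag; apply/eqP; rewrite subr_eq0; apply/eqP; congr diag_mx;
  apply/rowP => i; rewrite !mxE mulrC.
Qed.

Fact diag_elt0 : diag_elt 0.
Proof. by apply/diagP => i j ij; rewrite (linear_fun0 lmu) mxE. Qed.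

Fact diag_eltP a x y : diag_elt x -> diag_elt y -> diag_elt (a *: x + y).
Proof.
move=> /diagP dx /diagP dy; apply/diagP => i j ij.
by rewrite lmu !mxE dx // dy // mulr0 addr0.
Qed.

Fact diag_elt_lbr x y : diag_elt x -> diag_elt y -> diag_elt (lbr x y).
Proof. by move=> dx dy; rewrite diag_lbr //; exact: diag_elt0. Qed.

Definition diag_subalg : lieSubalg L := LieSubalg diag_elt0 diag_eltP diag_elt_lbr.

(** Diagonal matrices commute, so the algebra is nilpotent with one bracket. The principal h is
    diagonal with distinct entries, and a matrix whose commutator with it is diagonal is itself
    diagonal. *)
Lemma diag_cartan : cartan_subalgebra diag_subalg.
Proof.
split.
  by exists 1%N => s y Hs Hy; case/tupleP: s Hs => x s Hs; rewrite (tuple0 s) /=;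
    apply: diag_lbr => //; have := Hs ord0; rewrite tnth0.
move=> x nx; have [_ _ _ smu _] := mod_mu.
have [h hE] : exists h, mu h = imx F (principal_mx 0).
  apply: smu; apply: (der_imx (Omega0_table F)); by vm_compute.
have hdiag : diag_elt h.
  apply/diagP => i j ij; rewrite hE mxE.
  have chk : alln 7 (fun i => alln 7 (fun j => (i != j) ==> (principal_mx 0 i j == 0))).
    by vm_compute.
  by have /implyP/(_ ij)/eqP -> := allnP (allnP chk (ltn_ord i)) (ltn_ord j).
have dist (i j : 'I_7) : i != j -> principal_mx 0 i i != principal_mx 0 j j.
  move=> ij; have chk : alln 7 (fun i => alln 7 (fun j => (i != j) ==>
    (principal_mx 0 i i != principal_mx 0 j j))) by vm_compute.
  exact: (implyP (allnP (allnP chk (ltn_ord i)) (ltn_ord j)) ij).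
apply/diagP => i j ij; have /diagP/(_ i j ij) := nx _ hdiag.
have [d dE] := diag_mxP _ hdiag.
have dd k : d 0 k = (principal_mx 0 k k)%:~R.
  by have /matrixP/(_ k k) := hE; rewrite dE !mxE eqxx.
rewrite bmu dE mul_diag_mx mul_mx_diag !mxE [mu x i j * _]mulrC -mulrBl => /eqP.
by rewrite mulf_eq0 subr_eq0 !dd eqr_int (negPf (dist _ _ ij)) => /eqP.
Qed.

(** The basis [basis0] consists of common eigenvectors. A diagonal element has zero coordinates on
    the twelve root vectors, whose positions lie off the diagonal, so only elements 12 and 13 remain
    to be tested. *)
Lemma diag_diagonalizable h : diag_elt h -> ad_diagonalizable h.
Proof.
move=> /diagP dh.
have [b [bb bE _]] := model_basis mod_mu (@der0_basis F) (@der0_span F) pos0_lt dual0.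
apply: (ad_diagonalizable_tuple bb) => l; have [_ _ dmu _ _] := mod_mu.
pose c k : F := mu h (inord (pos0 k).1) (inord (pos0 k).2).
have c0 k : (k < 12)%N -> c k = 0.
  move=> k12; apply: dh.
  have chk : alln 12 (fun k => (pos0 k).1 != (pos0 k).2) by vm_compute.
  have /andP[p1 p2] := pos0_lt (ltn_trans k12 (isT : 12 < 14)%N).
  by rewrite -val_eqE /= !inordK // (allnP chk).
have hE : mu h = c 12%N *: imx F (basis0 12) + c 13%N *: imx F (basis0 13).
  transitivity (\sum_(k < 14) c k *: imx F (basis0 k)); first exact: der0_span.
  rewrite 2!big_ord_recr /= big1 ?add0r // => k _.
  by rewrite c0 ?scale0r //; exact: ltn_ord k.
pose v k : int := ibracket (basis0 k) (basis0 l) (pos0 l).1 (pos0 l).2.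
have br k : (k < 14)%N -> k \in [:: 12; 13]%N ->
    imx F (basis0 l) *m imx F (basis0 k) - imx F (basis0 k) *m imx F (basis0 l)
    = (v k)%:~R *: imx F (basis0 l).
  move=> k14 kc.
  have chk : all (fun k => alln 14 (fun l => alln 7 (fun r => alln 7 (fun s =>
    ibracket (basis0 k) (basis0 l) r s ==
    ibracket (basis0 k) (basis0 l) (pos0 l).1 (pos0 l).2 * basis0 l r s))))
    [:: 12; 13]%N.
    by vm_compute.
  apply/matrixP => r s; rewrite !mxE /v -intrM.
  have /eqP <- :=
    allnP (allnP (allnP (allP chk k kc) (ltn_ord l)) (ltn_ord r)) (ltn_ord s).
  by rewrite intrB !intr_isum; congr (_ - _); apply: eq_bigr => t _; rewrite !mxE intrM.
exists (c 12%N * (v 12%N)%:~R + c 13%N * (v 13%N)%:~R); apply: imu.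
rewrite (linear_funZ _ _ lmu) bmu bE hE mulmxDl mulmxDr -!scalemxAl -!scalemxAr.
by rewrite opprD addrACA -!scalerBr !br // !scalerA -scalerDl.
Qed.

Lemma model_lie_split : lie_split L.
Proof. by exists diag_subalg; [exact: diag_cartan | exact: diag_diagonalizable]. Qed.

End Split.

Section Main.
Variable R : realType.

Lemma model_split (L : lieVectType R) mu :
  mx_model (L := L) (der_mx (Omega0 R)) mu -> is_g2_split L.
Proof.
move=> mod_mu; have [e [be orth]] := killing0_orthogonal mod_mu; split.
- exact: Omega0_real_form mod_mu.
- exact: model_lie_split mod_mu.
by have := orthogonal_signature be orth.
Qed.

(** A negative definite form has signature at most 0, and the split form has signature 2. *)
Lemma split_not_compact (L : lieVectType R) : is_g2_split L -> ~ is_g2_compact L.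
Proof.
by move=> [_ _ sig] [_ neg _]; have := signature_bound neg sig.
Qed.

End Main.

Theorem proposition5p9 (R : realType) :
  [/\ [/\ real_form (Der3 (Omega0 R)) (DerOct R[i]),
          real_form (Der3 (Omega1 R)) (DerOct R[i])
        & ~ lie_iso (Der3 (Omega0 R)) (Der3 (Omega1 R))],
      forall L : lieAlgType R, real_form L (DerOct R[i]) ->
        lie_iso L (Der3 (Omega0 R)) \/ lie_iso L (Der3 (Omega1 R)),
      forall L : lieVectType R,
        lie_iso (Der3 (Omega0 R)) L <-> is_g2_split L
    & forall L : lieVectType R,
        lie_iso (Der3 (Omega1 R)) L <-> is_g2_compact L].
Proof.
have m0 := Der3_model (Omega0 R); have m1 := Der3_model (Omega1 R).
have iso_of (A B : lieAlgType R) w mu nu : mx_model (L := A) (der_mx w) mu ->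
    mx_model (L := B) (der_mx w) nu -> lie_iso A B.
  by move=> mA mB; exact: (mx_model_iso mA mB).
have cls (L : lieAlgType R) : real_form L (DerOct R[i]) ->
    lie_iso L (Der3 (Omega0 R)) \/ lie_iso L (Der3 (Omega1 R)).
  by case/real_form_model => -[nu mod_nu]; [left | right];
    [exact: iso_of mod_nu m0 | exact: iso_of mod_nu m1].
split=> //.
- split; [exact: Omega0_real_form m0 | exact: Omega1_real_form m1 |].
  move=> iso; have [nu mod_nu] := iso_mx_model (lie_iso_sym iso) m0.
  exact: split_not_compact (model_split mod_nu) (model_compact m1).
- move=> L; split=> [iso|sL].
    by have [nu mod_nu] := iso_mx_model (lie_iso_sym iso) m0; exact: model_split mod_nu.
  have [real _ _] := sL; case: (real_form_model real) => -[nu mod_nu].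
    exact: iso_of m0 mod_nu.
  by case: (split_not_compact sL (model_compact mod_nu)).
- move=> L; split=> [iso|cL].
    by have [nu mod_nu] := iso_mx_model (lie_iso_sym iso) m1; exact: model_compact mod_nu.
  have [real _ _] := cL; case: (real_form_model real) => -[nu mod_nu].
    by case: (split_not_compact (model_split mod_nu) cL).
  exact: iso_of m1 mod_nu.
Qed.
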